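(* Let $n\ge1$. There is no algorithm that, given a finite group presentation $\langle S\mid R\rangle$, decides whether $H^n_{(\infty)}(\langle S\mid R\rangle;\mathbb{R})=0$.
   Context: For a group $G$, $H^\bullet_{(\infty)}(G;\mathbb{R}):=H^\bullet(G;\ell^\infty(G,\mathbb{R}))$, the ordinary group cohomology with coefficients in the $\mathbb{R}[G]$-module of bounded real functions on $G$ with action $(g\cdot f)(h)=f(g^{-1}h)$. *)

(* Defs.v *)
From Stdlib Require Import Reals List Arith.
Import ListNotations.
Open Scope R_scope.

(* A letter is (generator index, inverted?); a word is a list of letters.   *)
Definition letter := (nat * bool)%type.
Definition word := list letter.

(* A finite presentation <S | R>: S = {0,...,k-1}, R a finite list of words. *)
Record presentation := Pres { pgens : nat; prels : list word }.

Definition valid_word (P : presentation) (w : word) : Prop :=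
  Forall (fun l : letter => (fst l < pgens P)%nat) w.

Definition valid_pres (P : presentation) : Prop :=
  Forall (valid_word P) (prels P).

Inductive geq (P : presentation) : word -> word -> Prop :=
| geq_refl w : geq P w w
| geq_sym u v : geq P u v -> geq P v u
| geq_trans u v w : geq P u v -> geq P v w -> geq P u w
| geq_cancel u v a b : geq P (u ++ (a, b) :: (a, negb b) :: v) (u ++ v)
| geq_rel u v r : In r (prels P) -> geq P (u ++ r ++ v) (u ++ v).

Definition winv (w : word) : word :=
  rev (map (fun l : letter => (fst l, negb (snd l))) w).

(* An n-cochain is c : (nat -> word) -> word -> R, where c gs is the bounded
   function on G attached to the n-tuple (gs 0, ..., gs (n-1)). *)
Definition tuple_valid (P : presentation) (gs : nat -> word) : Prop :=
  forall i, valid_word P (gs i).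

Definition is_cochain (P : presentation) (n : nat)
  (c : (nat -> word) -> word -> R) : Prop :=
  (forall gs hs h h',
      (forall i, (i < n)%nat ->
         valid_word P (gs i) /\ valid_word P (hs i) /\ geq P (gs i) (hs i)) ->
      valid_word P h -> valid_word P h' -> geq P h h' ->
      c gs h = c hs h') /\
  (forall gs, tuple_valid P gs ->
      exists M, forall h, valid_word P h -> Rabs (c gs h) <= M).

Fixpoint rsum (m : nat) (f : nat -> R) : R :=
  match m with O => 0 | S m' => rsum m' f + f m' end.

Definition tshift (gs : nat -> word) : nat -> word := fun j => gs (S j).

Definition tmerge (i : nat) (gs : nat -> word) : nat -> word :=
  fun j => if (j <? i)%nat then gs j
           else if (j =? i)%nat then gs i ++ gs (S i) else gs (S j).

(* Inhomogeneous (bar) coboundary C^m -> C^(m+1), with (g.f)(h) = f(g^-1 h):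
   (dc)(g0..gm)(h) = c(g1..gm)(g0^-1 h)
                    + sum_{i<m} (-1)^(i+1) c(g0..,g_i g_(i+1),..gm)(h)
                    + (-1)^(m+1) c(g0..g_(m-1))(h). *)
Definition coboundary (m : nat) (c : (nat -> word) -> word -> R)
  : (nat -> word) -> word -> R :=
  fun gs h =>
    c (tshift gs) (winv (gs O) ++ h)
    + rsum m (fun i => (-1) ^ (S i) * c (tmerge i gs) h)
    + (-1) ^ (S m) * c gs h.

(* H^n(G; l^oo(G,R)) = 0 for n >= 1 : every cocycle is a coboundary. *)
Definition Hinf_vanishes (P : presentation) (n : nat) : Prop :=
  forall c, is_cochain P n c ->
    (forall gs h, tuple_valid P gs -> valid_word P h ->
       coboundary n c gs h = 0) ->
    exists b, is_cochain P (pred n) b /\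
      forall gs h, tuple_valid P gs -> valid_word P h ->
        c gs h = coboundary (pred n) b gs h.

Inductive prf : Type :=
| PZero | PSucc | PProj (i : nat) | PComp (f : prf) (gs : list prf)
| PRec (f g : prf) | PMu (f : prf).

Inductive peval : prf -> list nat -> nat -> Prop :=
| ev_zero v : peval PZero v 0
| ev_succ x v : peval PSucc (x :: v) (S x)
| ev_proj i v : peval (PProj i) v (nth i v 0%nat)
| ev_comp f gs v ys y :
    pevals gs v ys -> peval f ys y -> peval (PComp f gs) v y
| ev_rec0 f g v y : peval f v y -> peval (PRec f g) (0%nat :: v) y
| ev_recS f g n v z y :
    peval (PRec f g) (n :: v) z -> peval g (n :: z :: v) y ->
    peval (PRec f g) (S n :: v) y
| ev_mu f v n :
    peval f (n :: v) 0%nat ->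
    (forall m, (m < n)%nat -> exists k, peval f (m :: v) (S k)) ->
    peval (PMu f) v n
with pevals : list prf -> list nat -> list nat -> Prop :=
| evs_nil v : pevals nil v nil
| evs_cons g gs v y ys :
    peval g v y -> pevals gs v ys -> pevals (g :: gs) v (y :: ys).

Definition cpair (x y : nat) : nat := ((x + y) * (x + y + 1) / 2 + y)%nat.

Fixpoint code_list (l : list nat) : nat :=
  match l with nil => O | x :: l' => S (cpair x (code_list l')) end.

Definition code_letter (l : letter) : nat :=
  (2 * fst l + (if snd l then 1 else 0))%nat.

Definition code_word (w : word) : nat := code_list (map code_letter w).

Definition code_pres (P : presentation) : nat :=
  cpair (pgens P) (code_list (map code_word (prels P))).

Definition decides (e : prf) (Q : presentation -> Prop) : Prop :=
  forall P, valid_pres P ->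
    (Q P -> peval e [code_pres P] 1%nat) /\
    (~ Q P -> peval e [code_pres P] 0%nat).

(* Main.v *)
Require Import Defs.
From Stdlib Require Import Reals List Arith.
From Stdlib Require Import ZArith Lia Lra Wf_nat Classical FinFun.
From Stdlib Require Import FunctionalExtensionality PropExtensionality ProofIrrelevance ClassicalEpsilon.
Import ListNotations.

(* A machine that halts on a given input is turned into a finite presentation of the trivial group,
   and one that does not into a presentation of an infinite group G.  Taking the direct product of n
   copies separates the two cases: for the trivial group H^n vanishes, whereas for G^n the cup product
   of the classes of the n word norms, c_j(g)(h) = |g^-1 h|_j - |h|_j, is nonzero: evaluated on an
   n-cube of geodesics of length L it gives L^n, while a bounded primitive gives O(L^(n-1)).

   Configurations of the machine are points (p, v) of N x Z^d, registers being encoded so that each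
   step is an affine map between cosets of sublattices.  The group has commuting translations x_i,
   lamps t_p, one stable letter per step conjugating the corresponding lamps, and an element k
   commuting with the stable letters and with the lamp of the halting configuration.  Hence k
   commutes with the lamp c of the input if the machine halts; otherwise a Heisenberg-type group in
   which k commutes exactly with the lamps of halting configurations shows that [k,c] has infinite
   order.  Finally [k,c] is tied to all generators by amalgamations over Z^2 with the braid group
   B_3, where the meridian kills the whole group, so that [k,c] = 1 collapses everything.

   A decision procedure would itself be such a machine; feeding it its own presentation gives the
   contradiction. *)

(** * Groups *)

(** Self-reference needs no recursion theorem. The machine is built from the decision procedure and
    [n] alone, and it determines the number of generators and all relators except one per copy. The
    exceptional relators only place the lamp [c] at the input configuration, so they can be computed
    from the input. The input consists of two numbers: the number of generators and the code of all
    other relators. From these the machine reassembles the code of its own presentation.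

    Killing one commutator has to kill arbitrarily many generators, but an amalgamation with B_3
    over Z^2 passes death on to one further element only. The missing link is a stable letter z that
    doubles infinitely many coordinates of a free abelian group: z = 1 turns each relation z e = e^2
    z into e = 1.

    In the proof that the cup product is nonzero, lowering the degree turns an exact primitive into
    an approximate one. The induction therefore runs over primitives with relative error eps, for
    every eps > 0, against one bound that does not depend on eps. *)

Record group := Group {
  car :> Type;
  mul : car -> car -> car;
  one : car;
  inv : car -> car;
  mulA : forall x y z, mul x (mul y z) = mul (mul x y) z;
  mul1g : forall x, mul one x = x;
  mulVg : forall x, mul (inv x) x = one }.

Arguments mul {g} _ _.
Arguments one {g}.
Arguments inv {g} _.

Declare Scope grp_scope.
Delimit Scope grp_scope with g.
Infix "*" := mul (at level 40, left associativity) : grp_scope.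
Notation "1" := one : grp_scope.
Bind Scope grp_scope with car.

Section GroupTheory.
Variable G : group.
Implicit Types x y z : G.
Local Open Scope grp_scope.

Lemma mulKg x y : inv x * (x * y) = y.
Proof. now rewrite mulA, mulVg, mul1g. Qed.

Lemma mulgI x y z : x * y = x * z -> y = z.
Proof. intros H. now rewrite <- (mulKg x y), H, mulKg. Qed.

Lemma mulg1 x : x * 1 = x.
Proof. apply (mulgI (inv x)). now rewrite mulA, mulVg, mul1g. Qed.

Lemma mulgV x : x * inv x = 1.
Proof. apply (mulgI (inv x)). now rewrite mulKg, mulg1. Qed.

Lemma mulKVg x y : x * (inv x * y) = y.
Proof. now rewrite mulA, mulgV, mul1g. Qed.

Lemma mulAr x y z : x * y * z = x * (y * z).
Proof. now rewrite mulA. Qed.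

Lemma mulIg x y z : y * x = z * x -> y = z.
Proof.
  intros H. rewrite <- (mulg1 y), <- (mulgV x), mulA, H, <- mulA, mulgV.
  apply mulg1.
Qed.

Lemma inv_uniq x y : x * y = 1 -> y = inv x.
Proof. intros H. apply (mulgI x). now rewrite H, mulgV. Qed.

Lemma invK x : inv (inv x) = x.
Proof. symmetry. apply inv_uniq. apply mulVg. Qed.

Lemma invM x y : inv (x * y) = inv y * inv x.
Proof. symmetry. apply inv_uniq. now rewrite mulAr, mulKVg, mulgV. Qed.

Lemma inv1 : inv (1 : G) = 1.
Proof. symmetry. apply inv_uniq. apply mul1g. Qed.

Lemma idem1 x : x * x = x -> x = 1.
Proof. intros H. apply (mulgI x). now rewrite H, mulg1. Qed.

Lemma divg1_eq x y : x * inv y = 1 -> x = y.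
Proof. intros H. apply (mulIg (inv y)). now rewrite H, mulgV. Qed.

Definition comm x y := x * y = y * x.

Lemma comm_invl x y : comm x y -> comm (inv x) y.
Proof.
  unfold comm; intros H. apply (mulgI x). rewrite mulKVg, mulA, H, mulAr, mulgV.
  now rewrite mulg1.
Qed.

Lemma comm_mull x y z : comm x z -> comm y z -> comm (x * y) z.
Proof. unfold comm; intros H1 H2. now rewrite mulAr, H2, mulA, H1, mulAr. Qed.

Lemma comm_sym x y : comm x y -> comm y x.
Proof. unfold comm; auto. Qed.

Lemma comm_1l x : comm 1 x.
Proof. unfold comm. now rewrite mul1g, mulg1. Qed.

Lemma comm_refl x : comm x x.
Proof. reflexivity. Qed.

Lemma comm_mulr x y z : comm x y -> comm x z -> comm x (y * z).
Proof. intros; apply comm_sym, comm_mull; now apply comm_sym. Qed.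

Fixpoint npow x (n : nat) : G :=
  match n with O => 1 | S n' => x * npow x n' end.

Lemma comm_npow x y n : comm x y -> comm (npow x n) y.
Proof.
  intros H; induction n as [|n IH]; simpl; [apply comm_1l|now apply comm_mull].
Qed.


Lemma npow_Sr x n : npow x (S n) = npow x n * x.
Proof. symmetry; apply (comm_npow x x n (comm_refl x)). Qed.

Definition zpow x (n : Z) : G :=
  match n with
  | Z0 => 1
  | Zpos p => npow x (Pos.to_nat p)
  | Zneg p => inv (npow x (Pos.to_nat p))
  end.

Lemma zpow_nat x n : zpow x (Z.of_nat n) = npow x n.
Proof.
  destruct n; [reflexivity|]. simpl Z.of_nat. unfold zpow.
  now rewrite SuccNat2Pos.id_succ.
Qed.

Lemma zpow_negnat x n : zpow x (- Z.of_nat n) = inv (npow x n).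
Proof.
  destruct n; [simpl; now rewrite inv1|]. simpl Z.of_nat. simpl Z.opp. unfold zpow.
  now rewrite SuccNat2Pos.id_succ.
Qed.

Lemma zpow1 x : zpow x 1 = x.
Proof. simpl. apply mulg1. Qed.

Lemma zpow_succ x n : zpow x (n + 1) = x * zpow x n.
Proof.
  destruct (Z_le_gt_dec 0 n) as [H|H].
  - rewrite <- (Z2Nat.id n) by lia.
    replace (Z.of_nat (Z.to_nat n) + 1)%Z with (Z.of_nat (S (Z.to_nat n))) by lia.
    now rewrite !zpow_nat.
  - replace n with (- Z.of_nat (S (Z.to_nat (- n - 1))))%Z by lia.
    set (m := Z.to_nat (- n - 1)).
    replace (- Z.of_nat (S m) + 1)%Z with (- Z.of_nat m)%Z by lia.
    rewrite !zpow_negnat, npow_Sr, invM. now rewrite mulKVg.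
Qed.

Lemma zpow_pred x n : zpow x (n - 1) = inv x * zpow x n.
Proof.
  replace n with ((n - 1) + 1)%Z at 2 by lia. now rewrite zpow_succ, mulKg.
Qed.

Lemma Z_step_ind (P : Z -> Prop) :
  P 0%Z -> (forall n, P n -> P (n + 1)%Z) -> (forall n, P n -> P (n - 1)%Z) ->
  forall n, P n.
Proof.
  intros H0 H1 H2. apply Z.bi_induction; auto; try (intros ? ? ->; reflexivity).
  intros n; split; intros H.
  - replace (Z.succ n) with (n + 1)%Z by lia; auto.
  - replace n with (Z.succ n - 1)%Z by lia; auto.
Qed.

Lemma zpow_add x m n : zpow x (m + n) = zpow x m * zpow x n.
Proof.
  revert m; apply Z_step_ind.
  - now rewrite mul1g.
  - intros m IH. replace (m + 1 + n)%Z with (m + n + 1)%Z by lia.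
    now rewrite !zpow_succ, IH, mulA.
  - intros m IH. replace (m - 1 + n)%Z with (m + n - 1)%Z by lia.
    now rewrite !zpow_pred, IH, mulA.
Qed.

Lemma zpow_comm x y n : comm x y -> comm (zpow x n) y.
Proof.
  intros H. destruct n; simpl; [apply comm_1l|now apply comm_npow|].
  now apply comm_invl, comm_npow.
Qed.

Lemma zpow_opp x n : zpow x (- n) = inv (zpow x n).
Proof. apply inv_uniq. rewrite <- zpow_add. now replace (n + - n)%Z with 0%Z by lia. Qed.

Lemma one_zpow n : zpow 1 n = 1.
Proof.
  revert n; apply Z_step_ind; [reflexivity| |]; intros n IH.
  - now rewrite zpow_succ, IH, mulg1.
  - now rewrite zpow_pred, IH, mulg1, inv1.
Qed.

Definition conjg x y := x * y * inv x.

Lemma conj_mul x y z : conjg x (y * z) = conjg x y * conjg x z.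
Proof. unfold conjg. now rewrite !mulAr, mulKg. Qed.

Lemma conj_inv x y : conjg x (inv y) = inv (conjg x y).
Proof. unfold conjg. now rewrite !invM, invK, mulAr. Qed.

Lemma conj_1 x : conjg x 1 = 1.
Proof. unfold conjg. now rewrite mulg1, mulgV. Qed.

Lemma conj_zpow x y n : conjg x (zpow y n) = zpow (conjg x y) n.
Proof.
  revert n; apply Z_step_ind; [apply conj_1| |]; intros n IH.
  - now rewrite !zpow_succ, conj_mul, IH.
  - now rewrite !zpow_pred, conj_mul, conj_inv, IH.
Qed.

Lemma conj_eq x y z : x * y = z * x -> conjg x y = z.
Proof. unfold conjg. intros ->. now rewrite mulAr, mulgV, mulg1. Qed.

Lemma conjM x y z : conjg (x * y) z = conjg x (conjg y z).
Proof. unfold conjg. now rewrite invM, !mulAr. Qed.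

Lemma zpow_mul2 x n : zpow (x * x) n = zpow x (2 * n).
Proof.
  revert n; apply Z_step_ind; [reflexivity| |]; intros n IH.
  - replace (2 * (n + 1))%Z with (2 * n + 1 + 1)%Z by lia. now rewrite !zpow_succ, IH, !mulA.
  - replace (2 * (n - 1))%Z with (2 * n - 1 - 1)%Z by lia.
    now rewrite !zpow_pred, IH, invM, !mulA.
Qed.

End GroupTheory.

Arguments comm {G} x y.
Arguments npow {G} x n.
Arguments zpow {G} x n.
Arguments conjg {G} x y.

(** * Embeddings and HNN extensions *)

Record emb (G H : group) := Emb {
  efun :> G -> H;
  embM : forall x y, efun (x * y)%g = (efun x * efun y)%g;
  emb_inj : forall x y, efun x = efun y -> x = y }.

Arguments efun {G H} e x.
Arguments embM {G H} e x y.
Arguments emb_inj {G H} e x y.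
Arguments Emb {G H} efun embM emb_inj.

Section EmbTheory.
Local Open Scope grp_scope.

Lemma emb1 G H (f : emb G H) : f 1 = 1.
Proof. apply idem1. now rewrite <- embM, mul1g. Qed.

Lemma embV G H (f : emb G H) x : f (inv x) = inv (f x).
Proof. apply inv_uniq. now rewrite <- embM, mulgV, emb1. Qed.

Lemma emb_zpow G H (f : emb G H) x n : f (zpow x n) = zpow (f x) n.
Proof.
  revert n; apply Z_step_ind; [apply emb1| |]; intros n IH.
  - now rewrite !zpow_succ, embM, IH.
  - now rewrite !zpow_pred, embM, IH, embV.
Qed.

Definition emb_comp G H K (f : emb H K) (g : emb G H) : emb G K.
Proof.
  refine (Emb (fun x => f (g x)) _ _).
  - intros; now rewrite !embM.
  - intros x y E. now apply emb_inj, emb_inj in E.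
Defined.

Definition emb_id G : emb G G := Emb (fun x : G => x) (fun _ _ => eq_refl) (fun _ _ E => E).

Lemma hom_ker_inj (G H : group) (f : G -> H) :
  (forall x y, f (x * y) = f x * f y) -> (forall x, f x = 1 -> x = 1) ->
  forall x y, f x = f y -> x = y.
Proof.
  intros M K x y E. apply divg1_eq, K.
  rewrite M, E, <- M, mulgV. apply idem1. now rewrite <- M, mul1g.
Qed.

Record perm (X : Type) := Perm {
  pf : X -> X; pb : X -> X;
  pfb : forall x, pf (pb x) = x;
  pbf : forall x, pb (pf x) = x }.

Lemma perm_eq X (p q : perm X) : (forall x, pf X p x = pf X q x) -> p = q.
Proof.
  intros E. assert (E1 : pf X p = pf X q) by now apply functional_extensionality.
  assert (E2 : pb X p = pb X q).
  { apply functional_extensionality. intros x.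
    rewrite <- (pfb X q x) at 1. rewrite <- E1. apply pbf. }
  destruct p, q; simpl in *; subst. f_equal; apply proof_irrelevance.
Qed.

Definition sym_group (X : Type) : group.
Proof.
  refine (Group (perm X)
    (fun p q => Perm X (fun x => pf X p (pf X q x)) (fun x => pb X q (pb X p x)) _ _)
    (Perm X (fun x => x) (fun x => x) (fun _ => eq_refl) (fun _ => eq_refl))
    (fun p => Perm X (pb X p) (pf X p) (pbf X p) (pfb X p)) _ _ _).
  - intros; apply perm_eq; reflexivity.
  - intros; apply perm_eq; reflexivity.
  - intros; apply perm_eq; intros; simpl; apply pbf.
  Unshelve.
  + intros; now rewrite !pfb.
  + intros; now rewrite !pbf.
Defined.

Lemma pf_mul X (p q : sym_group X) x : pf X (p * q) x = pf X p (pf X q x).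
Proof. reflexivity. Qed.

Section Transversal.
Variables (A G : group) (al : emb A G).

(** The choice is made from the right coset of [g] as a predicate, so all elements of one coset get
    literally the same representative. *)
Definition rep (g : G) : G :=
  epsilon (inhabits 1) (fun c => exists a, g = al a * c).

Definition coef (g : G) : A :=
  epsilon (inhabits 1) (fun a => g = al a * rep g).

Lemma coef_rep g : g = al (coef g) * rep g.
Proof.
  unfold coef. apply (epsilon_spec (inhabits 1) (fun a => g = al a * rep g)).
  unfold rep. apply (epsilon_spec (inhabits 1) (fun c => exists a, g = al a * c)).
  exists g, 1. now rewrite emb1, mul1g.
Qed.

Lemma rep_mul a g : rep (al a * g) = rep g.
Proof.
  unfold rep. f_equal. apply functional_extensionality; intros c.
  apply propositional_extensionality; split; intros [b E].
  - exists (inv a * b). now rewrite embM, embV, mulAr, <- E, mulKg.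
  - exists (a * b). now rewrite embM, mulAr, <- E.
Qed.

Lemma rep_rep g : rep (rep g) = rep g.
Proof. rewrite <- (rep_mul (coef g) (rep g)). now rewrite <- coef_rep. Qed.

Lemma coef_mul a g : coef (al a * g) = a * coef g.
Proof.
  apply (emb_inj al). apply (mulIg _ (rep g)).
  rewrite <- (rep_mul a g) at 1. rewrite <- coef_rep, embM, mulAr.
  now rewrite <- coef_rep.
Qed.

Lemma coef_fix c : rep c = c -> coef c = 1.
Proof.
  intros E. apply (emb_inj al). apply (mulIg _ c).
  rewrite emb1, mul1g. rewrite <- E at 2. symmetry; apply coef_rep.
Qed.

Definition reps := {c : G | rep c = c}.
Definition mkrep (g : G) : reps := exist _ (rep g) (rep_rep g).

Lemma mkrep_eq g (c : reps) : rep g = proj1_sig c -> mkrep g = c.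
Proof. destruct c as [c H]; simpl; intros; subst. unfold mkrep. f_equal. apply proof_irrelevance. Qed.

Lemma rep_al_rep a (c : reps) : rep (al a * proj1_sig c) = proj1_sig c.
Proof. rewrite rep_mul. apply (proj2_sig c). Qed.

Lemma coef_al_rep a (c : reps) : coef (al a * proj1_sig c) = a.
Proof. rewrite coef_mul, coef_fix, mulg1; [reflexivity|apply (proj2_sig c)]. Qed.
End Transversal.

Definition scons {X : Type} (x : X) (f : nat -> X) (n : nat) : X :=
  match n with O => x | S m => f m end.

Lemma scons_eta X (f : nat -> X) : scons (f O) (fun n => f (S n)) = f.
Proof. apply functional_extensionality; intros [|]; reflexivity. Qed.

(* The free action of [G] on [X] restricts along [al] and along [be] to isomorphic [A]-sets: the
   orbit spaces are [C1 * C1^nat * C2^nat] and [C2 * C1^nat * C2^nat], and shifting a coordinate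
   between the sequences identifies both with [C1^nat * C2^nat].  This makes the stable letter an
   explicit permutation of [X], so no normal forms (Britton's lemma) are needed. *)
Section HNN.
Variables (A G : group) (al be : emb A G).

Let X : Type := (G * (nat -> reps A G al) * (nat -> reps A G be))%type.

Let fwd (t : X) : X :=
  let '(g, f1, f2) := t in
  (be (coef A G al g) * proj1_sig (f2 O), scons (mkrep A G al g) f1, fun n => f2 (S n)).

Let bwd (t : X) : X :=
  let '(g, f1, f2) := t in
  (al (coef A G be g) * proj1_sig (f1 O), fun n => f1 (S n), scons (mkrep A G be g) f2).

Let fwd_bwd t : fwd (bwd t) = t.
Proof.
  destruct t as [[g f1] f2]; unfold fwd, bwd.
  rewrite coef_al_rep. rewrite (mkrep_eq _ _ _ _ (f1 O) (rep_al_rep _ _ _ _ _)).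
  rewrite scons_eta. simpl proj1_sig. now rewrite <- coef_rep.
Qed.

Let bwd_fwd t : bwd (fwd t) = t.
Proof.
  destruct t as [[g f1] f2]; unfold fwd, bwd.
  rewrite coef_al_rep. rewrite (mkrep_eq _ _ _ _ (f2 O) (rep_al_rep _ _ _ _ _)).
  rewrite scons_eta. simpl proj1_sig. now rewrite <- coef_rep.
Qed.

Let trans (h : G) : sym_group X.
Proof.
  refine (Perm X (fun '(g, f1, f2) => (h * g, f1, f2)) (fun '(g, f1, f2) => (inv h * g, f1, f2)) _ _).
  - intros [[g f1] f2]. now rewrite mulKVg.
  - intros [[g f1] f2]. now rewrite mulKg.
Defined.

(** Left multiplication by [al a] changes only the [al]-coefficient of a point, which [fwd] turns
    into a [be]-coefficient; this is the relation for the stable letter. The embedding is injective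
    because [G] acts freely on the first coordinate. *)
Lemma hnn : exists (H : group) (io : emb G H) (r : H), forall a, r * io (al a) = io (be a) * r.
Proof.
  unshelve eexists (sym_group X), (Emb trans _ _), (Perm X fwd bwd fwd_bwd bwd_fwd).
  - intros x y; apply perm_eq; intros [[g f1] f2]; simpl. now rewrite mulA.
  - intros x y E.
    assert (E1 : pf X (trans x) (1, fun _ => mkrep A G al 1, fun _ => mkrep A G be 1) =
            pf X (trans y) (1, fun _ => mkrep A G al 1, fun _ => mkrep A G be 1)) by now rewrite E.
    simpl in E1. injection E1. now rewrite !mulg1.
  - intros a. apply perm_eq; intros [[g f1] f2]. rewrite !pf_mul. simpl.
    rewrite coef_mul, embM, mulA. f_equal. f_equal.
    f_equal. apply mkrep_eq. simpl. apply rep_mul.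
Qed.
End HNN.

(** * Adjoining solutions of finitely many problems *)

(* A condition on an element of an overgroup that every overgroup can be enlarged to satisfy,
   and that survives further enlargement. *)
Record problem (G : group) := Problem {
  solves : forall H : group, emb G H -> H -> Prop;
  solves_ext : forall H K (io : emb G H) (ka : emb H K) r,
    solves H io r -> solves K (emb_comp G H K ka io) (ka r);
  solvable : forall H (io : emb G H), exists K (ka : emb H K) r,
    solves K (emb_comp G H K ka io) r }.

Lemma solve_all G (ps : list (problem G)) :
  exists (H : group) (io : emb G H) (rs : nat -> H),
    forall j p, nth_error ps j = Some p -> solves G p H io (rs j).
Proof.
  induction ps as [|p ps (H & io & rs & IH)].
  - exists G, (emb_id G), (fun _ => 1). intros [|]; discriminate.
  - destruct (solvable G p H io) as (K & ka & r & Hr).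
    exists K, (emb_comp G H K ka io), (fun j => match j with O => r | S j => ka (rs j) end).
    intros [|j] q E; simpl in E.
    + now injection E as <-.
    + apply solves_ext. now apply IH.
Qed.

Definition hnn_problem A G (al be : emb A G) : problem G.
Proof.
  refine (Problem G (fun H io r => forall a, r * io (al a) = io (be a) * r) _ _).
  - intros H K io ka r E a. simpl. now rewrite <- !embM, E.
  - intros H io. destruct (hnn A H (emb_comp A G H io al) (emb_comp A G H io be)) as (K & ka & r & E).
    exists K, ka, r. exact E.
Defined.

Definition prod_group (G H : group) : group.
Proof.
  refine (Group (G * H) (fun x y => (fst x * fst y, snd x * snd y)) (1, 1)
    (fun x => (inv (fst x), inv (snd x))) _ _ _).
  - intros [] [] []; simpl; now rewrite !mulA.
  - intros []; simpl; now rewrite !mul1g.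
  - intros []; simpl; now rewrite !mulVg.
Defined.

Definition embl G H : emb G (prod_group G H).
Proof.
  refine (Emb (fun x => (x, 1) : prod_group G H) _ _).
  - intros; simpl; now rewrite mul1g.
  - intros x y E; now injection E.
Defined.

Definition embr G H : emb H (prod_group G H).
Proof.
  refine (Emb (fun x => (1, x) : prod_group G H) _ _).
  - intros; simpl; now rewrite mul1g.
  - intros x y E; now injection E.
Defined.

Definition Zn_group : group.
Proof.
  refine (Group (nat -> Z) (fun u v i => (u i + v i)%Z) (fun _ => 0%Z) (fun u i => (- u i)%Z) _ _ _);
    intros; apply functional_extensionality; intros; lia.
Defined.

Definition Z_group : group.
Proof.
  refine (Group Z Z.add 0%Z Z.opp _ _ _); intros; lia.
Defined.

Definition indep {G : group} (v u : G) :=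
  comm v u /\ forall i j, zpow v i * zpow u j = 1 -> i = 0%Z /\ j = 0%Z.

Lemma indep_emb G H (f : emb G H) v u : indep v u -> indep (f v) (f u).
Proof.
  intros [C I]; split.
  - unfold comm. now rewrite <- !embM, C.
  - intros i j E. apply I. apply (emb_inj f). now rewrite embM, !emb_zpow, emb1.
Qed.

Definition Z2_emb (G : group) (v u : G) (I : indep v u) : emb (prod_group Z_group Z_group) G.
Proof.
  assert (M : forall x y : prod_group Z_group Z_group,
    zpow v (fst (x * y)) * zpow u (snd (x * y)) =
    zpow v (fst x) * zpow u (snd x) * (zpow v (fst y) * zpow u (snd y))).
  { intros [a b] [c d]; simpl. rewrite !zpow_add, !mulAr. f_equal.
    rewrite !mulA. f_equal. apply zpow_comm, comm_sym, zpow_comm, comm_sym, (proj1 I). }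
  refine (Emb (fun x : prod_group Z_group Z_group => zpow v (fst x) * zpow u (snd x)) M _).
  apply hom_ker_inj; [exact M|].
  intros [a b] E. simpl in E. apply (proj2 I) in E as [-> ->]. reflexivity.
Defined.

Ltac triple := apply (f_equal2 pair); [apply (f_equal2 pair)|]; ring.

(* The braid group B_3 acts on Z^3 through SL_2(Z) and the exponent sum; the half-twist squared is
   central and independent of the generator [a]. *)
Lemma braid_pair : exists (V : group) (a b : V),
  a * b * a = b * a * b /\ indep a (a * b * a * (a * b * a)).
Proof.
  set (X := (Z * Z * Z)%type).
  unshelve eset (a := Perm X (fun '(x, y, n) => (x + y, y, n + 1)%Z)
     (fun '(x, y, n) => (x - y, y, n - 1)%Z) _ _ : sym_group X).
  1,2: intros [[x y] n]; triple.
  unshelve eset (b := Perm X (fun '(x, y, n) => (x, y - x, n + 1)%Z)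
     (fun '(x, y, n) => (x, y + x, n - 1)%Z) _ _ : sym_group X).
  1,2: intros [[x y] n]; triple.
  exists (sym_group X), a, b.
  assert (U : forall x y n, pf X (a * b * a * (a * b * a)) (x, y, n) = (-x, -y, n + 6)%Z).
  { intros; simpl; triple. }
  set (u := a * b * a * (a * b * a)) in *.
  assert (Pa : forall i x y n, pf X (zpow a i) (x, y, n) = (x + i * y, y, n + i)%Z).
  { intros i; pattern i; revert i; apply Z_step_ind.
    - intros; simpl; triple.
    - intros i IH x y n. rewrite zpow_succ, pf_mul, IH. simpl. triple.
    - intros i IH x y n. rewrite zpow_pred, pf_mul, IH. simpl. triple. }
  (* The factor [s] is a sign depending on the parity of [j]; it is left unspecified here and read
     off later from one point. *)
  assert (Pu : forall j, exists s, forall x y n, pf X (zpow u j) (x, y, n) = (s * x, s * y, n + 6 * j)%Z).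
  { intros j; pattern j; revert j; apply Z_step_ind.
    - exists 1%Z; intros; change (pf X (zpow u 0) (x, y, n)) with (x, y, n); triple.
    - intros j [s IH]. exists (- s)%Z. intros x y n. rewrite zpow_succ, pf_mul, IH, U. triple.
    - intros j [s IH]. exists (- s)%Z. intros x y n. rewrite zpow_pred, pf_mul, IH.
      transitivity (pf X (inv u) (pf X u (- s * x, - s * y, n + 6 * (j - 1))%Z)).
      + rewrite U. triple.
      + apply pbf. }
  split; [|split].
  - apply perm_eq; intros [[x y] n]; simpl; triple.
  - unfold comm. apply perm_eq; intros [[x y] n]. rewrite !pf_mul, U.
    change (pf X a (x, y, n)) with (x + y, y, n + 1)%Z. rewrite U. simpl. triple.
  - intros i j E. destruct (Pu j) as [s Hs].
    (* The point (0, 1, 0) is sent to (i s, s, i + 6 j), which forces s = 1, then i = 0 and j =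
       0. *)
    assert (E0 : pf X (zpow a i * zpow u j) (0, 1, 0)%Z = (0, 1, 0)%Z) by now rewrite E.
    rewrite pf_mul, Hs, Pa in E0.
    pose proof (f_equal (fun t => fst (fst t)) E0) as E1.
    pose proof (f_equal (fun t => snd (fst t)) E0) as E2.
    pose proof (f_equal snd E0) as E3. cbn [fst snd] in E1, E2, E3.
    assert (s = 1)%Z by lia. subst s. lia.
Qed.

(* Amalgamating the Z^2 spanned by (v,u) with the peripheral Z^2 of B_3: killing [v] then kills [u]. *)
Definition braid_problem (G : group) (v u : G) (I : indep v u) : problem G.
Proof.
  refine (Problem G (fun H io b =>
     io v * b * io v = b * io v * b /\ io u = io v * b * io v * (io v * b * io v)) _ _).
  - intros H K io ka b [E1 E2]; simpl. rewrite <- !embM, E2, E1. split; [reflexivity|].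
    reflexivity.
  - intros H io. destruct braid_pair as (V & a & b & R & J).
    (* The amalgam is replaced by an HNN extension of the direct product: the stable letter
       conjugates the pair in [V] to the pair in [H], and the conjugate of [b] becomes the
       solution. *)
    set (P := prod_group H V).
    set (al := emb_comp _ _ _ (embr H V) (Z2_emb V _ _ J)).
    set (be := emb_comp _ _ _ (embl H V) (Z2_emb H _ _ (indep_emb _ _ io _ _ I))).
    destruct (hnn _ _ al be) as (K & ka & r & E).
    exists K, (emb_comp _ _ _ ka (embl H V)), (conjg r (ka (embr H V b))).
    assert (Ev : conjg r (ka (embr H V a)) = ka (embl H V (io v))).
    { specialize (E (1, 0)%Z). apply conj_eq. simpl in E. rewrite !mulg1 in E. exact E. }
    assert (Eu : conjg r (ka (embr H V (a * b * a * (a * b * a)))) = ka (embl H V (io u))).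
    { specialize (E (0, 1)%Z). apply conj_eq. simpl in E. rewrite !mulg1, !mul1g in E. exact E. }
    cbn [efun emb_comp]. rewrite <- Ev. split.
    + rewrite <- !conj_mul, <- !embM. now rewrite R.
    + rewrite <- Eu. now rewrite <- !conj_mul, <- !embM.
Defined.
End EmbTheory.

(** * A Heisenberg-type lamplighter group *)

Section Lamplighter.
Open Scope Z_scope.

Definition vec := nat -> Z.
Definition vadd (u v : vec) : vec := fun i => u i + v i.
Definition vsub (u v : vec) : vec := fun i => u i - v i.
Definition vopp (u : vec) : vec := fun i => - u i.
Definition v0 : vec := fun _ => 0.
Definition basis (i : nat) : vec := fun j => if (j =? i)%nat then 1 else 0.

Ltac vext := apply functional_extensionality; intros ?; unfold vadd, vsub, vopp, v0; try lia.

Lemma vadd0 u : vadd u v0 = u. Proof. vext. Qed.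
Lemma vadd0l u : vadd v0 u = u. Proof. vext. Qed.
Lemma vaddA u v w : vadd u (vadd v w) = vadd (vadd u v) w. Proof. vext. Qed.
Lemma vaddC u v : vadd u v = vadd v u. Proof. vext. Qed.

Lemma fext2 (Q : Type) (f g : Q -> vec -> Z) : (forall q u, f q u = g q u) -> f = g.
Proof. intros H. apply functional_extensionality; intros q. apply functional_extensionality; auto. Qed.

Lemma fext1 (f g : vec -> Z) : (forall u, f u = g u) -> f = g.
Proof. apply functional_extensionality. Qed.

(* [hK] and [hT] stand for (infinite) formal sums of translates of [k] and of lamps, recorded
   through their pairing with functions, so that no finiteness bookkeeping is needed. *)
Record lamp_elt (Q : Type) := LampElt {
  hv : vec;
  hK : (vec -> Z) -> Z;
  hT : (Q -> vec -> Z) -> Z;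
  hs : Z;
  hTadd : forall f g, hT (fun q u => f q u + g q u) = hT f + hT g }.

Arguments LampElt {Q}. Arguments hv {Q}. Arguments hK {Q}. Arguments hT {Q}. Arguments hs {Q}.
Arguments hTadd {Q}.

Lemma lamp_eq Q (x y : lamp_elt Q) :
  hv x = hv y -> (forall f, hK x f = hK y f) -> (forall f, hT x f = hT y f) -> hs x = hs y -> x = y.
Proof.
  destruct x as [v K T s A], y as [v' K' T' s' A']; simpl; intros -> EK ET ->.
  apply functional_extensionality in EK. apply functional_extensionality in ET. subst.
  f_equal; apply proof_irrelevance.
Qed.

Lemma hT0 Q (x : lamp_elt Q) : hT x (fun _ _ => 0) = 0.
Proof. pose proof (hTadd x (fun _ _ => 0) (fun _ _ => 0)) as E. simpl in E. lia. Qed.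

Lemma hTopp Q (x : lamp_elt Q) f : hT x (fun q u => - f q u) = - hT x f.
Proof.
  pose proof (hTadd x f (fun q u => - f q u)) as E. cbv beta in E.
  rewrite (fext2 Q (fun q u => f q u + - f q u) (fun _ _ => 0)), hT0 in E by (intros; lia). lia.
Qed.

Section Group.
Variables (Q : Type) (chi : Q -> vec -> Z).

(** Elements are in the normal form: central part, lamps, translates of [k], translation. To
    multiply, the lamps of [y] are shifted by the translation of [x] and then moved to the left of
    the [k]-part of [x]. Passing a lamp at (q, u) over a translate of [k] at d costs the central
    element [chi q (u - d)]. *)
Definition lmul (x y : lamp_elt Q) : lamp_elt Q.
Proof.
  refine (LampElt (vadd (hv x) (hv y))
    (fun f => hK x f + hK y (fun d => f (vadd d (hv x))))
    (fun f => hT x f + hT y (fun q u => f q (vadd u (hv x))))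
    (hs x + hs y + hT y (fun q u => hK x (fun d => chi q (vsub (vadd u (hv x)) d)))) _).
  intros f g. rewrite !hTadd. lia.
Defined.

Definition lone : lamp_elt Q.
Proof. refine (LampElt v0 (fun _ => 0) (fun _ => 0) 0 _). reflexivity. Defined.

Definition linv (x : lamp_elt Q) : lamp_elt Q.
Proof.
  refine (LampElt (vopp (hv x))
    (fun f => - hK x (fun d => f (vsub d (hv x))))
    (fun f => - hT x (fun q u => f q (vsub u (hv x))))
    (- hs x + hT x (fun q u => hK x (fun d => chi q (vsub u d)))) _).
  intros f g. rewrite hTadd. lia.
Defined.

Definition lamp_group : group.
Proof.
  refine (Group (lamp_elt Q) lmul lone linv _ _ _).
  - intros x y z. apply lamp_eq; simpl.
    + apply vaddA.
    + intros f. rewrite Z.add_assoc. do 2 f_equal. apply fext1; intros d. f_equal; vext.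
    + intros f. rewrite Z.add_assoc. do 2 f_equal. apply fext2; intros q u. f_equal; vext.
    + rewrite hTadd.
      replace (hT z (fun q u => hK x (fun d => chi q (vsub (vadd u (vadd (hv x) (hv y))) d))))
        with (hT z (fun q u => hK x (fun d => chi q (vsub (vadd (vadd u (hv y)) (hv x)) d)))).
      2: { f_equal. apply fext2; intros q u. f_equal. apply fext1; intros d. f_equal; vext. }
      replace (hT z (fun q u => hK y (fun d => chi q (vsub (vadd u (vadd (hv x) (hv y))) (vadd d (hv x))))))
        with (hT z (fun q u => hK y (fun d => chi q (vsub (vadd u (hv y)) d)))).
      2: { f_equal. apply fext2; intros q u. f_equal. apply fext1; intros d. f_equal; vext. }
      lia.
  - intros x. apply lamp_eq; simpl.
    + apply vadd0l.
    + intros f. f_equal. apply fext1; intros d. now rewrite vadd0.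
    + intros f. f_equal. apply fext2; intros q u. now rewrite vadd0.
    + rewrite hT0. lia.
  - intros x. apply lamp_eq; simpl.
    + vext.
    + intros f. replace (fun d => f (vadd d (vopp (hv x)))) with (fun d => f (vsub d (hv x))).
      * lia.
      * apply fext1; intros d. f_equal; vext.
    + intros f. replace (fun q u => f q (vadd u (vopp (hv x)))) with (fun q u => f q (vsub u (hv x))).
      * lia.
      * apply fext2; intros q d. f_equal; vext.
    + rewrite hTopp.
      replace (hT x (fun q u => hK x (fun d => chi q (vsub (vadd u (vopp (hv x))) (vsub d (hv x))))))
        with (hT x (fun q u => hK x (fun d => chi q (vsub u d)))).
      * lia.
      * f_equal. apply fext2; intros q u. f_equal. apply fext1; intros d. f_equal; vext.
Defined.

Definition transl (v : vec) : lamp_group.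
Proof. refine (LampElt v (fun _ => 0) (fun _ => 0) 0 _). reflexivity. Defined.

Definition lamp (q : Q) (u : vec) : lamp_group.
Proof. refine (LampElt v0 (fun _ => 0) (fun f => f q u) 0 _). reflexivity. Defined.

Definition kelt : lamp_group.
Proof. refine (LampElt v0 (fun f => f v0) (fun _ => 0) 0 _). reflexivity. Defined.

Definition central (s : Z) : lamp_group.
Proof. refine (LampElt v0 (fun _ => 0) (fun _ => 0) s _). reflexivity. Defined.

Lemma transl_add u v : transl (vadd u v) = (transl u * transl v)%g.
Proof. apply lamp_eq; reflexivity. Qed.

Lemma transl_lamp v q u : (transl v * lamp q u = lamp q (vadd u v) * transl v)%g.
Proof. apply lamp_eq; simpl; intros; try lia. now rewrite vadd0, vadd0l. Qed.

Lemma central_add s t : central (s + t) = (central s * central t)%g.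
Proof. apply lamp_eq; simpl; intros; try lia. now rewrite vadd0. Qed.


(** The purpose of the construction. For the [chi] of a machine, which is 0 on configurations that
    reach the halting one and 1 elsewhere, [k] commutes with exactly the lamps of halting
    configurations. *)
Lemma kelt_lamp q u : (kelt * lamp q u = central (chi q u) * (lamp q u * kelt))%g.
Proof.
  apply lamp_eq; simpl; intros.
  - now rewrite !vadd0.
  - now rewrite !vadd0, Z.add_0_r.
  - now rewrite !vadd0, ?Z.add_0_r.
  - replace (vsub (vadd u v0) v0) with u by vext. lia.
Qed.

Lemma central_zpow s n : zpow (central s) n = central (n * s).
Proof.
  revert n; apply Z_step_ind; [reflexivity| |]; intros n IH.
  - rewrite zpow_succ, IH, <- central_add. f_equal. lia.
  - rewrite zpow_pred, IH. apply (mulgI _ (central s)). rewrite mulKVg, <- central_add. f_equal. lia.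
Qed.
End Group.

(** [Li] is only a left inverse: for doubling it is halving rounded down, which is also the
    decrement of the machine encoding. *)
Record vlin := VLin {
  L :> vec -> vec;
  Li : vec -> vec;
  Ladd : forall u v, L (vadd u v) = vadd (L u) (L v);
  Lsub : forall u v, L (vsub u v) = vsub (L u) (L v);
  LK : forall u, Li (L u) = u }.

Definition vid : vlin.
Proof. now refine (VLin (fun u => u) (fun u => u) _ _ _). Defined.

Definition dbl (i : nat) : vlin.
Proof.
  refine (VLin (fun u j => if (j =? i)%nat then 2 * u j else u j)
    (fun u j => if (j =? i)%nat then u j / 2 else u j) _ _ _);
    intros; apply functional_extensionality; intros j; unfold vadd, vsub; destruct (j =? i)%nat; try lia.
  rewrite Z.mul_comm. now apply Z_div_mult.
Defined.

Lemma L0 (l : vlin) : l v0 = v0.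
Proof.
  replace v0 with (vsub v0 v0) at 1 by vext. rewrite Lsub. vext.
Qed.

(** The image contains [k], the translations by vectors [l v], and the lamps in state [p] over the
    coset [l u + c]. Two such embeddings with the same [chi'] give an isomorphism between two
    subgroups that acts on lamps as an affine step of the machine; [E] makes it respect the
    commutators with [k]. *)
Definition lamp_emb (chi : nat -> vec -> Z) (chi' : unit -> vec -> Z) (p : nat) (l : vlin) (c : vec)
  (E : forall u, chi p (vadd (l u) c) = chi' tt u) :
  emb (lamp_group unit chi') (lamp_group nat chi).
Proof.
  refine (Emb (fun x : lamp_group unit chi' => LampElt (l (hv x)) (fun f => hK x (fun d => f (l d)))
     (fun f => hT x (fun _ u => f p (vadd (l u) c))) (hs x) _ : lamp_group nat chi) _ _).
  - intros x y. apply lamp_eq; simpl.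
    + apply Ladd.
    + intros f. do 2 f_equal. apply fext1; intros d. now rewrite Ladd.
    + intros f. do 2 f_equal. apply fext2; intros q u. f_equal. rewrite Ladd. vext.
    + f_equal. f_equal. apply fext2; intros [] u. f_equal. apply fext1; intros d.
      rewrite <- E. f_equal. rewrite Lsub, Ladd. vext.
  - intros x y Exy. apply lamp_eq.
    + apply (f_equal hv) in Exy. simpl in Exy. now rewrite <- (LK l (hv x)), Exy, LK.
    + intros f. apply (f_equal (fun z => hK z (fun d => f (Li l d)))) in Exy. simpl in Exy.
      rewrite (fext1 (fun d => f (Li l (l d))) f) in Exy; [exact Exy|intros; now rewrite LK].
    + intros f. apply (f_equal (fun z => hT z (fun _ u => f tt (Li l (vsub u c))))) in Exy. simpl in Exy.
      rewrite (fext2 unit (fun _ u => f tt (Li l (vsub (vadd (l u) c) c))) f) in Exy; [exact Exy|].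
      intros [] u. f_equal. replace (vsub (vadd (l u) c) c) with (l u) by vext. now rewrite LK.
    + now apply (f_equal hs) in Exy.
  Unshelve. intros f g. apply (hTadd x).
Defined.

Section LampEmb.
Variables (chi : nat -> vec -> Z) (chi' : unit -> vec -> Z) (p : nat) (l : vlin) (c : vec)
  (E : forall u, chi p (vadd (l u) c) = chi' tt u).
Let f := lamp_emb chi chi' p l c E.

Lemma lamp_emb_transl v : f (transl _ _ v) = transl _ _ (l v).
Proof. now apply lamp_eq. Qed.

Lemma lamp_emb_lamp u : f (lamp _ _ tt u) = lamp _ _ p (vadd (l u) c).
Proof. apply lamp_eq; try reflexivity. apply L0. Qed.

Lemma lamp_emb_kelt : f (kelt _ _) = kelt _ _.
Proof. apply lamp_eq; simpl; intros; now rewrite ?L0. Qed.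
End LampEmb.

(** Both rules lead from state [p] to state [q]. [RInc] doubles coordinate [i] and adds 1; [RZero]
    changes no coordinate but applies only where coordinate [i] is even. *)
Inductive rule := RInc (p q i : nat) | RZero (p q i : nat).

Definition compat (chi : nat -> vec -> Z) (r : rule) : Prop :=
  match r with
  | RInc p q i => forall u, chi p u = chi q (vadd (dbl i u) (basis i))
  | RZero p q i => forall u, chi p (dbl i u) = chi q (dbl i u)
  end.

Definition rule_rel {G : group} (d : nat) (x t : nat -> G) (k r : G) (ru : rule) : Prop :=
  match ru with
  | RInc p q i => (r * t p = x i * t q * inv (x i) * r /\ r * x i = x i * x i * r /\
      (forall j, (j < d)%nat -> j <> i -> r * x j = x j * r) /\ r * k = k * r)%g
  | RZero p q i => (r * t p = t q * r /\ r * (x i * x i) = x i * x i * r /\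
      (forall j, (j < d)%nat -> j <> i -> r * x j = x j * r) /\ r * k = k * r)%g
  end.

Lemma dbl_basis i : dbl i (basis i) = vadd (basis i) (basis i).
Proof.
  apply functional_extensionality; intros j; simpl; unfold vadd, basis.
  destruct (Nat.eqb_spec j i); lia.
Qed.

Lemma dbl_basis_neq i j : j <> i -> dbl i (basis j) = basis j.
Proof.
  intros N. apply functional_extensionality; intros m; simpl; unfold vadd, basis.
  destruct (Nat.eqb_spec m i), (Nat.eqb_spec m j); subst; lia.
Qed.

Definition rule_problem (chi : nat -> vec -> Z) (ru : rule) (C : compat chi ru) :
  problem (lamp_group nat chi).
Proof.
  destruct ru as [p q i|p q i].
  - refine (hnn_problem (lamp_group unit (fun _ => chi p)) _
      (lamp_emb chi _ p vid v0 _) (lamp_emb chi _ q (dbl i) (basis i) _)).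
    + intros u. now rewrite vadd0.
    + intros u. symmetry. apply C.
  (* A zero test moves no register; the doubling on both sides only restricts it to vectors whose
     [i]-th coordinate is even. *)
  - refine (hnn_problem (lamp_group unit (fun _ u => chi p (dbl i u))) _
      (lamp_emb chi _ p (dbl i) v0 _) (lamp_emb chi _ q (dbl i) v0 _)).
    + intros u. now rewrite vadd0.
    + intros u. rewrite vadd0. symmetry. apply C.
Defined.

Lemma rule_problem_rel d chi ru C H io r :
  solves _ (rule_problem chi ru C) H io r ->
  rule_rel d (fun i => io (transl _ _ (basis i))) (fun p => io (lamp _ _ p v0)) (io (kelt _ _)) r ru.
Proof.
  assert (Ex : forall i, io (transl nat chi (vadd (basis i) (basis i))) =
            (io (transl _ _ (basis i)) * io (transl _ _ (basis i)))%g).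
  { intros i. now rewrite transl_add, embM. }
  destruct ru as [p q i|p q i]; intros S; cbn [solves rule_problem hnn_problem] in S.
  - repeat split.
    + pose proof (S (lamp _ _ tt v0)) as E. rewrite !lamp_emb_lamp, !L0, !vadd0l in E.
      rewrite E. f_equal. rewrite <- embV, <- !embM. f_equal.
      rewrite transl_lamp, vadd0l, mulAr, mulgV, mulg1. reflexivity.
    + pose proof (S (transl _ _ (basis i))) as E. rewrite !lamp_emb_transl, dbl_basis in E.
      now rewrite <- Ex.
    + intros j _ N. pose proof (S (transl _ _ (basis j))) as E.
      rewrite !lamp_emb_transl, dbl_basis_neq in E by assumption. exact E.
    + pose proof (S (kelt _ _)) as E. now rewrite !lamp_emb_kelt in E.
  - repeat split.
    + pose proof (S (lamp _ _ tt v0)) as E. rewrite !lamp_emb_lamp, !L0, !vadd0l in E. exact E.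
    + pose proof (S (transl _ _ (basis i))) as E. rewrite !lamp_emb_transl, dbl_basis in E.
      now rewrite <- Ex.
    + intros j _ N. pose proof (S (transl _ _ (basis j))) as E.
      rewrite !lamp_emb_transl, dbl_basis_neq in E by assumption. exact E.
    + pose proof (S (kelt _ _)) as E. now rewrite !lamp_emb_kelt in E.
Qed.

Lemma rules_model d chi rules :
  (forall r, In r rules -> compat chi r) ->
  exists (G : group) (io : emb (lamp_group nat chi) G) (rs : nat -> G),
    forall j ru, nth_error rules j = Some ru ->
      rule_rel d (fun i => io (transl _ _ (basis i))) (fun p => io (lamp _ _ p v0)) (io (kelt _ _)) (rs j) ru.
Proof.
  intros C.
  assert (Hp : exists ps, forall j ru, nth_error rules j = Some ru ->
     exists C, nth_error ps j = Some (rule_problem chi ru C)).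
  { induction rules as [|ru rules IH].
    - exists []. intros [|]; discriminate.
    - destruct IH as [ps IH]; [intros; apply C; now right|].
      exists (rule_problem chi ru (C ru (or_introl eq_refl)) :: ps).
      intros [|j] r E; simpl in *; [injection E as <-; eauto|now apply IH]. }
  destruct Hp as [ps Hp]. destruct (solve_all _ ps) as (G & io & rs & S).
  exists G, io, rs. intros j ru E. destruct (Hp j ru E) as [C' E'].
  eapply rule_problem_rel, S, E'.
Qed.
End Lamplighter.

(** * Counter machines *)

Inductive instr := INC (i q : nat) | DEC (i q z : nat).

Definition config := (nat * vec)%type.

(* A register holding [r] is encoded by the integer [2^r-1], so that "register [i] is zero" is a
   parity condition, which a finitely generated subgroup of Z^d can express. *)
Definition zstep (prog : list instr) (c : config) : option config :=
  match nth_error prog (fst c) with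
  | Some (INC i q) => Some (q, vadd (dbl i (snd c)) (basis i))
  | Some (DEC i q z) =>
      if Z.odd (snd c i) then Some (q, Li (dbl i) (snd c)) else Some (z, snd c)
  | None => None
  end.

(** The target is one single configuration, with all coordinates 0, and not merely the label [halt].
    Thus one relation, that [k] commutes with the lamp of [halt], covers all halting computations;
    the price is that the machine must erase its registers before halting. *)
Inductive reach (prog : list instr) (halt : nat) : config -> Prop :=
| reach_halt : reach prog halt (halt, v0)
| reach_step c c' : zstep prog c = Some c' -> reach prog halt c' -> reach prog halt c.

Definition chi (prog : list instr) (halt : nat) (p : nat) (v : vec) : Z :=
  if excluded_middle_informative (reach prog halt (p, v)) then 0%Z else 1%Z.

(** A decrement from [p] to [q] is an increment from [q] to [p] read backwards, and conjugation by a
    stable letter can be undone, so [RInc q p i] serves for it. *)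
Definition instr_rules (p : nat) (a : instr) : list rule :=
  match a with
  | INC i q => [RInc p q i]
  | DEC i q z => [RInc q p i; RZero p z i]
  end.

Definition rules (prog : list instr) : list rule :=
  flat_map (fun p => match nth_error prog p with Some a => instr_rules p a | None => [] end)
    (seq 0 (length prog)).

Lemma in_rules prog r :
  In r (rules prog) <-> exists p a, nth_error prog p = Some a /\ In r (instr_rules p a).
Proof.
  unfold rules. rewrite in_flat_map. split.
  - intros (p & _ & H). destruct (nth_error prog p) as [a|] eqn:E; [eauto|destruct H].
  - intros (p & a & E & H). exists p. rewrite E. split; [|exact H].
    apply in_seq. split; [lia|]. apply nth_error_Some. congruence.
Qed.

(** Stable letters act in both directions, so the halting set must be invariant in both. The forward
    direction holds because steps are deterministic and the halting label carries no instruction. *)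
Lemma reach_zstep prog halt c c' : nth_error prog halt = None ->
  zstep prog c = Some c' -> (reach prog halt c <-> reach prog halt c').
Proof.
  intros N S; split; intros H; [|eapply reach_step; eassumption].
  inversion H as [E|d d' S' H' E]; subst.
  - unfold zstep in S. simpl in S. rewrite N in S. discriminate.
  - rewrite S in S'. now injection S' as ->.
Qed.

Lemma chi_zstep prog halt p v q w : nth_error prog halt = None ->
  zstep prog (p, v) = Some (q, w) -> chi prog halt p v = chi prog halt q w.
Proof.
  intros N S. pose proof (reach_zstep _ _ _ _ N S) as R. unfold chi.
  destruct excluded_middle_informative, excluded_middle_informative; tauto.
Qed.

Lemma odd_dbl_basis i u : Z.odd (vadd (dbl i u) (basis i) i) = true.
Proof.
  unfold vadd, basis, dbl; cbn [L]. rewrite Nat.eqb_refl.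
  now rewrite Z.add_comm, Z.odd_add_mul_2.
Qed.

Lemma even_dbl i u : Z.odd (dbl i u i) = false.
Proof. unfold dbl; cbn [L]. rewrite Nat.eqb_refl. now rewrite <- (Z.add_0_l (2 * u i)), Z.odd_add_mul_2. Qed.

Lemma half_dbl_basis i u : Li (dbl i) (vadd (dbl i u) (basis i)) = u.
Proof.
  apply functional_extensionality; intros j. unfold vadd, basis, dbl; cbn [L Li]; cbv beta.
  destruct (j =? i)%nat; [|lia]. rewrite Z.mul_comm, Z_div_plus_full_l by lia. change (1 / 2)%Z with 0%Z. lia.
Qed.

Lemma dbl_half_odd i v : Z.odd (v i) = true -> vadd (dbl i (Li (dbl i) v)) (basis i) = v.
Proof.
  intros O. apply functional_extensionality; intros j. unfold vadd, basis, dbl; cbn [L Li]; cbv beta.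
  destruct (Nat.eqb_spec j i) as [->|]; [|lia].
  pose proof (Zdiv2_odd_eqn (v i)) as E. rewrite O, Z.div2_div in E. lia.
Qed.

Lemma dbl_half_even i v : Z.odd (v i) = false -> dbl i (Li (dbl i) v) = v.
Proof.
  intros O. apply functional_extensionality; intros j. unfold dbl; cbn [L Li]; cbv beta.
  destruct (Nat.eqb_spec j i) as [->|]; [|lia].
  pose proof (Zdiv2_odd_eqn (v i)) as E. rewrite O, Z.div2_div in E. lia.
Qed.

Lemma rules_compat prog halt r : nth_error prog halt = None ->
  In r (rules prog) -> compat (chi prog halt) r.
Proof.
  intros N I. apply in_rules in I as (p & a & E & I).
  destruct a as [i q|i q z]; simpl in I.
  - destruct I as [<-|[]]. intros u. apply (chi_zstep _ _ _ _ _ _ N).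
    unfold zstep; cbn [fst snd]. now rewrite E.
  - destruct I as [<-|[<-|[]]]; intros u.
    + symmetry. apply (chi_zstep _ _ _ _ _ _ N). unfold zstep; cbn [fst snd].
      now rewrite E, odd_dbl_basis, half_dbl_basis.
    + apply (chi_zstep _ _ _ _ _ _ N). unfold zstep; cbn [fst snd].
      now rewrite E, even_dbl.
Qed.

(** * Halting computations inside the group *)

Section Halting.
Local Open Scope nat_scope.
Local Open Scope grp_scope.
Variables (G : group) (d : nat) (x t : nat -> G) (k : G).
Hypothesis xC : forall i j, i < d -> j < d -> comm (x i) (x j).

Fixpoint xprod (d : nat) (v : vec) : G :=
  match d with O => 1 | S d' => xprod d' v * zpow (x d') (v d') end.

Lemma xprod_comm e v g : (forall i, i < e -> comm (x i) g) -> comm (xprod e v) g.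
Proof.
  induction e as [|e IH]; intros H; simpl; [apply comm_1l|].
  apply comm_mull; [apply IH; auto|apply zpow_comm; auto].
Qed.

Lemma xprod_add e u v : e <= d -> xprod e (vadd u v) = xprod e u * xprod e v.
Proof.
  induction e as [|e IH]; intros H; simpl; [now rewrite mul1g|].
  rewrite IH by lia. unfold vadd at 1. rewrite zpow_add.
  assert (C : comm (xprod e v) (zpow (x e) (u e))).
  { apply xprod_comm. intros i Hi. apply comm_sym, zpow_comm, xC; lia. }
  unfold comm in C. rewrite !mulAr. f_equal. rewrite !mulA. f_equal. exact C.
Qed.

Lemma xprod_zero e v : (forall i, i < e -> v i = 0%Z) -> xprod e v = 1.
Proof.
  induction e as [|e IH]; intros H; simpl; [reflexivity|].
  rewrite IH by auto. rewrite H by lia. apply mulg1.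
Qed.

Lemma xprod_basis e i : i < e -> xprod e (basis i) = x i.
Proof.
  induction e as [|e IH]; intros H; simpl; [lia|].
  unfold basis at 2. destruct (Nat.eqb_spec e i) as [->|N].
  - rewrite xprod_zero, zpow1; [apply mul1g|].
    intros j Hj. unfold basis. destruct (Nat.eqb_spec j i); [lia|reflexivity].
  - rewrite IH by lia. apply mulg1.
Qed.

Lemma conj_xprod r e a b :
  (forall j, j < e -> conjg r (zpow (x j) (a j)) = zpow (x j) (b j)) -> conjg r (xprod e a) = xprod e b.
Proof.
  induction e as [|e IH]; intros H; simpl; [apply conj_1|].
  rewrite conj_mul, IH, H by auto. reflexivity.
Qed.

(** The lamp of the configuration (p, v), written with the generators. *)
Definition tt_at (p : nat) (v : vec) : G := conjg (xprod d v) (t p).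

Lemma conj_conj (r a b : G) : conjg r (conjg a b) = conjg (conjg r a) (conjg r b).
Proof. unfold conjg. now rewrite !invM, !invK, !mulAr, !mulKg. Qed.

Lemma comm_conj_iff (r a b : G) : comm (conjg r a) (conjg r b) <-> comm a b.
Proof.
  unfold comm. rewrite <- !conj_mul. split; [|now intros ->].
  unfold conjg. intros E. apply mulIg, mulgI in E. exact E.
Qed.

Lemma conj_self_comm (r a : G) : comm r a -> conjg r a = a.
Proof. intros C. now apply conj_eq. Qed.

(** Conjugation by [r] fixes [k] and carries the lamp of a configuration to the lamp of its
    successor: it squares [x i], which doubles the coordinate, and the extra [x i] in the relation
    for [t p] adds the 1. *)
Lemma rinc_comm p q i r u : i < d -> rule_rel d x t k r (RInc p q i) ->
  comm (tt_at p u) k <-> comm (tt_at q (vadd (dbl i u) (basis i))) k.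
Proof.
  intros Hi (E1 & E2 & E3 & E4).
  rewrite <- (comm_conj_iff r (tt_at p u)). rewrite (conj_self_comm r k E4).
  replace (conjg r (tt_at p u)) with (tt_at q (vadd (dbl i u) (basis i))); [reflexivity|].
  unfold tt_at. rewrite conj_conj, xprod_add, xprod_basis by lia. rewrite conjM. f_equal.
  - symmetry. apply conj_xprod. intros j Hj. rewrite conj_zpow.
    unfold dbl; cbn [L]. destruct (Nat.eqb_spec j i) as [->|N].
    + rewrite (conj_eq _ _ _ _ E2). apply zpow_mul2.
    + now rewrite (conj_eq _ _ _ _ (E3 j Hj N)).
  - symmetry. now apply conj_eq.
Qed.

Lemma rzero_comm p q i r u : rule_rel d x t k r (RZero p q i) ->
  comm (tt_at p (dbl i u)) k <-> comm (tt_at q (dbl i u)) k.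
Proof.
  intros (E1 & E2 & E3 & E4).
  rewrite <- (comm_conj_iff r (tt_at p _)). rewrite (conj_self_comm r k E4).
  replace (conjg r (tt_at p (dbl i u))) with (tt_at q (dbl i u)); [reflexivity|].
  unfold tt_at. rewrite conj_conj. f_equal.
  - symmetry. apply conj_xprod. intros j Hj.
    unfold dbl; cbn [L]. destruct (Nat.eqb_spec j i) as [->|N].
    + rewrite <- zpow_mul2, conj_zpow. now rewrite (conj_eq _ _ _ _ E2).
    + now rewrite conj_zpow, (conj_eq _ _ _ _ (E3 j Hj N)).
  - symmetry. now apply conj_eq.
Qed.

(** The commutation with [k] is pulled back along the computation, starting from its last
    configuration. *)
Lemma reach_comm prog halt :
  (forall r, In r (rules prog) -> exists g, rule_rel d x t k g r) ->
  (forall p a i, nth_error prog p = Some a -> (exists q, a = INC i q) \/ (exists q z, a = DEC i q z) -> i < d) ->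
  comm (t halt) k ->
  forall c, reach prog halt c -> comm (tt_at (fst c) (snd c)) k.
Proof.
  intros HR Hd Hk c R. induction R as [|[p v] c' S R IH].
  - simpl. unfold tt_at. rewrite xprod_zero by reflexivity. unfold conjg.
    now rewrite mul1g, inv1, mulg1.
  - unfold zstep in S. cbn [fst snd] in *. destruct (nth_error prog p) as [[i q|i q z]|] eqn:E; [| |discriminate].
    + injection S as <-. cbn [fst snd] in IH.
      destruct (HR (RInc p q i)) as [g Hg].
      { apply in_rules. exists p, (INC i q). simpl; auto. }
      apply (rinc_comm p q i g); eauto.
    + destruct (Z.odd (v i)) eqn:O; injection S as <-; cbn [fst snd] in IH.
      * destruct (HR (RInc q p i)) as [g Hg].
        { apply in_rules. exists p, (DEC i q z). simpl; auto. }
        rewrite <- (dbl_half_odd i v O). apply (rinc_comm q p i g); eauto.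
      * destruct (HR (RZero p z i)) as [g Hg].
        { apply in_rules. exists p, (DEC i q z). simpl; auto. }
        rewrite <- (dbl_half_even i v O) in IH |- *. now apply (rzero_comm p z i g).
Qed.
End Halting.

(** * Compiling recursive functions to counter machines *)

Section Compile.
Local Open Scope bool_scope.
Local Open Scope nat_scope.

Inductive cmd := Inc (i : nat) | Seq (a b : cmd) | Loop (i : nat) (c : cmd).

Definition store := nat -> nat.
Definition upd (s : store) (i n : nat) : store := fun j => if j =? i then n else s j.

Inductive exec : cmd -> store -> store -> Prop :=
| ex_inc i s : exec (Inc i) s (upd s i (S (s i)))
| ex_seq a b s1 s2 s3 : exec a s1 s2 -> exec b s2 s3 -> exec (Seq a b) s1 s3
| ex_loop0 i c s : s i = 0 -> exec (Loop i c) s s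
| ex_loopS i c r s s1 s2 : s i = S r -> exec c (upd s i r) s1 -> exec (Loop i c) s1 s2 ->
    exec (Loop i c) s s2.

Fixpoint clen (c : cmd) : nat :=
  match c with Inc _ => 1 | Seq a b => clen a + clen b | Loop _ c => S (clen c) end.

Fixpoint compile (c : cmd) (off ex : nat) : list instr :=
  match c with
  | Inc i => [INC i ex]
  | Seq a b => compile a off (off + clen a) ++ compile b (off + clen a) ex
  | Loop i c => DEC i (S off) ex :: compile c (S off) off
  end.

Lemma compile_length c off ex : length (compile c off ex) = clen c.
Proof.
  revert off ex; induction c; intros; simpl; [reflexivity| |].
  - now rewrite length_app, IHc1, IHc2.
  - now rewrite IHc.
Qed.

Definition enc (s : store) : vec := fun i => (2 ^ Z.of_nat (s i) - 1)%Z.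

Inductive steps (prog : list instr) : config -> config -> Prop :=
| steps_refl c : steps prog c c
| steps_step c1 c2 c3 : zstep prog c1 = Some c2 -> steps prog c2 c3 -> steps prog c1 c3.

Lemma steps_trans prog a b c : steps prog a b -> steps prog b c -> steps prog a c.
Proof. induction 1; intros; [assumption|eapply steps_step; eauto]. Qed.

Definition placed (prog : list instr) (off : nat) (code : list instr) :=
  forall j a, nth_error code j = Some a -> nth_error prog (off + j) = Some a.

Lemma placed_app prog off c1 c2 :
  placed prog off (c1 ++ c2) -> placed prog off c1 /\ placed prog (off + length c1) c2.
Proof.
  intros H; split; intros j a E.
  - apply H. rewrite nth_error_app1; [exact E|]. apply nth_error_Some. congruence.
  - rewrite <- Nat.add_assoc. apply H. rewrite nth_error_app2 by lia.
    now replace (length c1 + j - length c1) with j by lia.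
Qed.

Lemma placed_cons prog off a c :
  placed prog off (a :: c) -> nth_error prog off = Some a /\ placed prog (S off) c.
Proof.
  intros H; split.
  - rewrite <- (Nat.add_0_r off). now apply H.
  - intros j b E. replace (S off + j) with (off + S j) by lia. now apply H.
Qed.

Lemma enc_succ s i : enc (upd s i (S (s i))) = vadd (dbl i (enc s)) (basis i).
Proof.
  apply functional_extensionality; intros j. unfold enc, upd, vadd, dbl, basis; cbn [L]; cbv beta.
  destruct (Nat.eqb_spec j i) as [->|]; [|lia].
  rewrite Nat2Z.inj_succ, Z.pow_succ_r by lia. lia.
Qed.

Lemma zstep_inc prog p i q s : nth_error prog p = Some (INC i q) ->
  zstep prog (p, enc s) = Some (q, enc (upd s i (S (s i)))).
Proof. intros E. unfold zstep; cbn [fst snd]. now rewrite E, enc_succ. Qed.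

Lemma zstep_dec0 prog p i q z s : nth_error prog p = Some (DEC i q z) -> s i = 0 ->
  zstep prog (p, enc s) = Some (z, enc s).
Proof. intros E H. unfold zstep; cbn [fst snd]. rewrite E. unfold enc at 1. now rewrite H. Qed.

Lemma upd_same s i : upd s i (s i) = s.
Proof.
  apply functional_extensionality; intros j. unfold upd. now destruct (Nat.eqb_spec j i) as [->|].
Qed.

Lemma upd_upd s i a b : upd (upd s i a) i b = upd s i b.
Proof.
  apply functional_extensionality; intros j. unfold upd. now destruct (Nat.eqb_spec j i).
Qed.

Lemma upd_eq s i a : upd s i a i = a.
Proof. unfold upd. now rewrite Nat.eqb_refl. Qed.

Lemma zstep_decS prog p i q z s r : nth_error prog p = Some (DEC i q z) -> s i = S r ->
  zstep prog (p, enc s) = Some (q, enc (upd s i r)).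
Proof.
  intros E H. unfold zstep; cbn [fst snd]. rewrite E.
  replace (enc s) with (vadd (dbl i (enc (upd s i r))) (basis i)).
  - now rewrite odd_dbl_basis, half_dbl_basis.
  - replace s with (upd (upd s i r) i (S (upd s i r i))) at 2; [now rewrite enc_succ|].
    rewrite upd_eq, upd_upd, <- H. apply upd_same.
Qed.

Lemma compile_correct c s s' : exec c s s' -> forall prog off ex,
  placed prog off (compile c off ex) -> steps prog (off, enc s) (ex, enc s').
Proof.
  induction 1 as [i s|a b s1 s2 s3 _ IH1 _ IH2|i c s E|i c r s s1 s2 E _ IH1 _ IH2];
    intros prog off ex P; simpl in P.
  - apply placed_cons in P as [P _]. eapply steps_step; [apply zstep_inc, P|apply steps_refl].
  - apply placed_app in P as [P1 P2]. rewrite compile_length in P2.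
    eapply steps_trans; [apply IH1, P1|apply IH2, P2].
  - apply placed_cons in P as [P _]. eapply steps_step; [eapply zstep_dec0; eassumption|apply steps_refl].
  - pose proof P as P'. apply placed_cons in P' as [P1 P2].
    eapply steps_step; [eapply zstep_decS; eassumption|].
    eapply steps_trans; [apply IH1, P2|]. apply IH2. exact P.
Qed.

Ltac st := apply functional_extensionality; intros ?j; unfold upd;
  repeat (match goal with |- context [?a =? ?b] => destruct (Nat.eqb_spec a b) end);
  subst; auto; try lia; try congruence.

Lemma exec_eq c s s1 s2 : exec c s s1 -> s1 = s2 -> exec c s s2.
Proof. now intros ? <-. Qed.

(** The language has no skip command; a loop on a register that is known to be zero takes its place,
    which is why many commands carry such a register. *)
Definition noop (z : nat) := Loop z (Inc z).
Definition clear (r z : nat) := Loop r (noop z).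
Definition move (a b : nat) := Loop a (Inc b).
Definition copy (a b tmp : nat) := Seq (Loop a (Seq (Inc b) (Inc tmp))) (move tmp a).

Lemma noop_spec z s : s z = 0 -> exec (noop z) s s.
Proof. apply ex_loop0. Qed.

Lemma clear_spec r z s : r <> z -> s z = 0 -> exec (clear r z) s (upd s r 0).
Proof.
  intros N Z0. remember (s r) as n eqn:E. revert s Z0 E.
  induction n as [|n IH]; intros s Z0 E.
  - rewrite E, upd_same. apply ex_loop0. now symmetry.
  - eapply ex_loopS; [symmetry; exact E|apply noop_spec; unfold upd; destruct (Nat.eqb_spec z r); [congruence|assumption]|].
    rewrite <- (upd_upd s r n 0). apply IH; [|now rewrite upd_eq].
    unfold upd; destruct (Nat.eqb_spec z r); [congruence|assumption].
Qed.

Lemma move_spec a b s : a <> b -> exec (move a b) s (upd (upd s b (s b + s a)) a 0).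
Proof.
  intros N. remember (s a) as n eqn:E. revert s E.
  induction n as [|n IH]; intros s E.
  - eapply exec_eq; [apply ex_loop0; now symmetry|]. st.
  - eapply ex_loopS; [symmetry; exact E|apply ex_inc|].
    eapply exec_eq; [apply IH|].
    + unfold upd. rewrite Nat.eqb_refl. now destruct (Nat.eqb_spec a b).
    + st.
Qed.

Lemma copy_spec a b tmp s : a <> b -> a <> tmp -> b <> tmp -> s tmp = 0 ->
  exec (copy a b tmp) s (upd s b (s b + s a)).
Proof.
  intros N1 N2 N3 T.
  assert (H : forall n s, n = s a ->
    exec (Loop a (Seq (Inc b) (Inc tmp))) s (upd (upd (upd s b (s b + n)) tmp (s tmp + n)) a 0)).
  { clear s T. induction n as [|n IH]; intros s E.
    - eapply exec_eq; [apply ex_loop0; now symmetry|]. st.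
    - eapply ex_loopS; [symmetry; exact E|eapply ex_seq; apply ex_inc|].
      eapply exec_eq; [apply IH|].
      + unfold upd. rewrite Nat.eqb_refl. destruct (Nat.eqb_spec a b), (Nat.eqb_spec a tmp); congruence.
      + st. }
  eapply ex_seq; [apply (H _ s eq_refl)|].
  eapply exec_eq; [apply move_spec; auto|]. st.
Qed.

Fixpoint clears (b k z : nat) : cmd :=
  match k with O => noop z | S k' => Seq (clear b z) (clears (S b) k' z) end.

Lemma clears_spec k z : forall b s, b + k <= z -> s z = 0 ->
  exec (clears b k z) s (fun r => if (b <=? r) && (r <? b + k) then 0 else s r).
Proof.
  induction k as [|k IH]; intros b s H Z0; simpl.
  - eapply exec_eq; [now apply noop_spec|]. apply functional_extensionality; intros r.
    destruct (Nat.leb_spec b r), (Nat.ltb_spec r (b + 0)); simpl; auto; lia.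
  - eapply ex_seq; [apply clear_spec; [lia|assumption]|].
    eapply exec_eq; [apply IH; [lia|]|].
    + unfold upd. destruct (Nat.eqb_spec z b); [reflexivity|assumption].
    + apply functional_extensionality; intros r. unfold upd.
      destruct (Nat.leb_spec (S b) r), (Nat.ltb_spec r (S b + k)), (Nat.leb_spec b r),
        (Nat.ltb_spec r (b + S k)), (Nat.eqb_spec r b); simpl; auto; lia.
Qed.

(* Registers from [base] on are scratch space: zero before and after. *)
Fixpoint compile_prf (f : prf) (args : list nat) (dst base : nat) {struct f} : cmd :=
  match f with
  | PZero => noop base
  | PSucc => match args with a :: _ => Seq (copy a dst base) (Inc dst) | [] => noop base end
  | PProj i => if i <? length args then copy (nth i args 0) dst base else noop base
  | PComp f gs =>
      let k := length gs in
      Seq ((fix go (gs : list prf) (j : nat) : cmd :=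
             match gs with
             | [] => noop (base + k)
             | g :: gs' => Seq (compile_prf g args j (base + k)) (go gs' (S j))
             end) gs base)
        (Seq (compile_prf f (seq base k) dst (base + k)) (clears base k (base + k)))
  | PRec f g =>
      match args with
      | [] => noop base
      | n :: v =>
          let z := base + 2 in let z' := base + 3 in let b := base + 4 in
          Seq (copy n (base + 1) b) (Seq (compile_prf f v z b)
            (Seq (Loop (base + 1) (Seq (compile_prf g (base :: z :: v) z' b)
                    (Seq (clear z b) (Seq (move z' z) (Inc base)))))
              (Seq (move z dst) (clear base b))))
      end
  | PMu f =>
      let y := base + 1 in let b := base + 2 in
      Seq (compile_prf f (base :: args) y b)
        (Seq (Loop y (Seq (clear y b) (Seq (Inc base) (compile_prf f (base :: args) y b))))
          (move base dst))
  end.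

Definition comp_args (args : list nat) (b : nat) :=
  fix go (gs : list prf) (j : nat) : cmd :=
    match gs with [] => noop b | g :: gs' => Seq (compile_prf g args j b) (go gs' (S j)) end.

(** The whole final store is prescribed: arguments survive and scratch registers are zero again, so
    that calls compose. The destination has to start at zero because [copy] and [move] add to it. *)
Definition comp_ok (f : prf) := forall v y, peval f v y -> forall args dst base s,
  map s args = v -> Forall (fun a => a < base) args -> dst < base -> ~ In dst args ->
  s dst = 0 -> (forall j, base <= j -> s j = 0) ->
  exec (compile_prf f args dst base) s (upd s dst y).

Fixpoint updl (s : store) (b : nat) (ys : list nat) : store :=
  match ys with [] => s | y :: ys => updl (upd s b y) (S b) ys end.

Lemma updl_lt ys : forall s b r, r < b -> updl s b ys r = s r.
Proof.
  induction ys as [|y ys IH]; intros s b r H; simpl; [reflexivity|].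
  rewrite IH by lia. unfold upd. destruct (Nat.eqb_spec r b); [lia|reflexivity].
Qed.

Lemma updl_ge ys : forall s b r, b + length ys <= r -> updl s b ys r = s r.
Proof.
  induction ys as [|y ys IH]; intros s b r H; simpl in *; [reflexivity|].
  rewrite IH by lia. unfold upd. destruct (Nat.eqb_spec r b); [lia|reflexivity].
Qed.

Lemma updl_map ys : forall s b, map (updl s b ys) (seq b (length ys)) = ys.
Proof.
  induction ys as [|y ys IH]; intros s b; simpl; [reflexivity|].
  rewrite IH. f_equal. rewrite updl_lt by lia. apply upd_eq.
Qed.

Lemma map_upd_notin s i n l : ~ In i l -> map (upd s i n) l = map s l.
Proof.
  intros H. apply map_ext_in. intros a Ha. unfold upd.
  destruct (Nat.eqb_spec a i) as [->|]; [contradiction|reflexivity].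
Qed.

Lemma notin_lt i b l : Forall (fun a => a < b) l -> b <= i -> ~ In i l.
Proof. intros F H I. rewrite Forall_forall in F. apply F in I. lia. Qed.

Lemma comp_args_ok args b gs : Forall comp_ok gs -> forall v ys, pevals gs v ys ->
  forall j s, map s args = v -> Forall (fun a => a < j) args -> j + length gs <= b ->
  (forall r, j <= r -> s r = 0) ->
  exec (comp_args args b gs j) s (updl s j ys).
Proof.
  induction 1 as [|g gs Hg _ IH]; intros v ys E j s M F B Z0; inversion E; subst; simpl.
  - apply noop_spec, Z0. simpl in B. lia.
  - simpl in B. eapply ex_seq.
    + eapply Hg; [eassumption|reflexivity| | | | |].
      * eapply Forall_impl; [|exact F]. simpl; intros; lia.
      * lia.
      * now apply (notin_lt j j).
      * apply Z0; lia.
      * intros; apply Z0; lia.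
    + eapply IH; [eassumption| | |lia|].
      * apply map_upd_notin. now apply (notin_lt j j).
      * eapply Forall_impl; [|exact F]. simpl; intros; lia.
      * intros r Hr. unfold upd. destruct (Nat.eqb_spec r j); [lia|apply Z0; lia].
Qed.

Fixpoint prf_ind' (P : prf -> Prop) (HZ : P PZero) (HS : P PSucc) (HP : forall i, P (PProj i))
  (HC : forall f gs, P f -> Forall P gs -> P (PComp f gs))
  (HR : forall f g, P f -> P g -> P (PRec f g)) (HM : forall f, P f -> P (PMu f)) (f : prf) : P f :=
  let rc := prf_ind' P HZ HS HP HC HR HM in
  match f with
  | PZero => HZ | PSucc => HS | PProj i => HP i
  | PComp f gs => HC f gs (rc f)
      ((fix go gs : Forall P gs := match gs with [] => Forall_nil P | g :: gs => Forall_cons g (rc g) (go gs) end) gs)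
  | PRec f g => HR f g (rc f) (rc g)
  | PMu f => HM f (rc f)
  end.

Lemma pevals_length gs v ys : pevals gs v ys -> length ys = length gs.
Proof. revert ys; induction gs; intros ys H; inversion H; subst; simpl; auto. Qed.

Lemma Forall_lt_weaken b c l : b <= c -> Forall (fun a => a < b) l -> Forall (fun a => a < c) l.
Proof. intros H. apply Forall_impl. intros; lia. Qed.

Lemma comp_ok_PComp f gs : comp_ok f -> Forall comp_ok gs -> comp_ok (PComp f gs).
Proof.
  intros Hf Hgs v y E args dst base s M F D N S0 Z0. inversion E as [| | |f' gs' v' ys y' Eg Ef| | |]; subst.
  pose proof (pevals_length _ _ _ Eg) as Ly.
  change (compile_prf (PComp f gs) args dst base) with
    (Seq (comp_args args (base + length gs) gs base)
       (Seq (compile_prf f (seq base (length gs)) dst (base + length gs)) (clears base (length gs) (base + length gs)))).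
  eapply ex_seq; [eapply comp_args_ok; eauto|].
  eapply ex_seq.
  - eapply Hf; [exact Ef| | | | | |].
    + rewrite <- Ly. apply updl_map.
    + apply Forall_forall. intros a Ha. apply in_seq in Ha. lia.
    + lia.
    + rewrite in_seq. lia.
    + rewrite updl_lt; auto.
    + intros j Hj. rewrite updl_ge by lia. apply Z0. lia.
  - eapply exec_eq; [apply clears_spec; [lia|]|].
    + unfold upd. destruct (Nat.eqb_spec (base + length gs) dst); [lia|].
      rewrite updl_ge by lia. apply Z0. lia.
    + apply functional_extensionality; intros r. unfold upd.
      destruct (Nat.leb_spec base r), (Nat.ltb_spec r (base + length gs)), (Nat.eqb_spec r dst); simpl;
        subst; try lia; try (now rewrite Z0); try (now rewrite updl_lt).
      rewrite updl_ge by lia. reflexivity.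
Qed.

Lemma comp_ok_PRec f g : comp_ok f -> comp_ok g -> comp_ok (PRec f g).
Proof.
  intros Hf Hg v y E args dst base s M F D N S0 Z0.
  destruct args as [|n args]; [simpl in M; subst; inversion E|].
  simpl in M. subst v. cbn [compile_prf].
  inversion F as [|? ? Fn Fa]; subst.
  set (body := Seq (compile_prf g (base :: base + 2 :: args) (base + 3) (base + 4))
                    (Seq (clear (base + 2) (base + 4)) (Seq (move (base + 3) (base + 2)) (Inc base)))).
  (* State of the loop: [a] rounds done, [m] rounds left, current value [c]. *)
  set (X := fun a m c => upd (upd (upd s base a) (base + 1) m) (base + 2) c).
  assert (XM : forall a m c, map (X a m c) args = map s args).
  { intros. unfold X. rewrite !map_upd_notin; [reflexivity|..]; apply (notin_lt _ base); auto; lia. }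
  assert (Hbody : forall a m c c', peval g (a :: c :: map s args) c' ->
    exec body (X a m c) (X (S a) m c')).
  { intros a m c c' Eg. unfold body.
    eapply ex_seq; [eapply Hg; [exact Eg| | | | | |]|].
    - simpl. rewrite XM. f_equal; [|f_equal]; unfold X, upd;
        repeat match goal with |- context [?a =? ?b] => destruct (Nat.eqb_spec a b) end; lia.
    - repeat constructor; try lia. eapply Forall_lt_weaken; [|exact Fa]; lia.
    - lia.
    - simpl. intros [H|[H|H]]; try lia. eapply (notin_lt (base + 3) base); eauto; lia.
    - unfold X, upd. repeat match goal with |- context [?a =? ?b] => destruct (Nat.eqb_spec a b) end; try lia.
      apply Z0; lia.
    - intros j Hj. unfold X, upd. repeat match goal with |- context [?a =? ?b] => destruct (Nat.eqb_spec a b) end; try lia.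
      apply Z0; lia.
    - assert (B0 : s (base + 4) = 0) by (apply Z0; lia).
      assert (B3 : s (base + 3) = 0) by (apply Z0; lia).
      eapply ex_seq; [apply clear_spec; [lia|]|].
      { unfold X, upd. repeat match goal with |- context [?a =? ?b] => destruct (Nat.eqb_spec a b) end; lia. }
      eapply ex_seq; [apply move_spec; lia|].
      eapply exec_eq; [apply ex_inc|].
      unfold X. st. }
  (* The evaluation of [PRec] unfolds from the top while the loop counts upwards. The claim
     therefore prolongs a run backwards: a run from round [a] yields one from round 0. *)
  assert (Hloop : forall a y, peval (PRec f g) (a :: map s args) y ->
    exists y0, peval f (map s args) y0 /\ forall m s'',
      exec (Loop (base + 1) body) (X a m y) s'' -> exec (Loop (base + 1) body) (X 0 (a + m) y0) s'').
  { induction a as [|a IH]; intros y1 E1; inversion E1; subst.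
    - exists y1; auto.
    - destruct (IH z) as (y0 & Ey0 & H0); [assumption|]. exists y0; split; [exact Ey0|].
      intros m s'' Ex. replace (S a + m) with (a + S m) by lia. apply H0.
      eapply ex_loopS with (r := m); [| |exact Ex].
      2: { replace (upd (X a (S m) z) (base + 1) m) with (X a m z) by (unfold X; st). now apply Hbody. }
      unfold X, upd. repeat match goal with |- context [?a =? ?b] => destruct (Nat.eqb_spec a b) end; lia. }
  destruct (Hloop _ _ E) as (y0 & Ey0 & Hl). clear Hloop.
  assert (B0 : s (base + 4) = 0) by (apply Z0; lia).
  assert (B1 : s (base + 1) = 0) by (apply Z0; lia).
  assert (B2 : s (base + 2) = 0) by (apply Z0; lia).
  assert (BB : s base = 0) by (apply Z0; lia).
  eapply ex_seq; [apply copy_spec; [lia|lia|lia|exact B0]|].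
  eapply ex_seq; [eapply Hf; [exact Ey0| | | | | |]|].
  - apply map_upd_notin. apply (notin_lt _ base); auto; lia.
  - eapply Forall_lt_weaken; [|exact Fa]; lia.
  - lia.
  - apply (notin_lt _ base); auto; lia.
  - unfold upd. destruct (Nat.eqb_spec (base + 2) (base + 1)); [lia|exact B2].
  - intros j Hj. unfold upd. destruct (Nat.eqb_spec j (base + 1)); [lia|apply Z0; lia].
  - eapply ex_seq.
    + fold body.
      replace (upd (upd s (base + 1) (s (base + 1) + s n)) (base + 2) y0) with (X 0 (s n + 0) y0)
        by (unfold X; st).
      apply Hl. apply ex_loop0.
      unfold X, upd. repeat match goal with |- context [?a =? ?b] => destruct (Nat.eqb_spec a b) end; lia.
    + eapply ex_seq; [apply move_spec; lia|].
      eapply exec_eq; [apply clear_spec; [lia|]|].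
      * unfold X, upd. repeat match goal with |- context [?a =? ?b] => destruct (Nat.eqb_spec a b) end; lia.
      * unfold X. st.
Qed.

Lemma comp_ok_PMu f : comp_ok f -> comp_ok (PMu f).
Proof.
  intros Hf v y E args dst base s M F D N S0 Z0. inversion E as [| | | | | |f' v' n En Em]; subst.
  cbn [compile_prf].
  set (X := fun a m => upd (upd s base a) (base + 1) m).
  assert (B1 : s (base + 1) = 0) by (apply Z0; lia).
  assert (B2 : s (base + 2) = 0) by (apply Z0; lia).
  assert (BB : s base = 0) by (apply Z0; lia).
  assert (XM : forall a m, map (X a m) args = map s args).
  { intros. unfold X. rewrite !map_upd_notin; [reflexivity|..]; apply (notin_lt _ base); auto; lia. }
  assert (Hev : forall a c, peval f (a :: map s args) c ->
    exec (compile_prf f (base :: args) (base + 1) (base + 2)) (X a 0) (X a c)).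
  { intros a c Ef. eapply exec_eq; [eapply Hf; [exact Ef| | | | | |]|].
    - simpl. rewrite XM. f_equal. unfold X, upd.
      repeat match goal with |- context [?a =? ?b] => destruct (Nat.eqb_spec a b) end; lia.
    - constructor; [lia|]. eapply Forall_lt_weaken; [|exact F]; lia.
    - lia.
    - simpl. intros [H|H]; [lia|]. eapply (notin_lt (base + 1) base); eauto; lia.
    - apply upd_eq.
    - intros j Hj. unfold X, upd. repeat match goal with |- context [?a =? ?b] => destruct (Nat.eqb_spec a b) end; try lia.
      apply Z0; lia.
    - unfold X. apply upd_upd. }
  set (body := Seq (clear (base + 1) (base + 2)) (Seq (Inc base) (compile_prf f (base :: args) (base + 1) (base + 2)))).
  (* Induction on the distance [d] from the candidate [a] to the minimum. A positive value is first
     lowered by [Loop] itself and then cleared, so it triggers exactly one round. *)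
  assert (Hloop : forall d a, a + d = y -> exists c, peval f (a :: map s args) c /\
            exec (Loop (base + 1) body) (X a c) (X y 0)).
  { induction d as [|d IH]; intros a Ha.
    - replace a with y by lia. exists 0. split; [exact En|]. apply ex_loop0. apply upd_eq.
    - destruct (Em a) as [c Ec]; [lia|]. exists (S c). split; [exact Ec|].
      destruct (IH (S a)) as (c' & Ec' & Ex); [lia|].
      eapply ex_loopS; [apply upd_eq| |exact Ex].
      unfold body. eapply ex_seq; [apply clear_spec; [lia|]|].
      { unfold X, upd. repeat match goal with |- context [?a =? ?b] => destruct (Nat.eqb_spec a b) end; lia. }
      eapply ex_seq; [apply ex_inc|].
      match goal with |- exec _ ?s1 _ => replace s1 with (X (S a) 0) by (unfold X; st) end.
      now apply Hev. }
  destruct (Hloop y 0 eq_refl) as (c & Ec & Ex).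
  eapply ex_seq.
  - replace s with (X 0 0) at 1 by (unfold X; st). apply Hev, Ec.
  - eapply ex_seq; [exact Ex|].
    eapply exec_eq; [apply move_spec; lia|]. unfold X. st.
Qed.

Lemma comp_correct f : comp_ok f.
Proof.
  induction f using prf_ind'.
  - intros v y E args dst base s M F D N S0 Z0. inversion E; subst. simpl.
    eapply exec_eq; [apply noop_spec; auto|]. st.
  - intros v y E args dst base s M F D N S0 Z0. 
    destruct args as [|a args]; simpl in M; subst v; inversion E; subst.
    simpl in N. inversion F; subst. simpl.
    eapply ex_seq; [apply copy_spec; auto; lia|].
    eapply exec_eq; [apply ex_inc|]. st.
  - intros v y E args dst base s M F D N S0 Z0. inversion E; subst. simpl.
    destruct (Nat.ltb_spec i (length args)) as [H|H].
    + pose proof (nth_In args 0 H) as I. rewrite Forall_forall in F. pose proof (F _ I).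
      assert (nth i args 0 <> dst) by (intros Eq; rewrite Eq in I; contradiction).
      eapply exec_eq; [apply copy_spec; auto; lia|].
      rewrite (nth_indep (map s args) 0 (s 0)), map_nth by now rewrite length_map.
      st.
    + rewrite nth_overflow by now rewrite length_map.
      eapply exec_eq; [apply noop_spec; auto|]. st.
  - now apply comp_ok_PComp.
  - now apply comp_ok_PRec.
  - now apply comp_ok_PMu.
Qed.
End Compile.

(** * Recursive functions computing codes of presentations *)

Section Codes.
Local Open Scope nat_scope.

Lemma peval_c1 f g v a y : peval g v a -> peval f [a] y -> peval (PComp f [g]) v y.
Proof. intros; eapply ev_comp; [|eassumption]. repeat constructor. assumption. Qed.

Lemma peval_c2 f g h v a b y : peval g v a -> peval h v b -> peval f [a; b] y ->
  peval (PComp f [g; h]) v y.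
Proof. intros; eapply ev_comp; [|eassumption]. repeat constructor; assumption. Qed.

Lemma peval_proj i v y : nth i v 0 = y -> peval (PProj i) v y.
Proof. intros <-. constructor. Qed.

Fixpoint pconst (n : nat) : prf :=
  match n with O => PZero | S n => PComp PSucc [pconst n] end.

Lemma peval_const n v : peval (pconst n) v n.
Proof. induction n; simpl; [constructor|eapply peval_c1; [eassumption|constructor]]. Qed.

Definition padd : prf := PRec (PProj 0) (PComp PSucc [PProj 1]).

Lemma peval_add x y : peval padd [x; y] (x + y).
Proof.
  induction x as [|x IH]; simpl.
  - apply ev_rec0. now apply peval_proj.
  - eapply ev_recS; [exact IH|]. eapply peval_c1; [now apply peval_proj|constructor].
Qed.

(** Computes 2^n - 1, the integer that encodes a register holding n, hence the exponent with which
    that register enters the group. *)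
Definition ppow : prf := PRec PZero (PComp PSucc [PComp padd [PProj 1; PProj 1]]).

Lemma peval_pow n : peval ppow [n] (2 ^ n - 1).
Proof.
  induction n as [|n IH]; simpl.
  - apply ev_rec0. constructor.
  - eapply ev_recS; [exact IH|]. eapply peval_c1.
    + eapply peval_c2; [now apply peval_proj|now apply peval_proj|apply peval_add].
    + simpl. pose proof (Nat.pow_nonzero 2 n).
      replace (2 ^ n + (2 ^ n + 0) - 1) with (S (2 ^ n - 1 + (2 ^ n - 1))) by lia. constructor.
Qed.

Definition ptri : prf := PRec PZero (PComp PSucc [PComp padd [PProj 0; PProj 1]]).

Lemma peval_tri n : peval ptri [n] (n * (n + 1) / 2).
Proof.
  induction n as [|n IH].
  - apply ev_rec0. constructor.
  - eapply ev_recS; [exact IH|]. eapply peval_c1.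
    + eapply peval_c2; [now apply peval_proj|now apply peval_proj|apply peval_add].
    + cbn [nth].
      replace (S n * (S n + 1)) with (n * (n + 1) + (n + 1) * 2) by lia.
      rewrite Nat.div_add by lia.
      replace (n * (n + 1) / 2 + (n + 1)) with (S (n + n * (n + 1) / 2)) by lia. constructor.
Qed.

Definition pcpair : prf := PComp padd [PComp ptri [padd]; PProj 1].

Lemma peval_cpair x y : peval pcpair [x; y] (cpair x y).
Proof.
  eapply peval_c2; [eapply peval_c1; [apply peval_add|apply peval_tri]|now apply peval_proj|apply peval_add].
Qed.

Definition pcons : prf := PComp PSucc [pcpair].

Lemma peval_cons x l : peval pcons [x; code_list l] (code_list (x :: l)).
Proof. eapply peval_c1; [apply peval_cpair|constructor]. Qed.

Definition prep (a : nat) : prf := PRec (PProj 0) (PComp pcons [pconst a; PProj 1]).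

Lemma peval_rep a m l : peval (prep a) [m; code_list l] (code_list (repeat a m ++ l)).
Proof.
  induction m as [|m IH].
  - apply ev_rec0. now apply peval_proj.
  - eapply ev_recS; [exact IH|].
    eapply peval_c2; [apply peval_const|now apply peval_proj|apply peval_cons].
Qed.

(** As a relator it says that [c] is the conjugate of the lamp [t] by [x0^A x1^B], that is, the lamp
    of the configuration with coordinates [A] and [B]. *)
Definition vword (x0 x1 t c A B : nat) : word :=
  repeat (x0, false) A ++ repeat (x1, false) B ++
  (t, false) :: repeat (x1, true) B ++ repeat (x0, true) A ++ [(c, true)].

Definition pvword (x0 x1 t c : nat) : prf :=
  let pA := PComp ppow [PProj 0] in
  let pB := PComp ppow [PProj 1] in
  PComp (prep (code_letter (x0, false))) [pA;
  PComp (prep (code_letter (x1, false))) [pB;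
  PComp pcons [pconst (code_letter (t, false));
  PComp (prep (code_letter (x1, true))) [pB;
  PComp (prep (code_letter (x0, true))) [pA;
  PComp pcons [pconst (code_letter (c, true)); PZero]]]]]].

Lemma peval_vword x0 x1 t c g r :
  peval (pvword x0 x1 t c) [g; r] (code_word (vword x0 x1 t c (2 ^ g - 1) (2 ^ r - 1))).
Proof.
  unfold code_word, vword, pvword. rewrite !map_app, map_cons, !map_app, !map_repeat.
  cbn [map].
  assert (HA : peval (PComp ppow [PProj 0]) [g; r] (2 ^ g - 1))
    by (eapply peval_c1; [now apply peval_proj|apply peval_pow]).
  assert (HB : peval (PComp ppow [PProj 1]) [g; r] (2 ^ r - 1))
    by (eapply peval_c1; [now apply peval_proj|apply peval_pow]).
  eapply peval_c2; [exact HA| |apply peval_rep].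
  eapply peval_c2; [exact HB| |apply peval_rep].
  eapply peval_c2; [apply peval_const| |apply peval_cons].
  eapply peval_c2; [exact HB| |apply peval_rep].
  eapply peval_c2; [exact HA| |apply peval_rep].
  eapply peval_c2; [apply peval_const| |apply peval_cons]. constructor.
Qed.

Fixpoint pvwords (ls : list (nat * nat * nat * nat)) : prf :=
  match ls with
  | [] => PProj 1
  | (x0, x1, t, c) :: ls => PComp pcons [pvword x0 x1 t c; pvwords ls]
  end.

Definition vwords (ls : list (nat * nat * nat * nat)) (A B : nat) : list word :=
  map (fun '(x0, x1, t, c) => vword x0 x1 t c A B) ls.

(** The relators depending on the input stand in front, so the code of the full list arises by
    consing onto the code of the others, which is the second input. *)
Definition ppres (ls : list (nat * nat * nat * nat)) : prf :=
  PComp pcpair [PProj 0; pvwords ls].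

Lemma peval_pres ls g rest :
  let r := code_list (map code_word rest) in
  peval (ppres ls) [g; r] (code_pres (Pres g (vwords ls (2 ^ g - 1) (2 ^ r - 1) ++ rest))).
Proof.
  intros r. eapply peval_c2; [now apply peval_proj| |apply peval_cpair].
  cbn [prels]. induction ls as [|[[[x0 x1] t] c] ls IH]; [now apply peval_proj|].
  cbn [pvwords vwords map app].
  eapply peval_c2; [apply peval_vword|exact IH|apply peval_cons].
Qed.
End Codes.

(** * Evaluating words *)

Section Eval.
Local Open Scope nat_scope.
Local Open Scope grp_scope.

Definition lit {G : group} (nu : nat -> G) (l : letter) : G :=
  if snd l then inv (nu (fst l)) else nu (fst l).

Fixpoint eval {G : group} (nu : nat -> G) (w : word) : G :=
  match w with [] => 1 | l :: w => lit nu l * eval nu w end.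

Lemma eval_app (G : group) (nu : nat -> G) u v : eval nu (u ++ v) = eval nu u * eval nu v.
Proof. induction u; simpl; [now rewrite mul1g|now rewrite IHu, mulA]. Qed.

Lemma eval_winv (G : group) (nu : nat -> G) w : eval nu (winv w) = inv (eval nu w).
Proof.
  unfold winv. induction w as [|[i b] w IH]; simpl; [now rewrite inv1|].
  rewrite eval_app, IH, invM. simpl. rewrite mulg1. f_equal.
  unfold lit; simpl. destruct b; simpl; [now rewrite invK|reflexivity].
Qed.

Lemma eval_geq P (G : group) (nu : nat -> G) : (forall r, In r (prels P) -> eval nu r = 1) ->
  forall u v, geq P u v -> eval nu u = eval nu v.
Proof.
  intros H u v E. induction E.
  - reflexivity.
  - now symmetry.
  - congruence.
  - rewrite !eval_app. simpl. f_equal. rewrite mulA. unfold lit; simpl.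
    destruct b; simpl; [now rewrite mulVg, mul1g|now rewrite mulgV, mul1g].
  - rewrite !eval_app. now rewrite (H r), mul1g.
Qed.

Definition wmap (phi : nat -> nat) (w : word) : word := map (fun l => (phi (fst l), snd l)) w.

Lemma eval_wmap (G : group) (nu : nat -> G) phi w : eval nu (wmap phi w) = eval (fun i => nu (phi i)) w.
Proof. induction w as [|[i b] w IH]; simpl; [reflexivity|now rewrite IH]. Qed.

Lemma eval_ext (G : group) (nu nu' : nat -> G) w : (forall i, nu i = nu' i) -> eval nu w = eval nu' w.
Proof. intros E. induction w as [|[i b] w IH]; simpl; [reflexivity|]. now rewrite IH; unfold lit; rewrite E. Qed.

Lemma eval_emb (G H : group) (f : emb G H) (nu : nat -> G) w :
  eval (fun i => f (nu i)) w = f (eval nu w).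
Proof.
  induction w as [|[i b] w IH]; simpl; [now rewrite emb1|]. rewrite IH, embM. f_equal.
  unfold lit; simpl. destruct b; [now rewrite embV|reflexivity].
Qed.

Definition eqn (l r : word) : word := l ++ winv r.

Lemma eval_eqn (G : group) (nu : nat -> G) l r : eval nu (eqn l r) = 1 <-> eval nu l = eval nu r.
Proof.
  unfold eqn. rewrite eval_app, eval_winv. split; [apply divg1_eq|intros ->; apply mulgV].
Qed.

Lemma wmap_app phi u v : wmap phi (u ++ v) = wmap phi u ++ wmap phi v.
Proof. apply map_app. Qed.

Lemma wmap_repeat phi i b n : wmap phi (repeat (i, b) n) = repeat (phi i, b) n.
Proof. unfold wmap. now rewrite map_repeat. Qed.

Lemma wmap_vword phi x0 x1 t c A B :
  wmap phi (vword x0 x1 t c A B) = vword (phi x0) (phi x1) (phi t) (phi c) A B.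
Proof. unfold vword. now rewrite !wmap_app; simpl; rewrite !wmap_app, !wmap_repeat. Qed.

Lemma eval_repeat (G : group) (nu : nat -> G) i n : eval nu (repeat (i, false) n) = npow (nu i) n.
Proof. induction n; simpl; [reflexivity|now rewrite IHn]. Qed.

Lemma eval_repeat_inv (G : group) (nu : nat -> G) i n :
  eval nu (repeat (i, true) n) = inv (npow (nu i) n).
Proof.
  induction n; [simpl; now rewrite inv1|]. rewrite npow_Sr, invM, <- IHn. reflexivity.
Qed.

Lemma eval_vword (G : group) (nu : nat -> G) x0 x1 t c A B :
  eval nu (vword x0 x1 t c A B) = 1 <->
  conjg (npow (nu x0) A * npow (nu x1) B) (nu t) = nu c.
Proof.
  unfold vword. rewrite !eval_app. simpl. rewrite !eval_app, !eval_repeat, !eval_repeat_inv. simpl.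
  unfold lit; simpl. unfold conjg. rewrite invM, mulg1, !mulA. split; [apply divg1_eq|].
  intros ->. apply mulgV.
Qed.
End Eval.

(** * The presentation attached to a machine *)

Section Presentation.
Local Open Scope nat_scope.
Local Open Scope grp_scope.

(* Base generators: [k], [c], the translations [x_i], the lamps [t_p], the stable letters [r_j]. *)
Definition kb := 0.
Definition cb := S O.
Definition xb i := S (S (3 * i))%nat.
Definition tb p := S (S (3 * p + 1))%nat.
Definition rb j := S (S (3 * j + 2))%nat.

Definition pw (i : nat) : letter := (i, false).
Definition ng (i : nat) : letter := (i, true).

Definition rule_words (d j : nat) (r : rule) : list word :=
  match r with
  | RInc p q i =>
      [eqn [pw (rb j); pw (tb p)] [pw (xb i); pw (tb q); ng (xb i); pw (rb j)];
       eqn [pw (rb j); pw (xb i)] [pw (xb i); pw (xb i); pw (rb j)];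
       eqn [pw (rb j); pw kb] [pw kb; pw (rb j)]] ++
      map (fun m => eqn [pw (rb j); pw (xb m)] [pw (xb m); pw (rb j)])
        (filter (fun m => negb (m =? i)%nat) (seq 0 d))
  | RZero p q i =>
      [eqn [pw (rb j); pw (tb p)] [pw (tb q); pw (rb j)];
       eqn [pw (rb j); pw (xb i); pw (xb i)] [pw (xb i); pw (xb i); pw (rb j)];
       eqn [pw (rb j); pw kb] [pw kb; pw (rb j)]] ++
      map (fun m => eqn [pw (rb j); pw (xb m)] [pw (xb m); pw (rb j)])
        (filter (fun m => negb (m =? i)%nat) (seq 0 d))
  end.

Lemma in_app_iff_all (P : word -> Prop) (l1 l2 : list word) :
  (forall w, In w (l1 ++ l2) -> P w) <-> (forall w, In w l1 -> P w) /\ (forall w, In w l2 -> P w).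
Proof.
  split.
  - intros H; split; intros w I; apply H, in_or_app; auto.
  - intros [H1 H2] w I. apply in_app_or in I as [I|I]; auto.
Qed.

Lemma in_cons_all (P : word -> Prop) a (l : list word) :
  (forall w, In w (a :: l) -> P w) <-> P a /\ (forall w, In w l -> P w).
Proof.
  split.
  - intros H; split; [apply H; now left|intros w I; apply H; now right].
  - intros [H1 H2] w [<-|I]; auto.
Qed.

Lemma rule_words_ok (G : group) (nu : nat -> G) d j r :
  (forall w, In w (rule_words d j r) -> eval nu w = 1) <->
  rule_rel d (fun i => nu (xb i)) (fun p => nu (tb p)) (nu kb) (nu (rb j)) r.
Proof.
  assert (HF : forall i, (forall w, In w (map (fun m => eqn [pw (rb j); pw (xb m)] [pw (xb m); pw (rb j)])
        (filter (fun m => negb (m =? i)%nat) (seq 0 d))) -> eval nu w = 1) <->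
      forall m, (m < d)%nat -> m <> i -> nu (rb j) * nu (xb m) = nu (xb m) * nu (rb j)).
  { intros i; split.
    - intros H m Hm N. specialize (H (eqn [pw (rb j); pw (xb m)] [pw (xb m); pw (rb j)])).
      rewrite eval_eqn in H. simpl in H. unfold lit in H; simpl in H. rewrite !mulg1 in H. apply H.
      apply in_map_iff. exists m; split; [reflexivity|]. apply filter_In; split.
      + apply in_seq; lia.
      + destruct (Nat.eqb_spec m i); [contradiction|reflexivity].
    - intros H w I. apply in_map_iff in I as (m & <- & I). apply filter_In in I as [I1 I2].
      apply in_seq in I1. destruct (Nat.eqb_spec m i) as [|N]; [discriminate|].
      apply eval_eqn. simpl. unfold lit; simpl. rewrite !mulg1. apply H; [lia|assumption]. }
  destruct r as [p q i|p q i]; unfold rule_words, rule_rel;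
    rewrite in_app_iff_all, !in_cons_all, !eval_eqn, HF; simpl; unfold lit; simpl;
    rewrite !mulg1, !mulA; intuition.
Qed.

Definition base_rels (d halt : nat) (prog : list instr) : list word :=
  flat_map (fun i => map (fun j => eqn [pw (xb i); pw (xb j)] [pw (xb j); pw (xb i)]) (seq 0 d)) (seq 0 d) ++
  flat_map (fun j => match nth_error (rules prog) j with Some r => rule_words d j r | None => [] end)
    (seq 0 (length (rules prog))) ++
  [eqn [pw (tb halt); pw kb] [pw kb; pw (tb halt)]].

Definition base_ok d halt prog (G : group) (nu : nat -> G) : Prop :=
  (forall i j, (i < d)%nat -> (j < d)%nat -> comm (nu (xb i)) (nu (xb j))) /\
  (forall j r, nth_error (rules prog) j = Some r ->
     rule_rel d (fun i => nu (xb i)) (fun p => nu (tb p)) (nu kb) (nu (rb j)) r) /\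
  comm (nu (tb halt)) (nu kb).

Lemma base_rels_ok (G : group) (nu : nat -> G) d halt prog :
  (forall w, In w (base_rels d halt prog) -> eval nu w = 1) <-> base_ok d halt prog G nu.
Proof.
  unfold base_rels, base_ok. split.
  - intros H. repeat apply conj.
    + intros i j Hi Hj. specialize (H (eqn [pw (xb i); pw (xb j)] [pw (xb j); pw (xb i)])).
      rewrite eval_eqn in H. simpl in H. unfold lit in H; simpl in H. rewrite !mulg1 in H. apply H.
      apply in_or_app; left. apply in_flat_map. exists i; split; [apply in_seq; lia|].
      apply in_map_iff. exists j; split; [reflexivity|apply in_seq; lia].
    + intros j r E. apply rule_words_ok. intros w I. apply H.
      apply in_or_app; right; apply in_or_app; left. apply in_flat_map. exists j.
      rewrite E; split; [|exact I]. apply in_seq; split; [lia|]. apply nth_error_Some. congruence.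
    + specialize (H (eqn [pw (tb halt); pw kb] [pw kb; pw (tb halt)])).
      rewrite eval_eqn in H. simpl in H. unfold lit in H; simpl in H. rewrite !mulg1 in H. apply H.
      apply in_or_app; right; apply in_or_app; right. now left.
  - intros (H1 & H2 & H3) w I. apply in_app_or in I as [I|I]; [|apply in_app_or in I as [I|[<-|[]]]].
    + apply in_flat_map in I as (i & Ii & I). apply in_map_iff in I as (j & <- & Ij).
      apply in_seq in Ii, Ij. apply eval_eqn. simpl; unfold lit; simpl. rewrite !mulg1. apply H1; lia.
    + apply in_flat_map in I as (j & _ & I). destruct (nth_error (rules prog) j) as [r|] eqn:E; [|destruct I].
      pose proof (proj2 (rule_words_ok G nu d j r) (H2 j r E)). auto.
    + apply eval_eqn. simpl; unfold lit; simpl. rewrite !mulg1. exact H3.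
Qed.

(** In the infinite model, [e0], [ff] and [eb y] are the coordinates 0, 1 and 2 + y of a free
    abelian group, [zz] is the stable letter that doubles all of them except coordinate 0, [gb y] is
    the base generator [y], and [b0], [bz], [bb y] are the braid partners. *)
Definition e0 := 0.
Definition ff := S O.
Definition zz := 2.
Definition b0 := 3.
Definition bz := 4.
Definition gb y := (5 + 3 * y)%nat.
Definition eb y := (5 + (3 * y + 1))%nat.
Definition bb y := (5 + (3 * y + 2))%nat.

Definition wword : word := [pw (gb kb); pw (gb cb); ng (gb kb); ng (gb cb)].

(* If [v] dies then so do [b], a conjugate of [v], and [u]. *)
Definition braid_words (v u : word) (b : nat) : list word :=
  [eqn (v ++ [pw b] ++ v) ([pw b] ++ v ++ [pw b]);
   eqn u ((v ++ [pw b] ++ v) ++ (v ++ [pw b] ++ v))].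

(** The chain of deaths: the commutator kills [e0], this kills [zz], the doubling relations then
    kill [ff] and every [eb y], and [eb y] kills [gb y * ff], hence [gb y]. The factor [ff] is there
    because [gb y] alone might be trivial or of finite order in the infinite model, whereas the
    braid relation needs an independent pair. *)
Definition collapse_rels (Nb : nat) : list word :=
  braid_words wword [pw e0] b0 ++ braid_words [pw e0] [pw zz] bz ++
  [eqn [pw zz; pw ff] [pw ff; pw ff; pw zz]] ++
  flat_map (fun y => eqn [pw zz; pw (eb y)] [pw (eb y); pw (eb y); pw zz] ::
     braid_words [pw (eb y)] [pw (gb y); pw ff] (bb y)) (seq 0 Nb).

Definition braid_ok {G : group} (v u b : G) : Prop := v * b * v = b * v * b /\ u = v * b * v * (v * b * v).

Lemma braid_words_ok (G : group) (nu : nat -> G) v u b :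
  (forall w, In w (braid_words v u b) -> eval nu w = 1) <-> braid_ok (eval nu v) (eval nu u) (nu b).
Proof.
  unfold braid_words, braid_ok. rewrite !in_cons_all, !eval_eqn, !eval_app. simpl.
  unfold lit; simpl. rewrite !mulg1, !mulA. intuition.
Qed.

Definition collapse_ok Nb (G : group) (nu : nat -> G) : Prop :=
  braid_ok (nu (gb kb) * nu (gb cb) * inv (nu (gb kb)) * inv (nu (gb cb))) (nu e0) (nu b0) /\
  braid_ok (nu e0) (nu zz) (nu bz) /\
  nu zz * nu ff = nu ff * nu ff * nu zz /\
  forall y, (y < Nb)%nat -> nu zz * nu (eb y) = nu (eb y) * nu (eb y) * nu zz /\
    braid_ok (nu (eb y)) (nu (gb y) * nu ff) (nu (bb y)).

Lemma eval_wword (G : group) (nu : nat -> G) :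
  eval nu wword = nu (gb kb) * nu (gb cb) * inv (nu (gb kb)) * inv (nu (gb cb)).
Proof. simpl. unfold lit; cbn [fst snd pw ng]. now rewrite mulg1, !mulA. Qed.

Lemma eval_pw (G : group) (nu : nat -> G) i : eval nu [pw i] = nu i.
Proof. simpl. unfold lit; simpl. apply mulg1. Qed.

Lemma eval_pw2 (G : group) (nu : nat -> G) i j : eval nu [pw i; pw j] = nu i * nu j.
Proof. simpl. unfold lit; simpl. now rewrite mulg1. Qed.

Lemma eval_pw3 (G : group) (nu : nat -> G) i j k : eval nu [pw i; pw j; pw k] = nu i * nu j * nu k.
Proof. simpl. unfold lit; simpl. now rewrite mulg1, mulA. Qed.

Lemma collapse_rels_ok Nb (G : group) (nu : nat -> G) :
  (forall w, In w (collapse_rels Nb) -> eval nu w = 1) <-> collapse_ok Nb G nu.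
Proof.
  unfold collapse_rels, collapse_ok.
  rewrite !in_app_iff_all, in_cons_all, !braid_words_ok, eval_wword, !eval_pw, eval_eqn, eval_pw2, eval_pw3.
  assert (HF : (forall w, In w (flat_map (fun y => eqn [pw zz; pw (eb y)] [pw (eb y); pw (eb y); pw zz] ::
     braid_words [pw (eb y)] [pw (gb y); pw ff] (bb y)) (seq 0 Nb)) -> eval nu w = 1) <->
    forall y, (y < Nb)%nat -> nu zz * nu (eb y) = nu (eb y) * nu (eb y) * nu zz /\
    braid_ok (nu (eb y)) (nu (gb y) * nu ff) (nu (bb y))).
  { assert (Hy : forall y, (forall w, In w (eqn [pw zz; pw (eb y)] [pw (eb y); pw (eb y); pw zz] ::
       braid_words [pw (eb y)] [pw (gb y); pw ff] (bb y)) -> eval nu w = 1) <->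
       nu zz * nu (eb y) = nu (eb y) * nu (eb y) * nu zz /\ braid_ok (nu (eb y)) (nu (gb y) * nu ff) (nu (bb y))).
    { intros y. now rewrite in_cons_all, braid_words_ok, eval_eqn, eval_pw2, eval_pw3, eval_pw, eval_pw2. }
    split.
    - intros H y L. apply Hy. intros w I. apply H, in_flat_map. exists y; split; [apply in_seq; lia|exact I].
    - intros H w I. apply in_flat_map in I as (y & Iy & I). apply in_seq in Iy.
      revert w I. apply Hy, H. lia. }
  rewrite HF. simpl. tauto.
Qed.

Definition machine_rels (Nb d halt : nat) (prog : list instr) : list word :=
  map (wmap gb) (base_rels d halt prog) ++ collapse_rels Nb.

Lemma machine_rels_ok Nb d halt prog (G : group) (nu : nat -> G) :
  (forall w, In w (machine_rels Nb d halt prog) -> eval nu w = 1) <->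
  base_ok d halt prog G (fun y => nu (gb y)) /\ collapse_ok Nb G nu.
Proof.
  unfold machine_rels. rewrite in_app_iff_all, collapse_rels_ok, <- base_rels_ok.
  apply and_iff_compat_r. split.
  - intros H w I. rewrite <- eval_wmap. now apply H, in_map.
  - intros H w I. apply in_map_iff in I as (w' & <- & I). rewrite eval_wmap. auto.
Qed.

Definition var_word := vword (gb (xb 0)) (gb (xb 1)) (gb (tb 0)) (gb cb).

Definition init_vec (A B : nat) : vec :=
  fun i => match i with O => Z.of_nat A | 1%nat => Z.of_nat B | _ => 0%Z end.

Lemma braid_kill (G : group) (u b : G) : braid_ok 1 u b -> b = 1 /\ u = 1.
Proof.
  intros [E1 E2]. rewrite ?mulg1, ?mul1g, ?mulg1 in E1. rewrite ?mulg1, ?mul1g in E2.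
  assert (b = 1) as -> by (apply idem1; now symmetry). split; [reflexivity|]. now rewrite mulg1 in E2.
Qed.

Lemma gen_cases Nb m : (m < 5 + 3 * Nb)%nat ->
  m = e0 \/ m = ff \/ m = zz \/ m = b0 \/ m = bz \/
  exists y, (y < Nb)%nat /\ (m = gb y \/ m = eb y \/ m = bb y).
Proof.
  intros H. unfold e0, ff, zz, b0, bz, gb, eb, bb.
  do 5 (destruct m as [|m]; [tauto|]). do 5 right.
  exists (m / 3)%nat. pose proof (Nat.div_mod_eq m 3). pose proof (Nat.mod_upper_bound m 3 ltac:(lia)). lia.
Qed.

Lemma xprod_two (G : group) (x : nat -> G) e v : (2 <= e)%nat -> (forall i, (2 <= i)%nat -> v i = 0%Z) ->
  xprod G x e v = zpow (x O) (v O) * zpow (x (S O)) (v (S O)).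
Proof.
  intros He H. induction He as [|e He IH]; simpl.
  - now rewrite mul1g.
  - rewrite IH, (H e) by lia. apply mulg1.
Qed.

(** [var_word] identifies [c] with the lamp of the input, which commutes with [k] by [reach_comm].
    With the commutator gone, each braid pair collapses by [braid_kill], and each doubling relation
    reads x = x^2. *)
Lemma collapse Nb d halt prog A B (G : group) (nu : nat -> G) :
  (2 <= d)%nat ->
  (forall p a i, nth_error prog p = Some a -> (exists q, a = INC i q) \/ (exists q z, a = DEC i q z) -> (i < d)%nat) ->
  (forall w, In w (machine_rels Nb d halt prog) -> eval nu w = 1) ->
  eval nu (var_word A B) = 1 ->
  reach prog halt (O, init_vec A B) ->
  forall m, (m < 5 + 3 * Nb)%nat -> nu m = 1.
Proof.
  intros Hd Hi HM HV HR.
  apply machine_rels_ok in HM as [(B1 & B2 & B3) (C1 & C2 & C3 & C4)].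
  assert (W : comm (nu (gb cb)) (nu (gb kb))).
  { pose proof (reach_comm G d (fun i => nu (gb (xb i))) (fun p => nu (gb (tb p))) (nu (gb kb)) B1 prog halt) as RC.
    specialize (RC (fun r I => let '(ex_intro _ j E) := In_nth_error _ _ I in
       ex_intro _ (nu (gb (rb j))) (B2 j r E)) Hi B3 _ HR). cbn [fst snd] in RC.
    unfold tt_at in RC. rewrite xprod_two in RC; [|assumption|intros [|[|i]] ?; simpl; lia].
    cbn [init_vec] in RC. rewrite !zpow_nat in RC.
    apply eval_vword in HV. now rewrite HV in RC. }
  assert (E : nu (gb kb) * nu (gb cb) * inv (nu (gb kb)) * inv (nu (gb cb)) = 1).
  { rewrite <- W. now rewrite (mulAr _ (nu (gb cb))), mulgV, mulg1, mulgV. }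
  rewrite E in C1. apply braid_kill in C1 as [Eb0 Ee0].
  rewrite Ee0 in C2. apply braid_kill in C2 as [Ebz Ez].
  rewrite Ez, mul1g, mulg1 in C3. assert (Ef : nu ff = 1) by (apply idem1; now symmetry).
  intros m Hm. apply gen_cases in Hm as [->|[->|[->|[->|[->|(y & Hy & H)]]]]]; auto.
  destruct (C4 y Hy) as [D1 D2]. rewrite Ez, mul1g, mulg1 in D1.
  assert (Ee : nu (eb y) = 1) by (apply idem1; now symmetry).
  rewrite Ee, Ef, mulg1 in D2. apply braid_kill in D2 as [Ebb Eg].
  destruct H as [->|[->| ->]]; assumption.
Qed.
End Presentation.

(** * An infinite quotient in the non-halting case *)

Section Model.
Local Open Scope nat_scope.
Local Open Scope grp_scope.

(** Interleaves three sequences by residue modulo 3, matching the numbering of [xb], [tb], [rb] and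
    of [gb], [eb], [bb]. *)
Fixpoint sel3 {T : Type} (a b c : nat -> T) (m : nat) : T :=
  match m with
  | O => a O | 1%nat => b O | 2%nat => c O
  | S (S (S m)) => sel3 (fun i => a (S i)) (fun i => b (S i)) (fun i => c (S i)) m
  end.

Lemma sel3_spec T (a b c : nat -> T) i :
  sel3 a b c (3 * i)%nat = a i /\ sel3 a b c (3 * i + 1)%nat = b i /\ sel3 a b c (3 * i + 2)%nat = c i.
Proof.
  revert a b c; induction i as [|i IH]; intros a b c; [auto|].
  replace (3 * S i)%nat with (S (S (S (3 * i)))) by lia.
  apply (IH (fun i => a (S i)) (fun i => b (S i)) (fun i => c (S i))).
Qed.

Lemma npow_transl chi i n :
  npow (transl nat chi (basis i)) n = transl nat chi (fun j => (Z.of_nat n * basis i j)%Z).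
Proof.
  induction n as [|n IH]; cbn [npow].
  - apply lamp_eq; try reflexivity.
  - rewrite IH, <- transl_add. f_equal. apply functional_extensionality; intros j. unfold vadd. lia.
Qed.

Definition inf_order {G : group} (g : G) := forall n, zpow g n = 1 -> n = 0%Z.

Lemma inf_order_emb G H (f : emb G H) g : inf_order g -> inf_order (f g).
Proof. intros I n E. apply I, (emb_inj f). now rewrite emb_zpow, emb1. Qed.

Lemma inf_order_zpow_inj (G : group) (g : G) : inf_order g -> forall i j, zpow g i = zpow g j -> i = j.
Proof.
  intros I i j E. assert (i - j = 0)%Z; [|lia]. apply I.
  unfold Z.sub. now rewrite zpow_add, E, zpow_opp, mulgV.
Qed.

Lemma base_model d halt prog A B :
  nth_error prog halt = None -> ~ reach prog halt (O, init_vec A B) ->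
  exists (G : group) (nu : nat -> G), base_ok d halt prog G nu /\
    conjg (npow (nu (xb 0)) A * npow (nu (xb 1)) B) (nu (tb 0)) = nu cb /\
    inf_order (nu kb * nu cb * inv (nu kb) * inv (nu cb)).
Proof.
  intros N NR.
  destruct (rules_model d (chi prog halt) (rules prog)) as (G & io & rs & HR).
  { intros r I. now apply rules_compat. }
  set (X := fun i => io (transl _ _ (basis i))). set (T := fun p => io (lamp _ _ p v0)).
  set (nu := fun m => match m with
    | O => io (kelt _ _) | 1%nat => io (lamp _ _ O (init_vec A B)) | S (S m) => sel3 X T rs m end).
  assert (Ex : forall i, nu (xb i) = X i) by (intros i; apply (sel3_spec _ X T rs i)).
  assert (Et : forall i, nu (tb i) = T i) by (intros i; apply (sel3_spec _ X T rs i)).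
  assert (Er : forall i, nu (rb i) = rs i) by (intros i; apply (sel3_spec _ X T rs i)).
  assert (Exf : (fun i => nu (xb i)) = X) by now apply functional_extensionality.
  assert (Etf : (fun i => nu (tb i)) = T) by now apply functional_extensionality.
  exists G, nu. split; [split; [|split]|split].
  - intros i j _ _. rewrite !Ex. unfold comm, X. rewrite <- !embM, <- !transl_add. do 2 f_equal.
    apply vaddC.
  - intros j r E. rewrite Exf, Etf, Er. apply HR, E.
  - rewrite Et. unfold comm, T. change (nu kb) with (io (kelt nat (chi prog halt))).
    rewrite <- !embM, kelt_lamp. f_equal.
    replace (chi prog halt halt v0) with 0%Z.
    + replace (central nat (chi prog halt) 0) with (1 : lamp_group nat (chi prog halt)) by now apply lamp_eq.
      now rewrite mul1g.
    + unfold chi. destruct excluded_middle_informative as [|H]; [reflexivity|].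
      exfalso; apply H. constructor.
  - rewrite !Ex, Et. unfold X, T. change (nu cb) with (io (lamp nat (chi prog halt) O (init_vec A B))).
    assert (En : forall g n, npow (io g) n = io (npow g n)).
    { intros g n. rewrite <- !zpow_nat. now rewrite emb_zpow. }
    rewrite !En, !npow_transl, <- embM, <- transl_add. unfold conjg.
    rewrite <- embV, <- !embM. f_equal. rewrite transl_lamp, mulAr, mulgV, mulg1. f_equal.
    apply functional_extensionality; intros i. unfold vadd, v0, basis.
    destruct i as [|[|i]]; simpl; lia.
  - change (nu kb) with (io (kelt nat (chi prog halt))).
    change (nu cb) with (io (lamp nat (chi prog halt) O (init_vec A B))).
    rewrite <- !embV, <- !embM. apply inf_order_emb.
    (* The commutator reduces to the central element with value [chi] at the input, which is 1
       because the input does not reach the halting configuration. *)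
    rewrite kelt_lamp. rewrite (mulAr _ (central _ _ _)), (mulAr _ (lamp _ _ _ _)), mulgV, mulg1, mulAr, mulgV, mulg1.
    intros n E. rewrite central_zpow in E. apply (f_equal (hs nat)) in E. simpl in E.
    unfold chi in E. destruct excluded_middle_informative; [contradiction|lia].
Qed.

Lemma zpow_Zn (v : Zn_group) n : zpow v n = (fun i => n * v i)%Z :> Zn_group.
Proof.
  revert n; apply Z_step_ind.
  - apply functional_extensionality; intros i; simpl; lia.
  - intros n IH. rewrite zpow_succ, IH. apply functional_extensionality; intros i; simpl; lia.
  - intros n IH. rewrite zpow_pred, IH. apply functional_extensionality; intros i; simpl; lia.
Qed.

Lemma zpow_fst (G H : group) (g : prod_group G H) n : fst (zpow g n) = zpow (fst g) n.
Proof.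
  revert n; apply Z_step_ind; [reflexivity| |]; intros n IH.
  - now rewrite !zpow_succ, <- IH.
  - now rewrite !zpow_pred, <- IH.
Qed.

Lemma zpow_snd (G H : group) (g : prod_group G H) n : snd (zpow g n) = zpow (snd g) n.
Proof.
  revert n; apply Z_step_ind; [reflexivity| |]; intros n IH.
  - now rewrite !zpow_succ, <- IH.
  - now rewrite !zpow_pred, <- IH.
Qed.

(** Coordinate 0 is fixed so that the stable letter commutes with it and can be paired with it in a
    braid relation; the other coordinates are doubled so that they die with the stable letter. *)
Definition dilate : emb Zn_group Zn_group.
Proof.
  refine (Emb (fun v : Zn_group => (fun i => match i with O => v O | S i => 2 * v (S i) end)%Z : Zn_group) _ _).
  - intros x y. apply functional_extensionality; intros [|i]; cbn [mul Zn_group]; lia.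
  - intros x y E. apply functional_extensionality; intros [|i].
    + apply (f_equal (fun v => v O) E).
    + apply (f_equal (fun v => v (S i))) in E. cbv beta iota in E. lia.
Defined.

Lemma dilate_basis i : dilate (basis (S i)) = (basis (S i) : Zn_group) * basis (S i).
Proof.
  apply functional_extensionality; intros [|j]; [reflexivity|].
  cbn [mul Zn_group dilate efun]. lia.
Qed.

Lemma braid_problem_ok (G : group) (v u : G) I H io b :
  solves G (braid_problem G v u I) H io b -> braid_ok (io v) (io u) b.
Proof. intros [E1 E2]. split; assumption. Qed.

Lemma model Nb d halt prog A B :
  nth_error prog halt = None -> ~ reach prog halt (O, init_vec A B) ->
  exists (G : group) (nu : nat -> G),
    (forall w, In w (machine_rels Nb d halt prog) -> eval nu w = 1) /\
    eval nu (var_word A B) = 1 /\ inf_order (eval nu wword).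
Proof.
  intros N NR. destruct (base_model d halt prog A B N NR) as (G1 & nu1 & OK & Var & Inf).
  set (wd := nu1 kb * nu1 cb * inv (nu1 kb) * inv (nu1 cb)) in *.
  set (G2 := prod_group G1 Zn_group).
  set (E := fun i => embr G1 Zn_group (basis i)).
  destruct (hnn Zn_group G2 (embr G1 Zn_group) (emb_comp _ _ _ (embr G1 Zn_group) dilate)) as (K & io & r & Hr).
  (* The extra factor Z records the exponent of the stable letter, so that it has infinite order modulo [G2]. *)
  set (G3 := prod_group K Z_group).
  set (ka := emb_comp _ _ _ (embl K Z_group) io : emb G2 G3).
  set (z := (r, 1%Z) : G3).
  assert (Hz : forall v : Zn_group, z * ka (embr G1 Zn_group v) = ka (embr G1 Zn_group (dilate v)) * z).
  { intros v. apply (f_equal2 pair); [exact (Hr v)|reflexivity]. }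
  (* The two elements have infinite order in different factors of the direct product [G2]. *)
  assert (I1 : indep (ka (embl G1 Zn_group wd)) (ka (E 0))).
  { apply indep_emb. split.
    - unfold comm, E; simpl. rewrite mul1g, mulg1. f_equal. apply functional_extensionality; intros i. lia.
    - intros i j H. unfold E in H. rewrite <- !emb_zpow, zpow_Zn in H.
      pose proof (f_equal fst H) as H1. pose proof (f_equal (fun t => snd t O) H) as H2.
      cbn in H1. rewrite mulg1 in H1. apply Inf in H1. unfold basis in H2. cbn in H2. lia. }
  assert (I2 : indep (ka (E 0)) z).
  { split.
    - unfold comm. unfold E. rewrite Hz. f_equal. f_equal. f_equal.
      apply functional_extensionality; intros [|i]; reflexivity.
    - intros i j H.
      assert (H1 : zpow (fst (ka (E 0))) i * zpow (fst z) j = 1).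
      { rewrite <- (zpow_fst K Z_group z j), <- (zpow_fst K Z_group). exact (f_equal fst H). }
      assert (H2 : Z.add (zpow (snd (ka (E 0)) : Z_group) i) (zpow (snd z : Z_group) j) = 0%Z).
      { rewrite <- (zpow_snd K Z_group z j), <- (zpow_snd K Z_group). exact (f_equal snd H). }
      change (snd (ka (E 0))) with (1 : Z_group) in H2. rewrite one_zpow in H2.
      change (fst (ka (E 0))) with (io (E 0)) in H1. change (fst z) with r in H1.
      change (snd z) with (1%Z : Z_group) in H2.
      assert (Ez : forall n, zpow (1%Z : Z_group) n = n).
      { apply Z_step_ind; [reflexivity| |]; intros n IH.
        - rewrite zpow_succ, IH. cbn [mul inv Z_group]. lia.
        - rewrite zpow_pred, IH. cbn [mul inv Z_group]. lia. }
      rewrite Ez in H2. simpl in H2. subst j. change (zpow r 0) with (1 : K) in H1. rewrite mulg1, <- emb_zpow in H1.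
      rewrite <- (emb1 _ _ io) in H1. apply emb_inj in H1. unfold E in H1. rewrite <- emb_zpow in H1.
      rewrite zpow_Zn in H1. apply (f_equal (fun t => snd t O)) in H1.
      unfold basis in H1; cbn in H1. lia. }
  set (Y := fun y => ka (embl G1 Zn_group (nu1 y) * E 1%nat)).
  (* Read off from the coordinates 1 and 2 + y, whatever the order of [nu1 y]. *)
  assert (I3 : forall y, indep (ka (E (2 + y))) (Y y)).
  { intros y. apply indep_emb. split.
    - unfold comm, E; simpl. rewrite !mul1g, !mulg1. f_equal.
      apply functional_extensionality; intros i. lia.
    - intros i j H.
      assert (H1 : (fun m => i * basis (2 + y) m + j * basis (S O) m)%Z = (fun _ => 0%Z)).
      { etransitivity; [|exact (f_equal snd H)].
        cbn [mul G2 prod_group snd]. rewrite !zpow_snd.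
        unfold E; cbn [snd mul prod_group embl embr efun]. rewrite mul1g, !zpow_Zn. reflexivity. }
      pose proof (f_equal (fun t => t 1%nat) H1) as H2.
      pose proof (f_equal (fun t => t (2 + y)%nat) H1) as H3. unfold basis in H2, H3.
      simpl in H2, H3. rewrite Nat.eqb_refl in H3. lia. }
  set (ps := braid_problem G3 _ _ I1 :: braid_problem G3 _ _ I2 ::
             map (fun y => braid_problem G3 _ _ (I3 y)) (seq 0 Nb)).
  destruct (solve_all G3 ps) as (G & la & bs & Hb).
  pose proof (Hb O _ eq_refl) as S0. apply braid_problem_ok in S0.
  pose proof (Hb 1%nat _ eq_refl) as S1. apply braid_problem_ok in S1.
  assert (S2 : forall y, (y < Nb)%nat -> braid_ok (la (ka (E (2 + y)))) (la (Y y)) (bs (2 + y)%nat)).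
  { intros y Hy. eapply braid_problem_ok. apply Hb. simpl. rewrite nth_error_map.
    rewrite (nth_error_nth' (seq 0 Nb) 0) by now rewrite length_seq.
    rewrite seq_nth by assumption. reflexivity. }
  clear Hb.
  set (q := emb_comp _ _ _ la (emb_comp _ _ _ ka (embl G1 Zn_group)) : emb G1 G).
  set (e := fun i => la (ka (E i))).
  set (nu := fun m => match m with
    | O => e O | 1%nat => e 1%nat | 2%nat => la z | 3%nat => bs O | 4%nat => bs 1%nat
    | S (S (S (S (S m)))) => sel3 (fun y => q (nu1 y)) (fun y => e (2 + y)%nat) (fun y => bs (2 + y)%nat) m end).
  assert (Eg : forall y, nu (gb y) = q (nu1 y)) by (intros y; apply sel3_spec).
  assert (Ee : forall y, nu (eb y) = e (2 + y)%nat)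
    by (intros y; apply (sel3_spec _ _ (fun y => e (2 + y)%nat))).
  assert (Eb : forall y, nu (bb y) = bs (2 + y)%nat)
    by (intros y; apply (sel3_spec _ _ _ (fun y => bs (2 + y)%nat))).
  assert (Ew : eval nu wword = q wd).
  { rewrite eval_wword, !Eg. unfold wd. now rewrite <- !embV, <- !embM. }
  exists G, nu. split; [|split].
  - apply machine_rels_ok. split.
    + apply base_rels_ok. intros w I. rewrite (eval_ext _ _ (fun y => q (nu1 y)) w Eg), eval_emb.
      rewrite (proj2 (base_rels_ok _ _ _ _ _) OK w I). apply emb1.
    + split; [|split; [|split]].
      * rewrite <- eval_wword, Ew. exact S0.
      * exact S1.
      * change (la z * e 1%nat = e 1%nat * e 1%nat * la z). unfold e, E. rewrite <- !embM, Hz. do 4 f_equal.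
        apply dilate_basis.
      * intros y Hy. rewrite Eg, Ee, Eb. split.
        -- change (la z * e (2 + y)%nat = e (2 + y)%nat * e (2 + y)%nat * la z).
           unfold e, E. rewrite <- !embM, Hz. do 4 f_equal.
           apply dilate_basis.
        -- replace (q (nu1 y) * nu ff) with (la (Y y)); [now apply S2|].
           unfold Y. now rewrite !embM.
  - apply eval_vword. rewrite !Eg. rewrite <- Var.
    assert (En : forall g n, npow (q g) n = q (npow g n)).
    { intros g n. rewrite <- !zpow_nat. now rewrite emb_zpow. }
    rewrite !En. unfold conjg. now rewrite <- !embM, <- embV, <- !embM.
  - rewrite Ew. now apply inf_order_emb.
Qed.
End Model.

(** * Homogeneous cochains and prisms *)

Section Chains.
Local Open Scope R_scope.
Variable X : Type.
Implicit Types (F G : list X -> R) (l : list X).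

(* The alternating sum of [F] over the lists obtained by deleting one entry. *)
Fixpoint D F l : R :=
  match l with [] => 0 | x :: l => F l - D (fun r => F (x :: r)) l end.

(** The alternating sum of [F] over the standard triangulation of the prism with bottom [map a l]
    and top [map b l]. *)
Fixpoint Pr (a b : X -> X) F l : R :=
  match l with
  | [] => 0
  | x :: l => F (a x :: b x :: map b l) - Pr a b (fun r => F (a x :: r)) l
  end.

Lemma D_ext l : forall F G, (forall r, F r = G r) -> D F l = D G l.
Proof. induction l as [|x l IH]; intros F G E; simpl; [reflexivity|]. rewrite E. f_equal. now apply IH. Qed.

Lemma D_lin l : forall F G c, D (fun r => F r + c * G r) l = D F l + c * D G l.
Proof.
  induction l as [|x l IH]; intros F G c; simpl; [ring|].
  rewrite (IH (fun r => F (x :: r)) (fun r => G (x :: r))). ring.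
Qed.

Lemma D_zero l : D (fun _ => 0) l = 0.
Proof. induction l as [|x l IH]; simpl; [reflexivity|]. rewrite IH. ring. Qed.

Lemma D_map l : forall F (b : X -> X), D (fun r => F (map b r)) l = D F (map b l).
Proof.
  induction l as [|x l IH]; intros F b; simpl; [reflexivity|]. f_equal.
  apply (IH (fun r => F (b x :: r))).
Qed.

Lemma Pr_ext a b l : forall F G, (forall r, F r = G r) -> Pr a b F l = Pr a b G l.
Proof. induction l as [|x l IH]; intros F G E; simpl; [reflexivity|]. rewrite E. f_equal. now apply IH. Qed.

Lemma Pr_lin a b l : forall F G c, Pr a b (fun r => F r + c * G r) l = Pr a b F l + c * Pr a b G l.
Proof.
  induction l as [|x l IH]; intros F G c; simpl; [ring|].
  rewrite (IH (fun r => F (a x :: r)) (fun r => G (a x :: r))). ring.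
Qed.

Lemma Pr_zero a b l : Pr a b (fun _ => 0) l = 0.
Proof. induction l as [|x l IH]; simpl; [reflexivity|]. rewrite IH. ring. Qed.

(** The homotopy formula for the prism operator. The induction hypothesis for [Fx] is the homotopy
    with the first vertex frozen at [a x]; the other terms cancel, except the two that move this
    vertex. *)
Lemma prism a b l : forall F,
  D (Pr a b F) l + Pr a b (D F) l = F (map b l) - F (map a l).
Proof.
  induction l as [|x l IH]; intros F; [simpl; ring|].
  set (Fx := fun r => F (a x :: r)).
  assert (E1 : D (fun r => Pr a b F (x :: r)) l =
               D (fun r => F (a x :: b x :: r)) (map b l) + -1 * D (Pr a b Fx) l).
  { rewrite <- (D_map l (fun r => F (a x :: b x :: r)) b), <- D_lin.
    apply D_ext. intros r. unfold Fx; simpl. ring. }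
  assert (E2 : Pr a b (fun r => D F (a x :: r)) l = Pr a b F l + -1 * Pr a b (D Fx) l).
  { rewrite <- Pr_lin. apply Pr_ext. intros r. unfold Fx; simpl. ring. }
  pose proof (IH Fx) as E.
  change (Fx (map b l)) with (F (a x :: map b l)) in E.
  change (Fx (map a l)) with (F (a x :: map a l)) in E.
  change (D (Pr a b F) (x :: l)) with (Pr a b F l - D (fun r => Pr a b F (x :: r)) l).
  change (Pr a b (D F) (x :: l)) with
    (F (b x :: map b l) - (F (a x :: map b l) - D (fun r => F (a x :: b x :: r)) (map b l))
      - Pr a b (fun r => D F (a x :: r)) l).
  rewrite E1, E2. cbn [map]. lra.
Qed.

Lemma D_rsum m l : forall (F : nat -> list X -> R), D (fun r => rsum m (fun i => F i r)) l = rsum m (fun i => D (F i) l).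
Proof.
  induction m as [|m IH]; intros F; simpl; [apply D_zero|].
  rewrite <- IH. rewrite (D_ext l _ (fun r => rsum m (fun i => F i r) + 1 * F m r)) by (intros; ring).
  rewrite D_lin. ring.
Qed.
End Chains.

Arguments D {X} F l.
Arguments Pr {X} a b F l.

Lemma rsum_ext m f g : (forall i, (i < m)%nat -> f i = g i) -> rsum m f = rsum m g.
Proof. induction m as [|m IH]; intros H; simpl; [reflexivity|]. rewrite IH, H; auto. Qed.

Lemma rsum_plus m f g : (rsum m (fun i => f i + g i) = rsum m f + rsum m g)%R.
Proof. induction m as [|m IH]; simpl; [ring|]. rewrite IH. ring. Qed.

Lemma rsum_telescope m f : (rsum m (fun i => f (S i) - f i) = f m - f O)%R.
Proof. induction m as [|m IH]; simpl; [ring|]. rewrite IH. ring. Qed.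

Lemma rsum_scal m c f : (rsum m (fun i => f i * c) = rsum m f * c)%R.
Proof. induction m as [|m IH]; simpl; [ring|]. rewrite IH. ring. Qed.

Lemma rsum_bound m f c : (forall i, (i < m)%nat -> Rabs (f i) <= c)%R -> (Rabs (rsum m f) <= INR m * c)%R.
Proof.
  induction m as [|m IH]; intros H; [simpl; rewrite Rabs_R0; lra|].
  rewrite S_INR. simpl rsum. pose proof (Rabs_triang (rsum m f) (f m)).
  assert (Rabs (rsum m f) <= INR m * c)%R by auto.
  assert (Rabs (f m) <= c)%R by auto. lra.
Qed.

Fixpoint lsum {X : Type} (f : X -> R) (l : list X) : R :=
  match l with [] => 0%R | x :: l => (f x + lsum f l)%R end.

Lemma lsum_map X Y (g : X -> Y) f l : lsum f (map g l) = lsum (fun x => f (g x)) l.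
Proof. induction l as [|x l IH]; simpl; [reflexivity|now rewrite IH]. Qed.

Lemma lsum_nonneg X (f : X -> R) l : (forall x, 0 <= f x)%R -> (0 <= lsum f l)%R.
Proof. intros H; induction l as [|x l IH]; simpl; [lra|]. specialize (H x). lra. Qed.

Lemma lsum_in X (f : X -> R) l x : (forall x, 0 <= f x)%R -> In x l -> (f x <= lsum f l)%R.
Proof.
  intros H; induction l as [|y l IH]; intros I; [destruct I|]; destruct I as [->|I]; simpl.
  - pose proof (lsum_nonneg _ f l H). lra.
  - specialize (IH I). specialize (H y). lra.
Qed.

Lemma lsum_scal X c (f : X -> R) l : lsum (fun x => c * f x)%R l = (c * lsum f l)%R.
Proof. induction l as [|x l IH]; simpl; [ring|rewrite IH; ring]. Qed.

Lemma firstn_snoc X (d : X) l i : (i < length l)%nat -> firstn (S i) l = firstn i l ++ [nth i l d].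
Proof.
  revert i; induction l as [|x l IH]; intros i H; simpl in H; [lia|].
  destruct i as [|i]; [reflexivity|]. cbn [firstn nth app]. f_equal. apply IH. lia.
Qed.

(** * Cup products of unbounded Lipschitz functions on a direct product *)

Section Cup.
Local Open Scope R_scope.
Local Open Scope grp_scope.
Variables (Q : group) (n : nat) (U : nat -> list Q) (f : nat -> Q -> R).

Fixpoint prodl (l : list Q) : Q := match l with [] => 1 | x :: l => x * prodl l end.

Lemma prodl_app l l' : prodl (l ++ l') = prodl l * prodl l'.
Proof. induction l as [|x l IH]; simpl; [now rewrite mul1g|now rewrite IH, mulA]. Qed.

(** Abstract form of a direct power: [U j] generates the factor [j], and [f j] is the word norm of
    the projection to it. [HP] provides geodesics of every length starting at the unit. *)
Hypothesis HC : forall i j u v, i <> j -> In u (U i) -> In v (U j) -> comm u v.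
Hypothesis HF : forall i j u g, i <> j -> In u (U j) -> f i (g * u) = f i g.
Hypothesis HP : forall j m, (j < n)%nat -> exists us, length us = m /\ incl us (U j) /\
  forall i, (i <= m)%nat -> f j (prodl (firstn i us)) = INR i.

Fixpoint cup (J : list nat) (l : list Q) : R :=
  match J with
  | [] => match l with [_] => 1%R | _ => 0%R end
  | j :: J => match l with x :: ((y :: _) as r) => ((f j y - f j x) * cup J r)%R | _ => 0%R end
  end.

(** The faces that delete the third or a later vertex share the factor [f j y - f j x]. Since
    [cup J] is closed by induction, their sum is a combination of the two faces [y :: l] and
    [z :: l], and then the coefficients cancel. *)
Lemma cup_closed J : forall l, length l = (2 + length J)%nat -> D (cup J) l = 0%R.
Proof.
  induction J as [|j J IH]; intros l E.
  - destruct l as [|x [|y [|z l]]]; try discriminate. simpl. ring.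
  - destruct l as [|x [|y [|z l]]]; try discriminate. simpl in E.
    specialize (IH (y :: z :: l)). simpl length in IH.
    assert (E' : S (S (length l)) = (2 + length J)%nat) by lia. specialize (IH E').
    change (D (cup J) (y :: z :: l)) with
      (cup J (z :: l) - (cup J (y :: l) - D (fun r => cup J (y :: z :: r)) l))%R in IH.
    change (D (cup (j :: J)) (x :: y :: z :: l)) with
      ((f j z - f j y) * cup J (z :: l) - ((f j z - f j x) * cup J (z :: l) -
        ((f j y - f j x) * cup J (y :: l) - D (fun r => cup (j :: J) (x :: y :: z :: r)) l)))%R.
    rewrite (D_ext _ l (fun r => cup (j :: J) (x :: y :: z :: r))
       (fun r => 0 + (f j y - f j x) * cup J (y :: z :: r))%R) by (intros; simpl; ring).
    rewrite D_lin, D_zero.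
    replace (D (fun r => cup J (y :: z :: r)) l) with (cup J (y :: l) - cup J (z :: l))%R by lra. ring.
Qed.

(* Membership in the product of the factors listed in [J], seen from the other factors. *)
Definition Sp (J : list nat) (x : Q) : Prop :=
  forall j, ~ In j J -> (forall u, In u (U j) -> comm u x) /\ (forall g, f j (g * x) = f j g).

Lemma Sp_mul J x y : Sp J x -> Sp J y -> Sp J (x * y).
Proof.
  intros Hx Hy j N. destruct (Hx j N) as [C1 F1], (Hy j N) as [C2 F2]. split.
  - intros u I. apply comm_mulr; auto.
  - intros g. now rewrite mulA, F2, F1.
Qed.

Lemma Sp_1 J : Sp J 1.
Proof. intros j N; split; intros; [apply comm_sym, comm_1l|now rewrite mulg1]. Qed.

Lemma Sp_U J j u : In j J -> In u (U j) -> Sp J u.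
Proof.
  intros Ij Iu i N. assert (i <> j) by (intros ->; contradiction). split.
  - intros v Iv. now apply (HC i j).
  - intros g. now apply (HF i j).
Qed.

Lemma Sp_prodl J j us : In j J -> incl us (U j) -> Sp J (prodl us).
Proof.
  intros Ij. induction us as [|u us IH]; intros I; simpl; [apply Sp_1|].
  apply Sp_mul; [apply (Sp_U J j); auto; apply I; now left|apply IH; intros v Hv; apply I; now right].
Qed.

Lemma Sp_cons J j x : Sp J x -> Sp (j :: J) x.
Proof. intros H i N. apply H. intros I; apply N; now right. Qed.

Lemma prodl_comm J j us x : ~ In j J -> incl us (U j) -> Sp J x -> comm (prodl us) x.
Proof.
  intros N I Hx. induction us as [|u us IH]; simpl; [apply comm_1l|].
  apply comm_mull; [apply (Hx j N); apply I; now left|apply IH; intros v Hv; apply I; now right].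
Qed.

Lemma f_prodl i j us g : i <> j -> incl us (U j) -> f i (g * prodl us) = f i g.
Proof.
  intros N. revert g; induction us as [|u us IH]; intros g I; simpl; [now rewrite mulg1|].
  rewrite mulA, IH by (intros v Hv; apply I; now right). apply (HF i j); auto. apply I; now left.
Qed.

(** The simplices of the prism between [l] and its right translate by [u]. *)
Fixpoint prs (u : Q) (l : list Q) : list (list Q) :=
  match l with
  | [] => []
  | x :: l => (x :: map (fun y => y * u) (x :: l)) :: map (cons x) (prs u l)
  end.

Lemma prs_length u l s : In s (prs u l) -> length s = S (length l).
Proof.
  revert s; induction l as [|x l IH]; intros s I; [destruct I|].
  destruct I as [<-|I]; [simpl; now rewrite length_map|].
  apply in_map_iff in I as (s' & <- & I). simpl. now rewrite (IH s' I).
Qed.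

Lemma prs_Sp J u l s : Sp J u -> Forall (Sp J) l -> In s (prs u l) -> Forall (Sp J) s.
Proof.
  intros Hu Hl. revert s; induction Hl as [|x l Hx Hl IH]; intros s I; [destruct I|].
  destruct I as [<-|I].
  - constructor; [exact Hx|]. apply Forall_map. constructor; [now apply Sp_mul|].
    eapply Forall_impl; [|exact Hl]. intros; now apply Sp_mul.
  - apply in_map_iff in I as (s' & <- & I). constructor; auto.
Qed.

(** Since [u] commutes with [h] and with the vertices of [s], it can be moved to the far right. So
    each simplex of the prism from [q] to [q * u] is the left translate by [q * h] of a simplex in a
    finite list depending only on [u] and [s]; bounds along left translates thus become uniform in
    [q] and [h]. *)
Lemma Pr_bound q u h s : forall (F K : list Q -> R),
  comm u h -> Forall (comm u) s ->
  (forall s', In s' (prs u s) -> Rabs (F (map (mul (q * h)) s')) <= K s')%R ->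
  (Rabs (Pr (mul q) (mul (q * u)) F (map (mul h) s)) <= lsum K (prs u s))%R.
Proof.
  induction s as [|x s IH]; intros F K Ch Cs H; simpl; [rewrite Rabs_R0; lra|].
  inversion Cs as [|? ? Cx Cs']; subst.
  assert (E : forall y, comm u y -> q * u * (h * y) = q * h * (y * u)).
  { intros y Cy. rewrite !mulAr. f_equal. rewrite !mulA, Ch, !mulAr. f_equal. exact Cy. }
  eapply Rle_trans; [apply Rabs_triang|]. rewrite Rabs_Ropp. apply Rplus_le_compat.
  - specialize (H _ (or_introl eq_refl)). simpl in H.
    rewrite E by assumption. rewrite mulA.
    replace (map (mul (q * u)) (map (mul h) s)) with (map (mul (q * h)) (map (fun y => y * u) s)); [exact H|].
    rewrite !map_map. apply map_ext_in. intros y Iy. symmetry. apply E.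
    rewrite Forall_forall in Cs'. auto.
  - rewrite lsum_map. apply (IH (fun r => F (q * (h * x) :: r)) (fun r => K (x :: r))); auto.
    intros s' I. specialize (H (x :: s')). rewrite mulA. apply H. right. now apply in_map.
Qed.

Lemma cup_shift J g l : (forall j x, In j J -> In x l -> f j (g * x) = f j x) ->
  cup J (map (mul g) l) = cup J l.
Proof.
  revert l; induction J as [|j J IH]; intros l H.
  - destruct l as [|x [|]]; reflexivity.
  - destruct l as [|x [|y l]]; [reflexivity|reflexivity|].
    cbn [cup map]. rewrite !H by (simpl; auto). f_equal.
    apply (IH (y :: l)). intros; apply H; simpl in *; auto.
Qed.

(** When the prism turns upwards only after the first vertex, the first edge does not change [f j],
    so the first factor of the cup product is zero. *)
Lemma Pr_cup_stuck j J q q' p l : ~ In j J -> f j p = f j q -> Forall (Sp J) l ->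
  Pr (mul q) (mul q') (fun r => cup (j :: J) (p :: r)) l = 0%R.
Proof.
  intros N E Hl. destruct Hl as [|y l Hy Hl]; [reflexivity|]. cbn [Pr].
  assert (Z : forall r, cup (j :: J) (p :: q * y :: r) = 0%R).
  { intros r. cbn [cup]. rewrite (proj2 (Hy j N) q), E. ring. }
  rewrite Z. rewrite (Pr_ext _ _ _ _ _ (fun _ => 0%R)) by auto. rewrite Pr_zero. ring.
Qed.

(** Only the first simplex of the prism contributes. Its first edge runs in the direction [j], and
    the rest is the translate of [x :: l] by [q'], a shift that the [f i] with [i] in [J] do not
    see. *)
Lemma Pr_cup j J q q' x l : ~ In j J -> Forall (Sp J) (x :: l) ->
  (forall i y, In i J -> In y (x :: l) -> f i (q' * y) = f i y) ->
  Pr (mul q) (mul q') (cup (j :: J)) (x :: l) = ((f j q' - f j q) * cup J (x :: l))%R.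
Proof.
  intros N Hl Hs. inversion Hl as [|? ? Hx Hl']; subst. cbn [Pr].
  rewrite Pr_cup_stuck; [|assumption|apply (proj2 (Hx j N))|assumption].
  rewrite <- (cup_shift J q' (x :: l)) by assumption. cbn [cup map].
  rewrite !(proj2 (Hx j N)). ring.
Qed.

(** The bound [M s] depends on the simplex [s] but neither on the translate nor on [eps]. An exact
    primitive satisfies this for every [eps], and unlike exactness the property for all [eps]
    survives the passage to fewer factors. *)
Definition approx_primitive (J : list nat) (M : list Q -> R) (eps : R) (B : list Q -> R) : Prop :=
  (forall s h, length s = length J -> Forall (Sp J) s -> Sp J h ->
     Rabs (B (map (mul h) s)) <= M s)%R /\
  (forall s h, length s = S (length J) -> Forall (Sp J) s -> Sp J h ->
     Rabs (cup J (map (mul h) s) - D B (map (mul h) s)) <= eps * M s)%R.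

(* Integrating along a long path in the factor [j] lowers the degree by one; after division by the
   length of the path the boundary terms become small. *)
Lemma no_approx_primitive J : J <> [] -> NoDup J -> (forall j, In j J -> j < n)%nat ->
  forall M, ~ (forall eps, (0 < eps)%R -> exists B, approx_primitive J M eps B).
Proof.
  induction J as [|j J IH]; [congruence|]. intros _ ND Hn M H.
  inversion ND as [|? ? Nj ND']; subst.
  destruct J as [|j' J'].
  (* One factor left: [B] varies by at most 2 [M [1]] between 1 and [q], while [f j] grows by [m].
     The path is fixed first; only then is [eps] chosen, so small that the error on the edge
     [[1; q]] is at most 1. *)
  - clear IH. destruct (INR_unbounded (2 * M [one] + 1)) as [m Hm].
    destruct (HP j m) as (us & Lus & Ius & Fus); [apply Hn; now left|].
    set (q := prodl us).
    assert (Fq : f j q = INR m).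
    { rewrite <- (Fus m (le_n _)). f_equal. rewrite <- Lus, firstn_all. reflexivity. }
    assert (F1 : f j 1 = 0%R) by (apply (Fus 0%nat); lia).
    assert (Sq : Sp [j] q) by (apply (Sp_prodl [j] j); [now left|assumption]).
    pose proof (Rabs_pos (M [one; q])) as Pos.
    destruct (H (/ (1 + Rabs (M [one; q])))%R) as (B & HB1 & HB2).
    { apply Rinv_0_lt_compat. lra. }
    pose proof (HB1 [1] q eq_refl) as A1. pose proof (HB1 [1] 1 eq_refl) as A2.
    pose proof (HB2 [1; q] 1 eq_refl) as A3.
    simpl in A1, A2, A3. rewrite mulg1 in A1. rewrite !mul1g in A2. rewrite !mul1g in A3.
    specialize (A1 (Forall_cons _ (Sp_1 _) (Forall_nil _)) Sq).
    specialize (A2 (Forall_cons _ (Sp_1 _) (Forall_nil _)) (Sp_1 _)).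
    specialize (A3 (Forall_cons _ (Sp_1 _) (Forall_cons _ Sq (Forall_nil _))) (Sp_1 _)).
    rewrite Fq, F1 in A3.
    assert (A4 : (/ (1 + Rabs (M [one; q])) * M [one; q] <= 1)%R).
    { apply Rle_trans with (/ (1 + Rabs (M [one; q])) * (1 + Rabs (M [one; q])))%R.
      - apply Rmult_le_compat_l; [left; apply Rinv_0_lt_compat; lra|]. pose proof (Rle_abs (M [one; q])). lra.
      - rewrite Rinv_l; lra. }

    pose proof (Rle_abs (INR m * 1 - (B [q] - (B [one] - 0)))%R) as A5.
    pose proof (Rle_abs (B [q])) as A6. pose proof (Rle_abs (- B [one])) as A7. rewrite Rabs_Ropp in A7.
    replace (INR m - 0)%R with (INR m) in A3 by ring. lra.
  - set (J := j' :: J') in *.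
    (* Summing over all of [U j] makes the bound independent of the path and of its length. *)
    set (PM := fun s => lsum (fun u => lsum (fun s' => Rabs (M s')) (prs u s)) (U j)).
    assert (PMpos : forall s, (0 <= PM s)%R).
    { intros s. apply lsum_nonneg. intros; apply lsum_nonneg. intros; apply Rabs_pos. }
    apply (IH ltac:(discriminate) ND' (fun i I => Hn i (or_intror I)) (fun s => 2 * Rabs (M s) + PM s)%R).
    intros eps He. destruct (H eps He) as (B & HB1 & HB2).
    (* The boundary terms are at most [2 * Rabs (M s)]; with [m] above 1/eps, division by [m] puts
       them below [eps] times the new bound. *)
    destruct (INR_unbounded (/ eps)) as [m Hm].
    assert (Im : (0 < INR m)%R) by (pose proof (Rinv_0_lt_compat _ He); lra).
    destruct (HP j m) as (us & Lus & Ius & Fus); [apply Hn; now left|].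
    set (q := fun i => prodl (firstn i us)).
    assert (Iq : forall i, incl (firstn i us) (U j)).
    { intros i v Hv. apply Ius. rewrite <- (firstn_skipn i us). apply in_or_app; now left. }
    assert (Sq : forall i, Sp (j :: J) (q i)) by (intros i; apply (Sp_prodl _ j); [now left|apply Iq]).
    assert (Hq : forall i, (i < m)%nat -> exists u, In u (U j) /\ q (S i) = q i * u).
    { intros i Hi. exists (nth i us 1). split; [apply Ius, nth_In; lia|].
      unfold q. rewrite (firstn_snoc _ 1 us i) by lia. rewrite prodl_app. simpl. now rewrite mulg1. }
    assert (Fq : forall i, (i <= m)%nat -> f j (q i) = INR i) by exact Fus.
    assert (Cq : forall u x, In u (U j) -> Sp J x -> comm u x) by (intros u x Iu Hx; now apply (Hx j Nj)).
    assert (HPr : forall (F : list Q -> R) c s h, (0 <= c)%R -> Forall (Sp J) s -> Sp J h ->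
      (forall s' h', length s' = S (length s) -> Forall (Sp (j :: J)) s' -> Sp (j :: J) h' ->
        Rabs (F (map (mul h') s')) <= c * Rabs (M s'))%R ->
      forall i, (i < m)%nat ->
        (Rabs (Pr (mul (q i)) (mul (q (S i))) F (map (mul h) s)) <= c * PM s)%R).
    { intros F c s h Hc Hs Hh HF' i Hi. destruct (Hq i Hi) as (u & Iu & ->).
      eapply Rle_trans; [apply Pr_bound with (K := fun s' => (c * Rabs (M s'))%R)|].
      - now apply Cq.
      - eapply Forall_impl; [|exact Hs]. intros; now apply Cq.
      - intros s' Is. apply HF'.
        + now apply prs_length in Is.
        + eapply prs_Sp; [| |exact Is].
          * apply (Sp_U _ j); [now left|exact Iu].
          * eapply Forall_impl; [|exact Hs]. intros; now apply Sp_cons.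
        + apply Sp_mul; [apply Sq|now apply Sp_cons].
      - rewrite lsum_scal. apply Rmult_le_compat_l; [exact Hc|].
        apply (lsum_in _ (fun u => lsum (fun s' => Rabs (M s')) (prs u s))); [|exact Iu].
        intros; apply lsum_nonneg; intros; apply Rabs_pos. }
    assert (Hinv : forall r c, (Rabs r <= INR m * c)%R -> (Rabs (r * / INR m) <= c)%R).
    { intros r c Hr. rewrite Rabs_mult, (Rabs_right (/ INR m)) by (left; now apply Rinv_0_lt_compat).
      apply (Rmult_le_reg_r (INR m)); [exact Im|]. rewrite Rmult_assoc, Rinv_l by lra. lra. }
    set (S1 := fun F l => rsum m (fun i => Pr (mul (q i)) (mul (q (S i))) F l)).
    (* The minus sign comes from the homotopy formula: [S1 (D B)] equals the boundary terms minus
       [D (S1 B)]. *)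
    exists (fun l => 0 + - / INR m * S1 B l)%R. split.
    + intros s h Ls Hs Hh.
      replace (0 + - / INR m * S1 B (map (mul h) s))%R with (- (S1 B (map (mul h) s) * / INR m))%R by ring.
      rewrite Rabs_Ropp. apply Hinv. apply rsum_bound. intros i Hi.
      eapply Rle_trans; [apply (HPr B 1%R); auto; try lra|].
      * intros s' h' L' Hs' Hh'. rewrite Rmult_1_l. eapply Rle_trans; [apply HB1|apply Rle_abs]; auto.
        rewrite L', Ls. reflexivity.
      * pose proof (Rabs_pos (M s)). lra.
    + intros s h Ls Hs Hh. set (l := map (mul h) s).
      assert (Hl : Forall (Sp J) l).
      { apply Forall_map. eapply Forall_impl; [|exact Hs]. intros; now apply Sp_mul. }
      set (E := fun r => (cup (j :: J) r - D B r)%R).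
      assert (Ecup : S1 (cup (j :: J)) l = (INR m * cup J l)%R).
      { unfold S1. rewrite (rsum_ext m _ (fun i => (f j (q (S i)) - f j (q i)) * cup J l)%R).
        - rewrite rsum_scal, (rsum_telescope m (fun i => f j (q i))), !Fq by lia. simpl INR at 2. ring.
        - intros i Hi. unfold l in *. destruct s as [|x s]; [discriminate|].
          apply Pr_cup; [assumption|exact Hl|]. intros i' y Ii Iy.
          rewrite Forall_forall in Hl. specialize (Hl y Iy).
          change (q (S i)) with (prodl (firstn (S i) us)).
          rewrite (prodl_comm J j _ y Nj (Iq (S i)) Hl). apply (f_prodl i' j); [|apply Iq].
          intros ->. contradiction. }
      assert (Esum : S1 (cup (j :: J)) l = (S1 (D B) l + S1 E l)%R).
      { unfold S1. rewrite <- rsum_plus. apply rsum_ext. intros i _.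
        rewrite <- (Rmult_1_l (Pr _ _ E l)), <- Pr_lin. apply Pr_ext. intros r; unfold E; ring. }
      assert (EDB : S1 (D B) l = (B (map (mul (q m)) l) - B (map (mul (q O)) l) - D (S1 B) l)%R).
      { unfold S1. rewrite (D_rsum _ m l (fun i => Pr (mul (q i)) (mul (q (S i))) B)).
        rewrite <- (rsum_telescope m (fun i => B (map (mul (q i)) l))).
        rewrite <- (Rplus_0_r (rsum m (fun i => Pr _ _ (D B) l))).
        apply Rplus_eq_reg_r with (rsum m (fun i => D (Pr (mul (q i)) (mul (q (S i))) B) l)).
        rewrite Rplus_0_r, <- rsum_plus. ring_simplify. apply rsum_ext. intros i _.
        rewrite Rplus_comm. apply prism. }
      rewrite D_lin, D_zero.
      assert (BB : forall i, (Rabs (B (map (mul (q i)) l)) <= Rabs (M s))%R).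
      { intros i. unfold l. rewrite map_map.
        rewrite (map_ext _ (mul (q i * h))) by (intros; apply mulA).
        eapply Rle_trans; [apply HB1|apply Rle_abs].
        - exact Ls.
        - eapply Forall_impl; [|exact Hs]. intros; now apply Sp_cons.
        - apply Sp_mul; [apply Sq|now apply Sp_cons]. }
      assert (BE : (Rabs (S1 E l) <= INR m * (eps * PM s))%R).
      { apply rsum_bound. intros i Hi. apply HPr; auto; [lra|].
        intros s' h' L' Hs' Hh'. eapply Rle_trans; [apply HB2; auto; rewrite L', Ls; reflexivity|].
        apply Rmult_le_compat_l; [lra|apply Rle_abs]. }
      replace (cup J l - (0 + - / INR m * D (S1 B) l))%R with
        ((B (map (mul (q m)) l) - B (map (mul (q O)) l) + S1 E l) * / INR m)%R.
      * apply Hinv. eapply Rle_trans; [apply Rabs_triang|].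
        assert (Rabs (B (map (mul (q m)) l) - B (map (mul (q O)) l)) <= 2 * Rabs (M s))%R.
        { unfold Rminus. eapply Rle_trans; [apply Rabs_triang|]. rewrite Rabs_Ropp.
          pose proof (BB m). pose proof (BB O). lra. }
        assert (1 <= INR m * eps)%R.
        { apply (Rmult_le_reg_l (/ eps)); [now apply Rinv_0_lt_compat|].
          rewrite Rmult_1_r, (Rmult_comm (INR m)), <- Rmult_assoc, Rinv_l by lra. lra. }
        pose proof (Rabs_pos (M s)). pose proof (PMpos s). nra.
      * rewrite EDB in Esum. rewrite Ecup in Esum.
        replace (B (map (mul (q m)) l) - B (map (mul (q O)) l) + S1 E l)%R
          with (INR m * cup J l + D (S1 B) l)%R by lra.
        field. lra.
Qed.
End Cup.

(** * The group of a presentation *)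

Section Quotient.
Variable P : presentation.

Lemma geq_app u u' v v' : geq P u u' -> geq P v v' -> geq P (u ++ v) (u' ++ v').
Proof.
  intros H1 H2. apply geq_trans with (u' ++ v).
  - clear H2. induction H1 as [| | |u1 v1 a b|u1 v1 r I].
    + apply geq_refl.
    + now apply geq_sym.
    + eapply geq_trans; eassumption.
    + rewrite <- !app_assoc. simpl. apply geq_cancel.
    + rewrite <- !app_assoc. now apply geq_rel.
  - clear H1. induction H2 as [| | |u1 v1 a b|u1 v1 r I].
    + apply geq_refl.
    + now apply geq_sym.
    + eapply geq_trans; eassumption.
    + rewrite !app_assoc. apply geq_cancel.
    + rewrite !(app_assoc u'). now apply geq_rel.
Qed.

Lemma winv_app u v : winv (u ++ v) = winv v ++ winv u.
Proof. unfold winv. now rewrite map_app, rev_app_distr. Qed.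

Lemma winvK w : winv (winv w) = w.
Proof.
  unfold winv. rewrite map_rev, rev_involutive, map_map.
  rewrite <- (map_id w) at 2. apply map_ext. intros [i b]; simpl. now rewrite Bool.negb_involutive.
Qed.

Lemma winvr w : geq P (w ++ winv w) [].
Proof.
  induction w as [|[i b] w IH] using rev_ind; [apply geq_refl|].
  rewrite winv_app. simpl. rewrite <- app_assoc. simpl.
  eapply geq_trans; [apply geq_cancel|exact IH].
Qed.

Lemma winvl w : geq P (winv w ++ w) [].
Proof. pose proof (winvr (winv w)) as H. now rewrite winvK in H. Qed.

Lemma geq_winv u v : geq P u v -> geq P (winv u) (winv v).
Proof.
  intros H. apply geq_trans with (winv u ++ (v ++ winv v)).
  - rewrite <- (app_nil_r (winv u)) at 1. apply geq_app; [apply geq_refl|apply geq_sym, winvr].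
  - rewrite app_assoc. apply (geq_app _ [] _ (winv v)); [|apply geq_refl].
    apply geq_trans with (winv u ++ u); [|apply winvl].
    apply geq_app; [apply geq_refl|now apply geq_sym].
Qed.

Lemma valid_app u v : valid_word P u -> valid_word P v -> valid_word P (u ++ v).
Proof. intros; now apply Forall_app. Qed.

Lemma valid_winv w : valid_word P w -> valid_word P (winv w).
Proof. intros H. apply Forall_rev, Forall_map. exact H. Qed.

Lemma valid_nil : valid_word P [].
Proof. constructor. Qed.

(** Chosen from the class as a predicate, so equivalent words have the same canonical word. The
    quotient consists of the canonical words, and equality in it is plain equality. *)
Definition canon (w : word) : word :=
  epsilon (inhabits []) (fun u => valid_word P u /\ geq P w u).

Lemma canon_spec w : valid_word P w -> valid_word P (canon w) /\ geq P w (canon w).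
Proof.
  intros V. apply (epsilon_spec (inhabits []) (fun u => valid_word P u /\ geq P w u)).
  exists w. split; [exact V|apply geq_refl].
Qed.

Lemma canon_eq u v : geq P u v -> canon u = canon v.
Proof.
  intros H. unfold canon. f_equal. apply functional_extensionality; intros w.
  apply propositional_extensionality; split; intros [V E]; split; auto.
  - eapply geq_trans; [apply geq_sym, H|exact E].
  - eapply geq_trans; [exact H|exact E].
Qed.

Definition qcar := {w : word | valid_word P w /\ canon w = w}.

Definition mkcls (w : word) (V : valid_word P w) : qcar.
Proof.
  exists (canon w). destruct (canon_spec w V) as [V' E]. split; [exact V'|].
  symmetry. now apply canon_eq.
Defined.

Definition cls (w : word) : qcar :=
  match excluded_middle_informative (valid_word P w) with
  | left V => mkcls w V
  | right _ => mkcls [] valid_nil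
  end.

Definition val (x : qcar) : word := proj1_sig x.

Lemma val_valid x : valid_word P (val x).
Proof. apply (proj2_sig x). Qed.

Lemma val_inj x y : val x = val y -> x = y.
Proof. destruct x as [w H], y as [w' H']; simpl; intros; subst. f_equal. apply proof_irrelevance. Qed.

Lemma val_cls w : valid_word P w -> val (cls w) = canon w.
Proof. intros V. unfold cls. destruct excluded_middle_informative; [reflexivity|contradiction]. Qed.

Lemma cls_val x : cls (val x) = x.
Proof. apply val_inj. rewrite val_cls by apply val_valid. apply (proj2_sig x). Qed.

Lemma val_cls_geq w : valid_word P w -> geq P w (val (cls w)).
Proof. intros V. rewrite val_cls by assumption. now apply canon_spec. Qed.

Lemma cls_geq u v : valid_word P u -> valid_word P v -> (cls u = cls v <-> geq P u v).
Proof.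
  intros Vu Vv; split; intros H.
  - eapply geq_trans; [apply val_cls_geq, Vu|]. rewrite H. now apply geq_sym, val_cls_geq.
  - apply val_inj. rewrite !val_cls by assumption. now apply canon_eq.
Qed.

Definition pres_group : group.
Proof.
  refine (Group qcar (fun x y => cls (val x ++ val y)) (cls []) (fun x => cls (winv (val x))) _ _ _).
  - intros x y z. apply cls_geq; try (apply valid_app; apply val_valid).
    apply geq_trans with ((val x ++ val y) ++ val z).
    + rewrite <- app_assoc. apply geq_app; [apply geq_refl|].
      apply geq_sym, val_cls_geq, valid_app; apply val_valid.
    + apply geq_app; [|apply geq_refl]. apply val_cls_geq, valid_app; apply val_valid.
  - intros x. rewrite <- (cls_val x) at 2. apply cls_geq; [apply valid_app; apply val_valid|apply val_valid|].
    apply (geq_app _ [] _ (val x)); [|apply geq_refl]. apply geq_sym, val_cls_geq, valid_nil.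
  - intros x. apply cls_geq; [apply valid_app; apply val_valid|apply valid_nil|].
    eapply geq_trans; [|apply (winvl (val x))].
    apply geq_app; [|apply geq_refl]. apply geq_sym, val_cls_geq, valid_winv, val_valid.
Defined.

Lemma cls_app u v : valid_word P u -> valid_word P v ->
  cls (u ++ v) = @mul pres_group (cls u) (cls v).
Proof.
  intros Vu Vv. apply cls_geq; [now apply valid_app|apply valid_app; apply val_valid|].
  apply geq_app; now apply val_cls_geq.
Qed.

Lemma cls_winv w : valid_word P w -> cls (winv w) = inv (cls w : pres_group).
Proof.
  intros V. apply cls_geq; [now apply valid_winv|apply valid_winv, val_valid|].
  now apply geq_winv, val_cls_geq.
Qed.

Lemma cls_rel r : valid_pres P -> In r (prels P) -> cls r = (one : pres_group).
Proof.
  intros VP I. apply cls_geq; [|apply valid_nil|].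
  - unfold valid_pres in VP. rewrite Forall_forall in VP. auto.
  - pose proof (geq_rel P [] [] r I) as H. simpl in H. now rewrite app_nil_r in H.
Qed.

Lemma eval_cls phi w : valid_word P (wmap phi w) ->
  eval (fun i => cls [(phi i, false)] : pres_group) w = cls (wmap phi w).
Proof.
  induction w as [|[i b] w IH]; intros V; [reflexivity|].
  inversion V as [|? ? V1 V2]; subst. simpl in V1.
  assert (VL : forall c, valid_word P [(phi i, c)]) by (intros; constructor; [exact V1|constructor]).
  cbn [eval]. rewrite IH by exact V2.
  change (wmap phi ((i, b) :: w)) with ([(phi i, b)] ++ wmap phi w). rewrite cls_app by auto. f_equal.
  unfold lit; cbn [fst snd]. destruct b; [|reflexivity].
  rewrite <- cls_winv by auto. reflexivity.
Qed.
End Quotient.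

Arguments cls {P} w.
Arguments val {P} x.

(** * Inhomogeneous and homogeneous cochains *)

Section Cochains.
Local Open Scope R_scope.
Local Open Scope grp_scope.
Variable P : presentation.
Let Q := pres_group P.

Definition steps_of (l : list Q) (i : nat) : word := val (inv (nth i l (1 : Q)) * nth (S i) l (1 : Q) : Q).

(* With [p_0 = h^-1] and [p_(i+1) = p_i g_i], the value [c(g_0,..,g_(m-1))(h)] becomes a function of
   the points [p_0,..,p_m]; the bar coboundary turns into the simplicial one. *)
Definition hcoch (c : (nat -> word) -> word -> R) (l : list Q) : R :=
  c (steps_of l) (val (inv (nth 0 l (1 : Q)) : Q)).

Fixpoint pt (gs : nat -> word) (x : Q) (i : nat) : Q :=
  match i with O => x | S i => pt gs x i * (cls (gs i) : Q) end.

Definition pts (m : nat) (gs : nat -> word) (h : word) : list Q :=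
  map (pt gs (inv (cls h : Q))) (seq 0 (S m)).

Lemma nth_map_seq T (p : nat -> T) m i d : (i < m)%nat -> nth i (map p (seq 0 m)) d = p i.
Proof.
  intros H. rewrite (nth_indep _ d (p O)) by now rewrite length_map, length_seq.
  rewrite map_nth, seq_nth by assumption. reflexivity.
Qed.

Lemma hcoch_pts m c (p : nat -> Q) gs h : is_cochain P m c -> tuple_valid P gs -> valid_word P h ->
  (forall i, (i <= m)%nat -> p i = pt gs (inv (cls h : Q)) i) ->
  hcoch c (map p (seq 0 (S m))) = c gs h.
Proof.
  intros [Hc _] Vg Vh Hp. apply Hc.
  - intros i Hi. split; [apply val_valid|]. split; [apply Vg|].
    unfold steps_of. rewrite !nth_map_seq, !Hp by lia. cbn [pt]. rewrite mulKg.
    apply geq_sym, val_cls_geq, Vg.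
  - apply val_valid.
  - exact Vh.
  - rewrite nth_map_seq, Hp by lia. cbn [pt]. rewrite invK. now apply geq_sym, val_cls_geq.
Qed.

Definition skip (k j : nat) : nat := if (j <? k)%nat then j else S j.

Lemma rsum_first k (g : nat -> R) : rsum (S k) g = (g O + rsum k (fun i => g (S i)))%R.
Proof.
  revert g; induction k as [|k IH]; intros g; [simpl; ring|].
  change (rsum (S (S k)) g) with (rsum (S k) g + g (S k))%R. rewrite IH. simpl. ring.
Qed.

Lemma D_seq T m : forall (F : list T -> R) (p : nat -> T),
  D F (map p (seq 0 (S m))) = rsum (S m) (fun i => ((-1) ^ i * F (map (fun j => p (skip i j)) (seq 0 m)))%R).
Proof.
  induction m as [|m IH]; intros F p; [simpl; ring|].
  change (D F (map p (seq 0 (S (S m))))) with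
    (F (map p (seq 1 (S m))) - D (fun r => F (p O :: r)) (map p (seq 1 (S m))))%R.
  rewrite <- (seq_shift (S m) 0), map_map.
  rewrite (IH (fun r => F (p O :: r)) (fun i => p (S i))), (rsum_first (S m)). unfold Rminus. f_equal.
  - cbn [pow]. rewrite Rmult_1_l. reflexivity.
  - rewrite <- (Rmult_1_r (rsum _ _)), Ropp_mult_distr_r, <- rsum_scal. apply rsum_ext. intros i _.
    cbn [pow]. replace (map (fun j => p (skip (S i) j)) (seq 0 (S m))) with
      (p O :: map (fun j => p (S (skip i j))) (seq 0 m)); [ring|].
    change (seq 0 (S m)) with (O :: seq 1 m). rewrite <- seq_shift. cbn [map]. rewrite map_map.
    f_equal. apply map_ext. intros j. unfold skip. f_equal.
    change (S j <? S i)%nat with (j <? i)%nat. now destruct (j <? i)%nat.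
Qed.

Lemma tmerge_valid i gs : tuple_valid P gs -> tuple_valid P (tmerge i gs).
Proof.
  intros V j. unfold tmerge. destruct (j <? i)%nat; [apply V|]. destruct (j =? i)%nat; [apply valid_app; apply V|apply V].
Qed.

Lemma coboundary_D m b gs h : is_cochain P m b -> tuple_valid P gs -> valid_word P h ->
  coboundary m b gs h = D (hcoch b) (pts (S m) gs h).
Proof.
  intros Hb Vg Vh. unfold pts. rewrite D_seq.
  set (p := pt gs (inv (cls h : Q))).
  set (g := fun i => ((-1) ^ i * hcoch b (map (fun j => p (skip i j)) (seq 0 (S m))))%R).
  change (rsum (S (S m)) g) with (rsum (S m) g + g (S m))%R. rewrite rsum_first.
  unfold coboundary. f_equal; [f_equal|].
  (* Deleting the base point [h^-1] leaves [h^-1 g_0] as the new one, the inverse of [g_0^-1 h]: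
     this is the term with the action on coefficients. *)
  - unfold g. cbn [pow]. rewrite Rmult_1_l. symmetry. apply (hcoch_pts m); auto.
    + intros i; apply Vg.
    + apply valid_app; [apply valid_winv, Vg|exact Vh].
    + intros i _. unfold skip. cbn [Nat.ltb Nat.leb]. rewrite cls_app, cls_winv by (try apply valid_winv; auto).
      rewrite invM, invK. unfold p. induction i as [|i IH]; [reflexivity|].
      change (pt gs (inv (cls h : Q)) (S (S i))) with (pt gs (inv (cls h : Q)) (S i) * (cls (gs (S i)) : Q)).
      rewrite IH. reflexivity.
  - apply rsum_ext. intros i Hi. unfold g. f_equal. symmetry. apply (hcoch_pts m); auto.
    + now apply tmerge_valid.
    + intros j _. unfold p. induction j as [|j IH]; [reflexivity|].
      cbn [pt]. rewrite <- IH. unfold skip, tmerge.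
      destruct (Nat.ltb_spec j i), (Nat.eqb_spec j i), (Nat.ltb_spec j (S i)), (Nat.ltb_spec (S j) (S i)); try lia;
        try reflexivity.
      subst j. rewrite cls_app by apply Vg. cbn [pt]. now rewrite mulA.
  - unfold g. f_equal. symmetry. apply (hcoch_pts m); auto.
    intros i Hi. unfold skip. destruct (Nat.ltb_spec i (S m)); [reflexivity|lia].
Qed.

Lemma pts_steps m l : length l = S m -> pts m (steps_of l) (val (inv (nth 0 l (1 : Q)) : Q)) = l.
Proof.
  intros L. apply nth_ext with (1 : Q) (1 : Q); unfold pts; [now rewrite length_map, length_seq|].
  intros i Hi. rewrite length_map, length_seq in Hi. rewrite nth_map_seq by assumption.
  rewrite cls_val, invK. clear Hi. induction i as [|i IH]; [reflexivity|].
  cbn [pt]. rewrite IH. unfold steps_of. rewrite cls_val. apply mulKVg.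
Qed.

Lemma steps_valid l : tuple_valid P (steps_of l).
Proof. intros i; apply val_valid. Qed.

(** Left translation of [s] does not change its successive quotients [steps_of s]; it moves only the
    argument at which the bounded function [c (steps_of s)] is evaluated. *)
Lemma hcoch_bounded m c s : is_cochain P m c -> length s = S m ->
  exists M, forall h : Q, (Rabs (hcoch c (map (mul h) s)) <= M)%R.
Proof.
  intros [Hc1 Hc2] L. destruct (Hc2 (steps_of s) (steps_valid s)) as [M HM].
  exists M. intros h. unfold hcoch.
  rewrite (Hc1 _ (steps_of s) _ (val (inv (nth 0 (map (mul h) s) (1 : Q)) : Q))).
  - apply HM, val_valid.
  - intros i Hi. split; [apply val_valid|]. split; [apply val_valid|].
    unfold steps_of. rewrite !(nth_indep (map (mul h) s) (1 : Q) (h * (1 : Q))) by (rewrite length_map; lia).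
    rewrite !map_nth, invM, mulAr, mulKg. apply geq_refl.
  - apply val_valid.
  - apply val_valid.
  - apply geq_refl.
Qed.

Lemma D_ext_len T m : forall (F G : list T -> R) l, (forall r, length r = m -> F r = G r) ->
  length l = S m -> D F l = D G l.
Proof.
  induction m as [|m IH]; intros F G l H L; destruct l as [|x l]; try discriminate; injection L as L.
  - simpl. rewrite (H l L). destruct l; [reflexivity|discriminate].
  - simpl. rewrite (H l L). f_equal. apply IH; [|exact L]. intros r Hr. apply H. simpl; now rewrite Hr.
Qed.

Lemma pt_mul gs x i : pt gs x i = x * pt gs 1 i.
Proof. induction i as [|i IH]; cbn [pt]; [now rewrite mulg1|]. now rewrite IH, mulA. Qed.

Lemma cup_bounded (f : nat -> Q -> R) :
  (forall j x, exists K, forall g, (Rabs (f j (mul g x) - f j g) <= K)%R) ->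
  forall J s, exists M, forall g, (Rabs (cup Q f J (map (mul g) s)) <= M)%R.
Proof.
  intros HL. induction J as [|j J IH]; intros s.
  - exists 1%R. intros g. destruct s as [|x [|y s]]; simpl; rewrite ?Rabs_R0, ?Rabs_R1; lra.
  - destruct s as [|x [|y s]]; [exists 0%R; intros; simpl; rewrite Rabs_R0; lra..|].
    destruct (IH (y :: s)) as [M HM]. destruct (HL j (inv x * y)) as [K HK].
    exists (K * M)%R. intros g. cbn [map cup]. rewrite Rabs_mult.
    apply Rmult_le_compat; try apply Rabs_pos; [|apply (HM g)].
    specialize (HK (g * x)). rewrite mulAr, mulKVg in HK. exact HK.
Qed.

Theorem cup_not_coboundary (n : nat) (U : nat -> list Q) (f : nat -> Q -> R) : (1 <= n)%nat ->
  (forall i j u v, i <> j -> In u (U i) -> In v (U j) -> comm u v) ->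
  (forall i j u g, i <> j -> In u (U j) -> f i (g * u) = f i g) ->
  (forall j m, (j < n)%nat -> exists us, length us = m /\ incl us (U j) /\
     forall i, (i <= m)%nat -> f j (prodl Q (firstn i us)) = INR i) ->
  (forall j x, exists K, forall g, (Rabs (f j (mul g x) - f j g) <= K)%R) ->
  ~ Hinf_vanishes P n.
Proof.
  intros Hn HC HF HP HL HV.
  set (J := seq 0 n). assert (LJ : length J = n) by apply length_seq.
  set (c := fun gs h => cup Q f J (pts n gs h)).
  assert (Hc : is_cochain P n c).
  { split.
    - intros gs hs h h' Hg Vh Vh' E. unfold c, pts.
      rewrite (proj2 (cls_geq P h h' Vh Vh') E). f_equal. apply map_ext_in. intros i Ii.
      apply in_seq in Ii. assert (Hi : (i <= n)%nat) by lia. clear Ii.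
      induction i as [|i IH]; [reflexivity|]. cbn [pt]. rewrite IH by lia. f_equal.
      destruct (Hg i) as (V1 & V2 & E'); [lia|]. now apply cls_geq.
    - intros gs Vg. destruct (cup_bounded f HL J (map (pt gs 1) (seq 0 (S n)))) as [M HM].
      exists M. intros h Vh. unfold c, pts. specialize (HM (inv (cls h : Q))). rewrite map_map in HM.
      rewrite (map_ext _ (fun i => inv (cls h : Q) * pt gs 1 i)); [exact HM|].
      intros i. apply pt_mul. }
  assert (Hcl : forall l, length l = S n -> hcoch c l = cup Q f J l).
  { intros l L. unfold hcoch, c. now rewrite (pts_steps n l L). }
  destruct (HV c Hc) as (b & Hb & E).
  { intros gs h Vg Vh. rewrite coboundary_D by assumption.
    assert (L : length (pts (S n) gs h) = S (S n)) by (unfold pts; now rewrite length_map, length_seq).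
    rewrite (D_ext_len _ (S n) _ (cup Q f J) _ Hcl L).
    apply cup_closed. rewrite L, LJ. reflexivity. }
  assert (E' : forall l, length l = S n -> cup Q f J l = D (hcoch b) l).
  { intros l L. rewrite <- (Hcl l L). unfold hcoch at 1.
    rewrite E by (try apply val_valid; apply steps_valid).
    rewrite coboundary_D by (try assumption; try apply val_valid; apply steps_valid).
    replace (S (pred n)) with n by lia. now rewrite (pts_steps n l L). }
  (* The absolute value keeps [M] nonnegative: the error of the exact primitive is 0 and must not
     exceed [eps * M s]. *)
  set (M := fun s : list Q => Rabs (epsilon (inhabits 0%R) (fun M => forall h : Q, (Rabs (hcoch b (map (mul h) s)) <= M)%R))).
  apply (no_approx_primitive Q n U f HC HF HP J) with (M := M).
  - intros EJ. rewrite EJ in LJ. simpl in LJ. lia.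
  - apply seq_NoDup.
  - intros j Ij. apply in_seq in Ij. lia.
  - intros eps He. exists (hcoch b). split.
    + intros s h Ls _ _. eapply Rle_trans; [|apply Rle_abs].
      apply (epsilon_spec (inhabits 0%R) (fun M => forall h : Q, (Rabs (hcoch b (map (mul h) s)) <= M)%R)).
      apply (hcoch_bounded (pred n)); [exact Hb|]. rewrite Ls, LJ. lia.
    + intros s h Ls _ _. rewrite E' by (rewrite length_map, Ls, LJ; reflexivity).
      rewrite Rminus_diag, Rabs_R0. apply Rmult_le_pos; [lra|apply Rabs_pos].
Qed.
End Cochains.

(** * Word norms *)

Section Norm.
Local Open Scope nat_scope.
Local Open Scope grp_scope.
Variables (Q G : group) (pi : Q -> G) (U : list Q).
Hypothesis piM : forall x y, pi (x * y) = pi x * pi y.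
Hypothesis gen : forall x, exists us, incl us U /\ pi (prodl Q us) = pi x.

Let spells (g : G) (k : nat) := exists us, length us = k /\ incl us U /\ pi (prodl Q us) = g.

(** The word length is measured in [G], after projection, so that elements killed by [pi] do not
    affect it. The chosen value is meaningful on the image of [pi]. *)
Definition nrm (g : G) : nat :=
  epsilon (inhabits O) (fun k => spells g k /\ forall k', spells g k' -> k <= k').

Lemma nrm_spec x : spells (pi x) (nrm (pi x)) /\ forall k, spells (pi x) k -> nrm (pi x) <= k.
Proof.
  apply (epsilon_spec (inhabits O) (fun k => spells (pi x) k /\ forall k', spells (pi x) k' -> k <= k')).
  destruct (dec_inh_nat_subset_has_unique_least_element (spells (pi x))) as (k & Hk & _).
  - intros k. apply classic.
  - destruct (gen x) as (us & I & E). exists (length us), us. auto.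
  - exists k. exact Hk.
Qed.

Lemma nrm_le us : incl us U -> nrm (pi (prodl Q us)) <= length us.
Proof. intros I. apply nrm_spec. exists us. auto. Qed.

Lemma nrm_mul x y : nrm (pi (x * y)) <= nrm (pi x) + nrm (pi y).
Proof.
  destruct (proj1 (nrm_spec x)) as (us & <- & Iu & Eu), (proj1 (nrm_spec y)) as (vs & <- & Iv & Ev).
  rewrite piM, <- Eu, <- Ev, <- piM, <- prodl_app, <- length_app. apply nrm_le. now apply incl_app.
Qed.

Lemma nrm_lipschitz x : exists K, forall g, (Rabs (INR (nrm (pi (g * x))) - INR (nrm (pi g))) <= K)%R.
Proof.
  exists (INR (nrm (pi x) + nrm (pi (inv x)))). intros g.
  pose proof (nrm_mul g x) as H1. pose proof (nrm_mul (g * x) (inv x)) as H2.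
  rewrite mulAr, mulgV, mulg1 in H2.
  apply le_INR in H1, H2. rewrite plus_INR in H1, H2. rewrite plus_INR.
  pose proof (pos_INR (nrm (pi x))). pose proof (pos_INR (nrm (pi (inv x)))).
  apply Rabs_le. lra.
Qed.

Fixpoint lists_upto (m : nat) : list (list Q) :=
  match m with
  | O => [[]]
  | S m => [] :: flat_map (fun u => map (cons u) (lists_upto m)) U
  end.

Lemma in_lists_upto m : forall us, incl us U -> length us <= m -> In us (lists_upto m).
Proof.
  induction m as [|m IH]; intros us I L; destruct us as [|u us]; simpl in *; try lia; auto.
  right. apply in_flat_map. exists u. split; [apply I; now left|]. apply in_map, IH; [|lia].
  intros v Hv; apply I; now right.
Qed.

(** Balls are finite, being images of the finitely many short lists over [U], whereas the powers of
    [pi x] are pairwise distinct. *)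
Lemma nrm_unbounded x : inf_order (pi x) -> forall m, exists y, m <= nrm (pi y).
Proof.
  intros Inf m. apply NNPP. intros N.
  assert (Hy : forall y, nrm (pi y) <= m).
  { intros y. destruct (le_gt_dec m (nrm (pi y))); [exfalso; apply N; eauto|lia]. }
  assert (pi1 : pi 1 = 1) by (apply idem1; now rewrite <- piM, mul1g).
  assert (Ez : forall i, pi (zpow x i) = zpow (pi x) i).
  { apply Z_step_ind; [exact pi1| |]; intros i IH.
    - now rewrite !zpow_succ, piM, IH.
    - rewrite !zpow_pred, piM, IH. f_equal. apply inv_uniq. now rewrite <- piM, mulgV. }
  set (L := map (fun us => pi (prodl Q us)) (lists_upto m)).
  set (Z := map (fun i => zpow (pi x) (Z.of_nat i)) (seq 0 (S (length L)))).
  assert (length Z <= length L).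
  { apply NoDup_incl_length.
    - apply Injective_map_NoDup; [|apply seq_NoDup].
      intros i j E. apply (inf_order_zpow_inj _ _ Inf) in E. lia.
    - intros g Ig. apply in_map_iff in Ig as (i & <- & _). rewrite <- Ez.
      destruct (proj1 (nrm_spec (zpow x (Z.of_nat i)))) as (us & Lu & Iu & <-).
      apply (in_map (fun us => pi (prodl Q us))). apply in_lists_upto; [exact Iu|]. rewrite Lu. apply Hy. }
  unfold Z in H. rewrite length_map, length_seq in H. lia.
Qed.

(** A prefix of a shortest word is itself shortest, by the triangle inequality with the remaining
    suffix. *)
Lemma geodesic x : inf_order (pi x) -> forall m, exists us, length us = m /\ incl us U /\
  forall i, i <= m -> nrm (pi (prodl Q (firstn i us))) = i.
Proof.
  intros Inf m. destruct (nrm_unbounded x Inf m) as [y Hy].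
  destruct (proj1 (nrm_spec y)) as (us & Lu & Iu & Eu).
  assert (If : forall i, incl (firstn i us) U).
  { intros i v Hv. apply Iu. rewrite <- (firstn_skipn i us). apply in_or_app; now left. }
  exists (firstn m us). split; [rewrite length_firstn; lia|]. split; [apply If|].
  intros i Hi. rewrite firstn_firstn, Nat.min_l by assumption.
  pose proof (nrm_le (firstn i us) (If i)) as H1. rewrite length_firstn in H1.
  pose proof (nrm_mul (prodl Q (firstn i us)) (prodl Q (skipn i us))) as H2.
  rewrite <- prodl_app, firstn_skipn, Eu in H2.
  assert (Is : incl (skipn i us) U).
  { intros v Hv. apply Iu. rewrite <- (firstn_skipn i us). apply in_or_app; now right. }
  pose proof (nrm_le (skipn i us) Is) as H3. rewrite length_skipn in H3. lia.
Qed.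
End Norm.

(** * Direct powers of a presentation *)

Section Power.
Local Open Scope nat_scope.
Local Open Scope grp_scope.

(* The copies are interleaved so that the generators occurring in [var_word] get indices that do not
   depend on the number [N] of generators of a copy. *)
Definition slot (n c i : nat) : nat := (i * n + c)%nat.

Definition comm_rels (n N : nat) : list word :=
  flat_map (fun i => map (fun j => eqn [pw i; pw j] [pw j; pw i])
    (filter (fun j => negb (i mod n =? j mod n)) (seq 0 (N * n)%nat))) (seq 0 (N * n)%nat).

Variables (n N : nat) (P : presentation).
Hypothesis (n_pos : 0 < n).

(* Only the set of relators matters, which leaves their order free to suit [ppres]. *)
Definition is_power (rels : list word) : Prop :=
  pgens P = (N * n)%nat /\
  forall r, In r (prels P) <->
    (exists w c, In w rels /\ c < n /\ r = wmap (slot n c) w) \/ In r (comm_rels n N).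

Variable rels : list word.
Hypothesis (HP : is_power rels) (HV : valid_pres P).

Let Q := pres_group P.

Lemma slot_mod c i : c < n -> slot n c i mod n = c.
Proof. intros. unfold slot. rewrite Nat.add_comm, Nat.Div0.mod_add. now apply Nat.mod_small. Qed.

Lemma slot_div c i : c < n -> slot n c i / n = i.
Proof. intros. unfold slot. rewrite Nat.div_add_l by lia. rewrite Nat.div_small by assumption. lia. Qed.

Lemma slot_eq m : m = slot n (m mod n) (m / n).
Proof. unfold slot. pose proof (Nat.div_mod_eq m n). lia. Qed.

Lemma gen_lt m : m < (N * n)%nat -> m / n < N.
Proof. intros. apply Nat.Div0.div_lt_upper_bound. lia. Qed.

Lemma slot_lt c i : c < n -> i < N -> slot n c i < (N * n)%nat.
Proof. intros. unfold slot. nia. Qed.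

Lemma valid_letter m b : m < (N * n)%nat -> valid_word P [(m, b)].
Proof. intros. constructor; [|constructor]. simpl. destruct HP as [-> _]. assumption. Qed.

Lemma comm_rel i j : i < (N * n)%nat -> j < (N * n)%nat -> i mod n <> j mod n ->
  comm (cls [(i, false)] : Q) (cls [(j, false)] : Q).
Proof.
  intros Hi Hj Ne.
  assert (I : In (eqn [pw i; pw j] [pw j; pw i]) (prels P)).
  { apply HP. right. apply in_flat_map. exists i. split; [apply in_seq; lia|].
    apply in_map_iff. exists j. split; [reflexivity|]. apply filter_In. split; [apply in_seq; lia|].
    destruct (Nat.eqb_spec (i mod n) (j mod n)); [contradiction|reflexivity]. }
  apply cls_rel in I; [|exact HV]. unfold eqn in I.
  assert (V2 : forall a b, a < (N * n)%nat -> b < (N * n)%nat -> valid_word P [pw a; pw b]).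
  { intros a b Ha Hb. apply (valid_app P [pw a] [pw b]); now apply valid_letter. }
  rewrite cls_app, cls_winv in I by (try apply valid_winv; now apply V2).
  apply (divg1_eq Q) in I.
  change [pw i; pw j] with ([pw i] ++ [pw j]) in I. change [pw j; pw i] with ([pw j] ++ [pw i]) in I.
  rewrite !cls_app in I by now apply valid_letter. exact I.
Qed.

Lemma trivial_vanishes m :
  (forall (G : group) (nu : nat -> G), (forall w, In w rels -> eval nu w = 1) -> forall i, i < N -> nu i = 1) ->
  1 <= m -> Hinf_vanishes P m.
Proof.
  intros HT Hm.
  assert (T : forall w, valid_word P w -> geq P w []).
  { assert (TL : forall i, i < (N * n)%nat -> (cls [(i, false)] : Q) = 1).
    { intros i Hi. rewrite (slot_eq i).
      assert (Hc : i mod n < n) by (apply Nat.mod_upper_bound; lia).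
      apply (HT Q (fun y => cls [(slot n (i mod n) y, false)] : Q)); [|now apply gen_lt].
      intros w Iw.
      assert (Ir : In (wmap (slot n (i mod n)) w) (prels P)) by (apply HP; left; eauto).
      etransitivity; [apply (eval_cls P)|].
      2: now apply cls_rel.
      pose proof HV as HV'. unfold valid_pres in HV'. rewrite Forall_forall in HV'. auto. }
    intros w V. apply (cls_geq P w [] V (valid_nil P)).
    change (cls (P := P) []) with (1 : Q).
    induction w as [|[i b] w IH]; [reflexivity|].
    inversion V as [|? ? V1 V2]; subst. simpl in V1. rewrite (proj1 HP) in V1.
    change ((i, b) :: w) with ([(i, b)] ++ w). rewrite cls_app by (auto; now apply valid_letter).
    rewrite IH by assumption. rewrite mulg1. destruct b; [|now apply TL].
    change [(i, true)] with (winv [(i, false)]). rewrite cls_winv by now apply valid_letter.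
    rewrite TL by assumption. apply (inv1 Q). }
  intros c Hc Hd. destruct Hc as [Hc1 Hc2].
  set (a := c (fun _ => []) []).
  assert (Ha : forall gs h, tuple_valid P gs -> valid_word P h -> c gs h = a).
  { intros gs h Vg Vh. apply Hc1; auto; [|apply valid_nil]. intros i _. repeat split; auto. apply valid_nil. }
  assert (Hb : is_cochain P (pred m) (fun _ _ => a)).
  { split; [reflexivity|]. intros; exists (Rabs a); intros; lra. }
  (* All cochains are constant here, and the constant [a] works for both parities. For even [m] the
     signs in its coboundary add up to 1; for odd [m] they add up to 0, but then the cocycle
     condition forces [a = 0]. *)
  exists (fun _ _ => a). split; [exact Hb|].
  intros gs h Vg Vh. rewrite Ha by assumption.
  assert (E : coboundary m (fun _ _ => a) gs h = 0%R).
  { rewrite <- (Hd gs h Vg Vh). unfold coboundary. rewrite !Ha; auto.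
    - f_equal. f_equal. apply rsum_ext. intros i _. rewrite Ha; auto. now apply tmerge_valid.
    - intros i; apply Vg.
    - apply valid_app; [apply valid_winv, Vg|exact Vh]. }
  unfold coboundary in *. destruct m as [|m]; [lia|]. cbn [pred]. cbn [rsum] in E.
  assert (Alt : forall k, (2 * rsum k (fun i => (-1) ^ S i * a) = (-1) ^ k * a - a)%R).
  { induction k as [|k IHk]; simpl in *; lra. }
  specialize (Alt m).
  change ((-1) ^ S (S m))%R with (-1 * (-1 * (-1) ^ m))%R in E.
  change ((-1) ^ S m)%R with (-1 * (-1) ^ m)%R in E |- *. lra.
Qed.

Lemma eval_letters (G : group) (nu : nat -> G) (U : list Q) (pi : Q -> G) :
  (forall i b, i < (N * n)%nat -> nu i = 1 \/ In (cls [(i, b)]) U) ->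
  (forall x, pi x = eval nu (val x)) -> (forall u v, geq P u v -> eval nu u = eval nu v) ->
  forall x, exists us, incl us U /\ pi (prodl Q us) = pi x.
Proof.
  intros HU Hpi Hgeq.
  assert (pic : forall w, valid_word P w -> pi (cls w) = eval nu w).
  { intros w V. rewrite Hpi. apply Hgeq, geq_sym, val_cls_geq, V. }
  assert (piM : forall x y, pi (x * y) = pi x * pi y).
  { intros x y. change (x * y) with (cls (val x ++ val y) : Q).
    rewrite pic by (apply valid_app; apply val_valid). rewrite eval_app, !Hpi. reflexivity. }
  intros x. pose proof (val_valid P x) as V. rewrite (Hpi x). revert V. generalize (val x). clear x.
  induction w as [|[i b] w IH]; intros V.
  - exists []. split; [intros u []|]. simpl. exact (pic [] (Forall_nil _)).
  - inversion V as [|? ? V1 V2]; subst. simpl in V1. rewrite (proj1 HP) in V1.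
    destruct (IH V2) as (us & Iu & Eu). destruct (HU i b V1) as [E|I].
    + exists us. split; [exact Iu|]. rewrite Eu. simpl. unfold lit; simpl. rewrite E.
      destruct b; rewrite ?inv1; now rewrite mul1g.
    + exists (cls [(i, b)] :: us). split.
      * intros u [<-|Hu]; [exact I|now apply Iu].
      * cbn [prodl eval]. rewrite piM, Eu, pic by now apply valid_letter. simpl. now rewrite mulg1.
Qed.

Lemma infinite_not_vanishes (G : group) (nu : nat -> G) w0 :
  (forall w, In w rels -> eval nu w = 1) ->
  Forall (fun l : letter => fst l < N) w0 -> inf_order (eval nu w0) ->
  ~ Hinf_vanishes P n.
Proof.
  intros HR V0 Inf.
  (* Projection to the copy [c]: the letters of the other copies become trivial. *)
  set (nuc := fun c m => if m mod n =? c then nu (m / n) else 1).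
  assert (Hgeq : forall c u v, geq P u v -> eval (nuc c) u = eval (nuc c) v).
  { intros c. apply eval_geq. intros r Ir. apply HP in Ir as [(w & c' & Iw & Hc' & ->)|Ir].
    - rewrite eval_wmap. destruct (Nat.eq_dec c' c) as [->|Ne].
      + rewrite (eval_ext _ _ nu); [now apply HR|]. intros i. unfold nuc.
        rewrite slot_mod, Nat.eqb_refl, slot_div by assumption. reflexivity.
      + rewrite (eval_ext _ _ (fun _ => 1)).
        * clear. induction w as [|[i b] w IH]; simpl; [reflexivity|]. rewrite IH, mulg1.
          unfold lit; simpl. destruct b; [apply inv1|reflexivity].
        * intros i. unfold nuc. rewrite slot_mod by assumption. now destruct (Nat.eqb_spec c' c).
    - apply in_flat_map in Ir as (i & _ & Ir). apply in_map_iff in Ir as (j & <- & Ij).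
      apply filter_In in Ij as [_ Ij]. apply eval_eqn. rewrite !eval_pw2. unfold nuc.
      destruct (Nat.eqb_spec (i mod n) c) as [Ei|], (Nat.eqb_spec (j mod n) c) as [Ej|]; rewrite ?mul1g, ?mulg1; try reflexivity.
      rewrite Ei, Ej, Nat.eqb_refl in Ij. discriminate. }
  set (pi := fun c (x : Q) => eval (nuc c) (val x)).
  assert (pic : forall c w, valid_word P w -> pi c (cls w) = eval (nuc c) w).
  { intros c w V. unfold pi. apply Hgeq, geq_sym, val_cls_geq, V. }
  assert (piM : forall c x y, pi c (x * y) = pi c x * pi c y).
  { intros c x y. change (x * y) with (cls (val x ++ val y) : Q).
    rewrite pic by (apply valid_app; apply val_valid). now rewrite eval_app. }
  set (U := fun c => flat_map (fun i => [cls [(i, false)] : Q; cls [(i, true)] : Q])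
                       (filter (fun i => i mod n =? c) (seq 0 (N * n)%nat))).
  assert (HU : forall c u, In u (U c) <-> exists i b, i < (N * n)%nat /\ i mod n = c /\ u = cls [(i, b)]).
  { intros c u. unfold U. rewrite in_flat_map. split.
    - intros (i & Ii & Iu). apply filter_In in Ii as [Ii Ec]. apply in_seq in Ii. apply Nat.eqb_eq in Ec.
      destruct Iu as [<-|[<-|[]]]; [exists i, false|exists i, true]; repeat split; auto; lia.
    - intros (i & b & Hi & Ec & ->). exists i. split.
      + apply filter_In. split; [apply in_seq; lia|now apply Nat.eqb_eq].
      + destruct b; simpl; auto. }
  assert (Hgen : forall c x, exists us, incl us (U c) /\ pi c (prodl Q us) = pi c x).
  { intros c. apply (eval_letters G (nuc c)); [|reflexivity|apply Hgeq].
    intros i b Hi. unfold nuc. destruct (Nat.eqb_spec (i mod n) c); [right|now left].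
    apply HU. exists i, b. auto. }
  apply (cup_not_coboundary P n U (fun c x => INR (nrm Q G (pi c) (U c) (pi c x)))).
  - lia.
  - intros c c' u v Ne Iu Iv. apply HU in Iu as (i & b & Hi & Ei & ->), Iv as (j & b' & Hj & Ej & ->).
    assert (C : comm (cls [(i, false)] : Q) (cls [(j, false)] : Q)) by (apply comm_rel; auto; congruence).
    assert (Ev : forall k, k < (N * n)%nat -> (cls [(k, true)] : Q) = inv (cls [(k, false)] : Q)).
    { intros k Hk. change [(k, true)] with (winv [(k, false)]). apply cls_winv. now apply valid_letter. }
    destruct b, b'; rewrite ?Ev by assumption.
    + apply comm_invl, comm_sym, comm_invl, comm_sym, C.
    + apply comm_invl, C.
    + apply comm_sym, comm_invl, comm_sym, C.
    + exact C.
  - intros c c' u g Ne Iu. apply HU in Iu as (i & b & Hi & Ei & ->).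
    rewrite piM, (pic c [(i, b)]) by now apply valid_letter. simpl. unfold lit, nuc; simpl.
    destruct (Nat.eqb_spec (i mod n) c); [congruence|]. destruct b; now rewrite ?inv1, !mulg1.
  - intros c m Hc.
    assert (V : valid_word P (wmap (slot n c) w0)).
    { apply Forall_map. eapply Forall_impl; [|exact V0]. intros l Hl. simpl. rewrite (proj1 HP). now apply slot_lt. }
    destruct (geodesic Q G (pi c) (U c) (piM c) (Hgen c) (cls (wmap (slot n c) w0))) with (m := m)
      as (us & Lu & Iu & Fu).
    + rewrite pic by exact V. rewrite eval_wmap.
      rewrite (eval_ext _ _ nu); [exact Inf|]. intros i. unfold nuc.
      now rewrite slot_mod, Nat.eqb_refl, slot_div by assumption.
    + exists us. repeat split; auto.
  - intros c x. apply (nrm_lipschitz Q G (pi c) (U c) (piM c) (Hgen c)).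
Qed.
End Power.

(** * The diagonal argument *)

Section Diagonal.
Local Open Scope nat_scope.

Section Machine.
Variables (f : prf).

(** Registers 0 and 1 hold the input, register 2 receives the value, and scratch space starts at
    3. *)
Let K := clen (compile_prf f [0; 1] 2 3).
Let cleanup := Seq (clear 0 3) (clear 1 3).
Definition halt_pc : nat := S K + clen cleanup.

(* The label [S halt_pc] lies outside the program: the machine gets stuck there unless the value is 0. *)
Definition zero_test : list instr :=
  compile (compile_prf f [0; 1] 2 3) 0 K ++ DEC 2 (S halt_pc) (S K) :: compile cleanup (S K) halt_pc.

Definition input (a b : nat) : store := fun i => match i with 0 => a | 1 => b | _ => 0 end.

Lemma zero_test_length : length zero_test = halt_pc.
Proof.
  unfold zero_test, halt_pc. rewrite length_app. cbn [length]. rewrite !compile_length. fold K. lia.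
Qed.

Lemma halt_pc_none : nth_error zero_test halt_pc = None.
Proof. apply nth_error_None. rewrite zero_test_length. lia. Qed.

Lemma zero_test_placed :
  placed zero_test 0 (compile (compile_prf f [0; 1] 2 3) 0 K) /\
  nth_error zero_test K = Some (DEC 2 (S halt_pc) (S K)) /\
  placed zero_test (S K) (compile cleanup (S K) halt_pc).
Proof.
  assert (H : placed zero_test 0 zero_test) by (intros j a E; exact E).
  unfold zero_test at 2 in H. apply placed_app in H as [H1 H2].
  rewrite compile_length in H2. fold K in H2. apply placed_cons in H2 as [H2 H3]. auto.
Qed.

Lemma zero_test_run a b y : peval f [a; b] y ->
  steps zero_test (0, enc (input a b)) (K, enc (upd (input a b) 2 y)).
Proof.
  intros E. apply (compile_correct (compile_prf f [0; 1] 2 3)); [|apply zero_test_placed].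
  apply (comp_correct f [a; b] y E); auto; try lia.
  - simpl; lia.
  - intros [|[|[|j]]] ?; simpl; lia.
Qed.

Lemma steps_reach prog h c c' : steps prog c c' -> reach prog h c' -> reach prog h c.
Proof. induction 1; intros; auto. eapply reach_step; eauto. Qed.

Lemma steps_reach_inv prog h c c' : nth_error prog h = None -> steps prog c c' ->
  reach prog h c -> reach prog h c'.
Proof. intros N. induction 1; intros; auto. apply IHsteps. now apply (reach_zstep prog h c1 c2). Qed.

Lemma zero_test_halts a b : peval f [a; b] 0 -> reach zero_test halt_pc (0, enc (input a b)).
Proof.
  intros E. eapply steps_reach; [apply zero_test_run, E|].
  destruct zero_test_placed as (_ & P2 & P3).
  eapply reach_step; [eapply zstep_dec0; [exact P2|reflexivity]|].
  eapply steps_reach; [eapply (compile_correct cleanup); [|exact P3]|].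
  - eapply ex_seq; apply clear_spec; try lia; reflexivity.
  - match goal with |- reach _ _ (_, enc ?s) => replace (enc s) with v0 end; [constructor|].
    apply functional_extensionality; intros [|[|[|i]]]; reflexivity.
Qed.

Lemma zero_test_stuck a b : peval f [a; b] 1 -> ~ reach zero_test halt_pc (0, enc (input a b)).
Proof.
  intros E R. eapply steps_reach_inv in R; [|apply halt_pc_none|apply zero_test_run, E].
  destruct zero_test_placed as (_ & P2 & _).
  assert (Z : zstep zero_test (K, enc (upd (input a b) 2 1)) =
              Some (S halt_pc, enc (upd (upd (input a b) 2 1) 2 0))).
  { apply (zstep_decS _ _ 2 (S halt_pc) (S K) _ 0 P2). reflexivity. }
  apply (reach_zstep _ _ _ _ halt_pc_none Z) in R.
  remember (S halt_pc, enc (upd (upd (input a b) 2 1) 2 0)) as c eqn:Ec.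
  destruct R as [|c c' S' _]; [apply (f_equal fst) in Ec; cbn [fst] in Ec; lia|subst c].
  - unfold zstep in S'. cbn [fst] in S'.
    rewrite (proj2 (nth_error_None zero_test (S halt_pc))) in S' by (rewrite zero_test_length; lia).
    discriminate.
Qed.
End Machine.

Lemma enc_input a b : enc (input a b) = init_vec (2 ^ a - 1) (2 ^ b - 1).
Proof.
  assert (E : forall k, (2 ^ Z.of_nat k - 1)%Z = Z.of_nat (2 ^ k - 1)).
  { intros k. pose proof (Nat.pow_nonzero 2 k). rewrite Nat2Z.inj_sub by lia. now rewrite Nat2Z.inj_pow. }
  apply functional_extensionality; intros [|[|i]]; unfold enc, init_vec; simpl input; try apply E.
Qed.

Lemma letters_bounded (ws : list word) : exists B, forall w, In w ws -> Forall (fun l : letter => fst l < B) w.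
Proof.
  induction ws as [|w ws [B HB]]; [exists 0; intros ? []|].
  assert (Hw : exists B', Forall (fun l : letter => fst l < B') w).
  { induction w as [|l w [B' HB']]; [exists 0; constructor|].
    exists (S (fst l) + B'). constructor; [lia|]. eapply Forall_impl; [|exact HB']. simpl; intros; lia. }
  destruct Hw as [B' HB']. exists (B + B'). intros v [<-|Iv].
  - eapply Forall_impl; [|exact HB']. simpl; intros; lia.
  - eapply Forall_impl; [|exact (HB v Iv)]. simpl; intros; lia.
Qed.

Lemma registers_bounded (prog : list instr) : exists d, 2 <= d /\ forall p a i, nth_error prog p = Some a ->
  (exists q, a = INC i q) \/ (exists q z, a = DEC i q z) -> i < d.
Proof.
  induction prog as [|a prog (d & Hd & H)].
  - exists 2. split; [lia|]. intros [|p]; discriminate.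
  - set (r := match a with INC i _ => i | DEC i _ _ => i end).
    exists (d + S r). split; [lia|]. intros [|p] a' i E Hi.
    + injection E as <-. destruct Hi as [[q ->]|(q & z & ->)]; simpl in r; subst r; lia.
    + specialize (H p a' i E Hi). lia.
Qed.

Lemma Forall_winv (p : nat -> Prop) w : Forall (fun l : letter => p (fst l)) w ->
  Forall (fun l : letter => p (fst l)) (winv w).
Proof. intros H. apply Forall_rev, Forall_map. exact H. Qed.

Lemma Forall_eqn (p : nat -> Prop) u v : Forall (fun l : letter => p (fst l)) u ->
  Forall (fun l : letter => p (fst l)) v -> Forall (fun l : letter => p (fst l)) (eqn u v).
Proof. intros Hu Hv. apply Forall_app. split; [exact Hu|now apply Forall_winv]. Qed.

Lemma Forall_vword (p : nat -> Prop) x0 x1 t c A B : p x0 -> p x1 -> p t -> p c ->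
  Forall (fun l : letter => p (fst l)) (vword x0 x1 t c A B).
Proof.
  intros H0 H1 Ht Hc. apply Forall_forall. intros l I. unfold vword in I.
  rewrite !in_app_iff in I. cbn [In] in I. rewrite !in_app_iff in I.
  destruct I as [I|[I|[<-|[I|[I|[<-|[]]]]]]]; try (apply repeat_spec in I; subst l); assumption.
Qed.

Lemma collapse_rels_bounded Nb w : 2 <= Nb -> In w (collapse_rels Nb) ->
  Forall (fun l : letter => fst l < 5 + 3 * Nb) w.
Proof.
  intros HN. set (ok := fun m => m < 5 + 3 * Nb).
  assert (HB : forall v u b, Forall (fun l : letter => ok (fst l)) v -> Forall (fun l : letter => ok (fst l)) u ->
     ok b -> forall w, In w (braid_words v u b) -> Forall (fun l : letter => ok (fst l)) w).
  { intros v u b Hv Hu Hb w' [<-|[<-|[]]]; apply Forall_eqn; repeat (apply Forall_app; split); auto. }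
  assert (HG : forall y, y < Nb -> ok (gb y)) by (intros; unfold ok, gb; lia).
  assert (HE : forall y, y < Nb -> ok (eb y)) by (intros; unfold ok, eb; lia).
  assert (HBb : forall y, y < Nb -> ok (bb y)) by (intros; unfold ok, bb; lia).
  assert (H5 : forall y, y < 5 -> ok y) by (intros; unfold ok; lia).
  assert (Hk : ok (gb kb)) by (apply HG; unfold kb; lia).
  assert (Hc : ok (gb cb)) by (apply HG; unfold cb; lia).
  assert (He0 : ok e0) by (apply H5; unfold e0; lia).
  assert (Hff : ok ff) by (apply H5; unfold ff; lia).
  assert (Hzz : ok zz) by (apply H5; unfold zz; lia).
  assert (Hb0 : ok b0) by (apply H5; unfold b0; lia).
  assert (Hbz : ok bz) by (apply H5; unfold bz; lia).
  unfold collapse_rels. rewrite !in_app_iff. intros [I|[I|[[<-|[]]|I]]].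
  - revert w I. apply HB; [..|assumption]; repeat (apply Forall_cons; [assumption|]); apply Forall_nil.
  - revert w I. apply HB; [..|assumption]; repeat (apply Forall_cons; [assumption|]); apply Forall_nil.
  - apply (Forall_eqn ok); repeat (apply Forall_cons; [assumption|]); apply Forall_nil.
  - apply in_flat_map in I as (y & Iy & I). apply in_seq in Iy.
    pose proof (HG y ltac:(lia)). pose proof (HE y ltac:(lia)). pose proof (HBb y ltac:(lia)).
    destruct I as [<-|I].
    + apply (Forall_eqn ok); repeat (apply Forall_cons; [assumption|]); apply Forall_nil.
    + revert w I. apply HB; [..|assumption]; repeat (apply Forall_cons; [assumption|]); apply Forall_nil.
Qed.

Definition copies (n : nat) : list (nat * nat * nat * nat) :=
  map (fun c => (slot n c (gb (xb 0)), slot n c (gb (xb 1)), slot n c (gb (tb 0)), slot n c (gb cb))) (seq 0 n).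

Lemma vwords_copies n A B : vwords (copies n) A B = map (fun c => wmap (slot n c) (var_word A B)) (seq 0 n).
Proof.
  unfold vwords, copies, var_word. rewrite map_map. apply map_ext. intros c. now rewrite wmap_vword.
Qed.
End Diagonal.

Theorem mainTheorem17 (n : nat) (hn : (1 <= n)%nat) :
  ~ exists e : prf, decides e (fun P => Hinf_vanishes P n).
Proof.
  intros [e He].
  set (f := PComp e [ppres (copies n)]).
  set (prog := zero_test f). set (halt := halt_pc f).
  destruct (registers_bounded prog) as (d & Hd & Hreg).
  destruct (letters_bounded (base_rels d halt prog)) as [Nb0 HNb].
  (* Six base generators at least, since [xb 1], which occurs in [var_word], has number 5. *)
  set (Nb := (6 + Nb0)%nat). set (N := (5 + 3 * Nb)%nat).
  set (fixed := machine_rels Nb d halt prog).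
  set (rest := flat_map (fun r => map (fun c => wmap (slot n c) r) (seq 0 n)) fixed ++ comm_rels n N).
  (* There is no circularity: [prog], [N] and [rest] are fixed before the input exists, and only the
     copies of [var_word] mention [A] and [B]. *)
  set (g := (N * n)%nat). set (r := code_list (map code_word rest)).
  set (A := (2 ^ g - 1)%nat). set (B := (2 ^ r - 1)%nat).
  set (rels := var_word A B :: fixed).
  set (P := Pres g (vwords (copies n) A B ++ rest)).
  assert (Hpow : is_power n N P rels).
  { split; [reflexivity|]. intros w. unfold P; cbn [prels]. rewrite vwords_copies.
    unfold rest. rewrite !in_app_iff, in_map_iff, in_flat_map. split.
    - intros [(c & <- & Ic)|[(w' & Iw & I)|I]].
      + left. exists (var_word A B), c. apply in_seq in Ic. repeat split; [now left|lia].
      + left. apply in_map_iff in I as (c & <- & Ic). apply in_seq in Ic.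
        exists w', c. repeat split; [now right|lia].
      + now right.
    - intros [(w' & c & [<-|Iw] & Hc & ->)|I].
      + left. exists c. split; [reflexivity|apply in_seq; lia].
      + right; left. exists w'. split; [exact Iw|]. apply in_map_iff. exists c. split; [reflexivity|apply in_seq; lia].
      + now right; right. }
  assert (Hbound : forall w, In w rels -> Forall (fun l : letter => (fst l < N)%nat) w).
  { intros w [<-|I].
    - apply (Forall_vword (fun m => (m < N)%nat)); unfold N, Nb, gb, xb, tb, cb; lia.
    - unfold fixed, machine_rels in I. apply in_app_or in I as [I|I].
      + apply in_map_iff in I as (w' & <- & I). apply Forall_map.
        eapply Forall_impl; [|exact (HNb w' I)]. intros l Hl. cbv beta in Hl. cbn [fst]. unfold gb, N, Nb. lia.
      + apply collapse_rels_bounded; [unfold Nb; lia|exact I]. }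
  assert (HV : valid_pres P).
  { apply Forall_forall. intros w I. apply (proj2 Hpow) in I as [(w' & c & I & Hc & ->)|I].
    - apply Forall_map. eapply Forall_impl; [|exact (Hbound w' I)]. intros l Hl. simpl.
      now apply slot_lt.
    - apply in_flat_map in I as (i & Ii & I). apply in_map_iff in I as (j & <- & Ij).
      apply filter_In in Ij as [Ij _]. apply in_seq in Ii, Ij.
      apply (Forall_eqn (fun m => (m < pgens P)%nat)); repeat (apply Forall_cons; [unfold P, g; cbn [pgens fst pw]; lia|]); apply Forall_nil. }
  assert (Hcode : peval (ppres (copies n)) [g; r] (code_pres P)) by apply peval_pres.
  pose proof (enc_input g r) as Hin. fold A in Hin. fold B in Hin.
  destruct (He P HV) as [Hyes Hno].
  destruct (classic (Hinf_vanishes P n)) as [V|V].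
  (* If the cohomology vanishes, the procedure answers 1 and the machine gets stuck; then each copy
     has an element of infinite order, so the cohomology does not vanish. *)
  - assert (NR : ~ reach prog halt (O, init_vec A B)).
    { rewrite <- Hin. apply zero_test_stuck. eapply peval_c1; [exact Hcode|now apply Hyes]. }
    destruct (model Nb d halt prog A B (halt_pc_none f) NR) as (G & nu & H1 & H2 & H3).
    apply (infinite_not_vanishes n N P) with (rels := rels) (G := G) (nu := nu) (w0 := wword); auto.
    + intros w [<-|I]; auto.
    + repeat (apply Forall_cons; [simpl; unfold N, Nb, gb, kb, cb; lia|]); apply Forall_nil.
  (* Otherwise the answer is 0, the machine halts, and the group is trivial, so the cohomology
     vanishes after all. *)
  - apply V. apply (trivial_vanishes n N P) with (rels := rels); auto.
    intros G nu HR. apply (collapse Nb d halt prog A B); auto.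
    + intros w I. apply HR. now right.
    + apply HR. now left.
    + rewrite <- Hin. apply zero_test_halts. eapply peval_c1; [exact Hcode|now apply Hno].
Qed.
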